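(* Let $0<\nu\le\frac12$, and let $r$ and $u_0$ be positive constants. Consider the Caputo time-fractional moving boundary (Stefan) problem of finding $u(x,t)$ and the moving boundary $\eta(t)$ such that $$ \begin{cases} {}^{C}_{0}D_t^{2\nu}u=\dfrac{\partial^2u}{\partial x^2}, & 0<x<\eta(t),\ t>0,\\ u(x,0)=u_0\,\chi_{(0,\infty)}(x), & 0\le x<\infty,\\ u(0,t)=1,\quad u(\eta(t),t)=0, & t>0,\\ {}^{C}_{0}D_t^{2\nu}\eta(t)=-\dfrac1r\,\dfrac{\partial u}{\partial x}(\eta(t),t), & t>0. \end{cases} $$ With the ansatz $\eta(t)=2\alpha t^\nu$ for a constant $\alpha$ to be determined, the condition $u(\eta(t),t)=0$ and the last (fractional Stefan) condition become, respectively, $$ W(-2\alpha;-\nu,1)=-\frac{u_0}{1-u_0},\qquad \frac{2\alpha r\,\Gamma(1+\nu)}{(1-u_0)\Gamma(1-\nu)}=W(-2\alpha;-\nu,1-\nu), $$ so that $$ u_0=-\frac{W(-2\alpha;-\nu,1)}{1-W(-2\alpha;-\nu,1)},\qquad 1-u_0=\frac{1}{1-W(-2\alpha;-\nu,1)}, $$ and the analytical solution of the moving boundary problem is $$ u(x,t)=\frac{R_{1,\nu}(x,t)-W(-2\alpha;-\nu,1)}{1-W(-2\alpha;-\nu,1)},\qquad \eta(t)=2\alpha t^{\nu}, $$ where $\alpha$ satisfies the transcendental equation $$ \frac{2\alpha r\,\Gamma(1+\nu)}{\Gamma(1-\nu)}\,\big[1-W(-2\alpha;-\nu,1)\big]=W(-2\alpha;-\nu,1-\nu).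 $$
   Context: $\chi_A$ is the indicator function of the set $A$: $\chi_A(x)=1$ if $x\in A$ and $\chi_A(x)=0$ otherwise. The Caputo derivative of order $\mu$ with $0<\mu\le1$ is ${}^{C}_{0}D_t^{\mu}y(t)=\frac{1}{\Gamma(1-\mu)}\int_0^t(t-\tau)^{-\mu}y'(\tau)\,d\tau$ for $0<\mu<1$ and $y'(t)$ for $\mu=1$; applied to $u(x,t)$ it acts in $t$ with $x$ fixed. The Wright function is $W(z;\alpha',\beta')=\sum_{j=0}^\infty\frac{z^j}{j!\,\Gamma(\alpha'j+\beta')}$ with $\alpha'>-1$, where $1/\Gamma$ is $0$ at the poles of the Euler gamma function $\Gamma$. For $\mu\ge0$, $0<\nu\le1$, $a>0$, $R_{\mu,\nu}(a,t)$ denotes the inverse Laplace transform (from $s$ to $t$) of $s^{-\mu}e^{-as^\nu}$; in particular $R_{1,\nu}(x,\cdot)$ has Laplace transform $s^{-1}e^{-xs^\nu}$. Its value at $x=0$ is the limit as $x\to0^+$.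
   Formalization: The derivation and uniqueness are for bounded u solving the equation for all x>0, regular enough for the Laplace transform in t (with the equation only on 0<x<η(t) they fail); α>0 is assumed, u0≠1 where 1-u0 divides, and u0>0 is dropped, as α>0 forces u0<0. *)

(* Defs.v *)
(* MathComp-Analysis *)
From mathcomp Require Import all_boot all_order all_algebra.
From mathcomp Require Import all_classical all_reals all_analysis.

Set Implicit Arguments.
Unset Strict Implicit.
Unset Printing Implicit Defensive.

Import Order.TTheory GRing.Theory Num.Theory.
Import numFieldNormedType.Exports.

Local Open Scope classical_set_scope.
Local Open Scope ring_scope.

Section special_functions.
Context {R : realType}.
Local Notation leb := (@lebesgue_measure R).

Definition euler_integral (x : R) : R :=
  \int[leb]_(t in `]0, +oo[) (t `^ (x - 1) * expR (- t)).

(* For x <= 0 the value is that of the n-fold iterated recurrence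
   Gamma(y + 1) = y Gamma(y), with n a natural number such that 0 < x + n.
   At a pole the product vanishes, so Gamma x = 0 and (Gamma x)^-1 = 0, which
   is the convention 1/Gamma = 0 at the poles. *)
Definition Gamma (x : R) : R :=
  if 0 < x then euler_integral x
  else let n := Num.bound x in
       euler_integral (x + n%:R) / \prod_(k < n) (x + k%:R).

(* The series converges absolutely whenever -1 < a. *)
Definition Wright (z a b : R) : R :=
  limn (series (fun j : nat => z ^+ j / (j`!%:R * Gamma (a * j%:R + b)))).

Definition laplace (f : R -> R) (s : R) : R :=
  \int[leb]_(t in `]0, +oo[) (expR (- (s * t)) * f t).

Definition laplace_integrable (f : R -> R) (s : R) : Prop :=
  leb.-integrable `]0, +oo[ (EFin \o (fun t => expR (- (s * t)) * f t)).

Definition is_inverse_laplace (F f : R -> R) : Prop :=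
  (forall t, 0 < t -> {for t, continuous f}) /\
  (forall s, 0 < s -> laplace_integrable f s /\ laplace f s = F s).

(* The inverse Laplace transform as a function of t > 0: by Lerch's theorem a
   function continuous on ]0, +oo[ is determined there by its transform on
   s > 0, so only values at t <= 0 are left unspecified. *)
Definition inverse_laplace (F : R -> R) : R -> R :=
  xget (cst 0) [set f | is_inverse_laplace F f].

(* For nu < 1 and a > 0 the inverse transform has a continuous representative
   and its abscissa of convergence is at most 0. *)
Definition Rfun (mu nu a t : R) : R :=
  let R_pos b := inverse_laplace (fun s => s `^ (- mu) * expR (- (b * s `^ nu))) in
  if 0 < a then R_pos a t else lim (R_pos b t @[b --> 0^'+]).

End special_functions.

Section caputo.
Context {R : realType}.
Local Notation leb := (@lebesgue_measure R).

Definition caputo (mu : R) (y : R -> R) (t : R) : R :=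
  if mu == 1 then derive1 y t
  else (Gamma (1 - mu))^-1 *
       \int[leb]_(tau in `]0, t[) ((t - tau) `^ (- mu) * derive1 y tau).

(* derive1 and the Lebesgue integral are total functions: this says that the
   expression defining the Caputo derivative is meaningful. *)
Definition caputo_derivable (mu : R) (y : R -> R) (t : R) : Prop :=
  if mu == 1 then derivable y t 1
  else (forall tau, 0 < tau < t -> derivable y tau 1) /\
       leb.-integrable `]0, t[
         (EFin \o (fun tau => (t - tau) `^ (- mu) * derive1 y tau)).

End caputo.

Section stefan.
Context {R : realType}.
Implicit Types (u : R -> R -> R) (eta : R -> R).

(* In u x t the first argument is space and the second one is time. *)

Definition dx u (x t : R) : R := derive1 (u^~ t) x.
Definition dxx u (x t : R) : R := derive1 (dx u ^~ t) x.

Definition twice_derivable (f : R -> R) (x : R) : Prop :=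
  (\forall y \near x, derivable f y 1) /\ derivable (derive1 f) x 1.

Definition diffusion_eq (nu : R) u (x t : R) : Prop :=
  [/\ caputo_derivable (2 * nu) (u x) t, twice_derivable (u^~ t) x &
      caputo (2 * nu) (u x) t = dxx u x t].

(* The second clause says that the initial datum is attained continuously; it
   is not asked at x = 0, where the datum 0 is incompatible with u(0, t) = 1. *)
Definition initial_condition (u0 : R) u : Prop :=
  (forall x, 0 <= x -> u x 0 = u0 * \1_(`]0, +oo[%classic : set R) x) /\
  (forall x, 0 < x -> u x t @[t --> 0^'+] --> u x 0).

Definition fixed_boundary_condition u : Prop :=
  forall t, 0 < t -> u 0 t = 1 /\ (u x t @[x --> 0^'+] --> u 0 t).

Definition moving_boundary_condition u eta : Prop :=
  forall t, 0 < t -> u (eta t) t = 0.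

Definition stefan_condition (nu r : R) u eta : Prop :=
  forall t, 0 < t ->
    [/\ caputo_derivable (2 * nu) eta t, derivable (u^~ t) (eta t) 1 &
        caputo (2 * nu) eta t = - (r^-1 * dx u (eta t) t)].

Definition stefan_problem (nu r u0 : R) u eta : Prop :=
  [/\ forall x t, 0 < t -> 0 < x < eta t -> diffusion_eq nu u x t,
      initial_condition u0 u,
      fixed_boundary_condition u,
      moving_boundary_condition u eta &
      stefan_condition nu r u eta].

(* The functions to which the Laplace transform method applies: bounded
   solutions, C^1 in t on the whole half-line, of the diffusion equation with
   the given initial datum and boundary value at x = 0, such that u_t and u_xx
   have Laplace transforms in t and the transform commutes with d^2/dx^2.  On
   0 < x < eta(t) alone the equation and the boundary values do not determine
   u, and do not tie u0 to eta, since no point (x, 0) with x > 0 is in the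
   closure of that region. *)
Definition half_line_solution (nu u0 : R) u : Prop :=
  [/\ forall x t, 0 < x -> 0 < t ->
        diffusion_eq nu u x t /\ {for t, continuous (derive1 (u x))},
      initial_condition u0 u,
      fixed_boundary_condition u,
      exists M, forall x t, 0 < x -> 0 < t -> `|u x t| <= M &
      forall x s, 0 < x -> 0 < s ->
        [/\ laplace_integrable (derive1 (u x)) s,
            laplace_integrable (dxx u x) s,
            twice_derivable (fun y => laplace (u y) s) x &
            derive1 (derive1 (fun y => laplace (u y) s)) x = laplace (dxx u x) s]].

End stefan.

(* Main.v *)
Require Import Defs.
From mathcomp Require Import all_boot all_order all_algebra.
From mathcomp Require Import all_classical all_reals all_analysis.
From mathcomp Require Import measurable_realfun lebesgue_integral_under.
From mathcomp Require Import ring lra.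
Import Order.TTheory GRing.Theory Num.Theory.
Import numFieldNormedType.Exports.
Local Open Scope classical_set_scope.
Local Open Scope ring_scope.

Set Implicit Arguments.
Unset Strict Implicit.
Unset Printing Implicit Defensive.

(** The Laplace transform in t turns the diffusion equation into the ordinary
    differential equation V'' = s^{2 nu} V for V = laplace (u x) s - u0 / s.  Its
    bounded solutions are multiples of e^{-x s^nu}, and the boundary value 1 at
    x = 0 fixes the factor.  So a half-line solution can only be
    u = u0 + (1 - u0) f, where f is the inverse transform of s^{-1} e^{-x s^nu}
    ([uniqueness]); conversely this u, with the prescribed values at x = 0 and
    t = 0, is one ([solution_half_line]).  Both f and t^nu f_x are functions of z = x t^{-nu}, namely the Wright functions
    W(-z; -nu, 1) and - W(-z; -nu, 1 - nu).  On the curve x = 2 alpha t^nu, z is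
    constant, and the Caputo derivative of t^nu is a multiple of t^{-nu}
    ([caputo_power]); hence the two conditions on the moving boundary become the
    two equations between numbers, and the rest is algebra.

    The substance is the construction of f with all the regularity that the
    Stefan problem asks for, collected in [fundamental_solution].  It is the
    Bromwich integral of s^{-1} e^{-x s^nu} e^{st}, with the vertical line folded
    onto two rays arg s = Th and arg s = - Th in the left half-plane.  There e^{st}
    decays, and e^{-x s^nu} does not grow because nu <= 1 / 2, so in the coordinate
    v = ln |s| one has integrals over the real line dominated by 1 / cosh: they
    can be differentiated in x and t and bounded under the integral sign.  The
    functions [stab] are these integrals for s^{g-1} e^{-x s^nu}, and a derivative
    in x or t only shifts g.

    Holomorphy enters at a single point, [cauchy_ray]: for F holomorphic in a
    sector, the integral over v of the imaginary part of F (w) / (1 - p e^{-w}),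
    w = v + i th, does not depend on th by the Cauchy-Riemann equations, and its
    limit as th -> 0 is - pi F (ln p).  By Fubini this says that the ray integral
    of F has Laplace transform F (ln p) at p ([laplace_ray_transform]).
    Identities between functions of t then follow from equality of transforms by
    Lerch's theorem ([lerch]): Hankel's formula t^{-g} / Gamma (1 - g) for the
    integrals at x = 0 ([stab0_Gamma]) and the value of the Abel integral in the
    Caputo derivative ([abel_stab]).  Expanding e^{-x s^nu} in powers of x and
    applying Hankel's formula termwise gives the Wright series ([Wright_stab]). *)

(** * Integrals of real-valued functions *)

Section integration_tools.
Context {R : realType}.
Local Notation leb := (@lebesgue_measure R).

Lemma integrable_bounded_by (D : set R) (f g : R -> R) :
  measurable D -> measurable_fun D f -> leb.-integrable D (EFin \o g) ->
  (forall x, D x -> `|f x| <= g x) -> leb.-integrable D (EFin \o f).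
Proof.
move=> mD mf ig fg; apply: le_integrable ig => //.
  exact/measurable_EFinP.
move=> x Dx /=; rewrite lee_fin.
by apply: (le_trans (fg _ Dx)); rewrite ler_norm.
Qed.

Lemma Rintegral_dominated_cvg (D : set R) (f_ : nat -> R -> R) (f g : R -> R) :
  measurable D -> (forall n, measurable_fun D (f_ n)) ->
  leb.-integrable D (EFin \o g) ->
  (forall n x, D x -> `|f_ n x| <= g x) ->
  (forall x, D x -> f_ n x @[n --> \oo] --> f x) ->
  leb.-integrable D (EFin \o f) /\
  (\int[leb]_(x in D) f_ n x @[n --> \oo] --> \int[leb]_(x in D) f x).
Proof.
move=> mD mf ig fg cf.
have mF n : measurable_fun D (EFin \o f_ n) by exact/measurable_EFinP.
have cF x : D x -> (EFin \o f_ n) x @[n --> \oo] --> (EFin \o f) x.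
  by move=> Dx; apply: cvg_EFin; [exact: nearW|exact: cf].
have FG n x : D x -> (`|(EFin \o f_ n) x| <= (EFin \o g) x)%E.
  by move=> Dx; rewrite /= lee_fin fg.
have mf' : measurable_fun D (EFin \o f).
  apply: emeasurable_fun_cvg; first exact: mF.
  by move=> x Dx; exact: cF.
have fi : leb.-integrable D (EFin \o f).
  apply: le_integrable ig => // x Dx /=.
  rewrite lee_fin (le_trans _ (ler_norm _))//.
  by apply: (cvgr_to_le (cvg_norm (cf x Dx))); apply: nearW => n; exact: fg.
split => //; apply: fine_cvg; rewrite /Rintegral fineK; last first.
  exact: integrable_fin_num fi.
exact: (@dominated_cvg _ _ _ leb D mD (fun n => EFin \o f_ n) _ (EFin \o g)).
Qed.

Lemma leb_integrableZl (D : set R) (k : R) (f : R -> R) : measurable D ->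
  leb.-integrable D (EFin \o f) ->
  leb.-integrable D (EFin \o (fun x => k * f x)).
Proof. by move=> mD fi; exact: (integrableZl (mu := leb) mD k fi). Qed.

Lemma leb_integrableD (D : set R) (f g : R -> R) : measurable D ->
  leb.-integrable D (EFin \o f) -> leb.-integrable D (EFin \o g) ->
  leb.-integrable D (EFin \o (fun x => f x + g x)).
Proof. by move=> mD fi gi; exact: (integrableD (mu := leb) mD fi gi). Qed.

Lemma leb_integrableB (D : set R) (f g : R -> R) : measurable D ->
  leb.-integrable D (EFin \o f) -> leb.-integrable D (EFin \o g) ->
  leb.-integrable D (EFin \o (fun x => f x - g x)).
Proof. by move=> mD fi gi; exact: (integrableB (mu := leb) mD fi gi). Qed.

Lemma leb_integrable_norm (D : set R) (f : R -> R) :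
  leb.-integrable D (EFin \o f) ->
  leb.-integrable D (EFin \o (fun x => `|f x|)).
Proof. by move=> fi; exact: (integrable_norm (mu := leb)). Qed.

Lemma eq_leb_integrable (D : set R) (f g : R -> R) : measurable D ->
  (forall x, D x -> f x = g x) ->
  leb.-integrable D (EFin \o f) -> leb.-integrable D (EFin \o g).
Proof.
move=> mD fg; apply: (eq_integrable (mu := leb) mD).
by move=> x; rewrite inE => /fg /= ->.
Qed.

Lemma leb_integrable_measurable (D : set R) (f : R -> R) :
  leb.-integrable D (EFin \o f) -> measurable_fun D f.
Proof. by move=> /integrableP[mf _]; exact/measurable_EFinP. Qed.

Lemma leb_integrable_mkcond (D : set R) (f : R -> R) : measurable D ->
  leb.-integrable D (EFin \o f) <-> leb.-integrable setT (EFin \o (f \_ D)).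
Proof.
move=> mD; rewrite (@integrable_mkcond _ _ _ leb D _ mD).
have -> // : EFin \o (f \_ D) = (EFin \o f) \_ D.
by apply/funext => x /=; rewrite !patchE; case: ifP.
Qed.

Lemma leb_integrableS (D E : set R) (f : R -> R) : measurable D ->
  measurable E -> D `<=` E ->
  leb.-integrable E (EFin \o f) -> leb.-integrable D (EFin \o f).
Proof. by move=> mD mE DE fi; exact: (integrableS (mu := leb) mE mD DE fi). Qed.

Lemma leb_RintegralZl (D : set R) (k : R) (f : R -> R) : measurable D ->
  leb.-integrable D (EFin \o f) ->
  \int[leb]_(x in D) (k * f x) = k * \int[leb]_(x in D) f x.
Proof. by move=> mD fi; exact: (RintegralZl (mu := leb)). Qed.

Lemma leb_RintegralD (D : set R) (f g : R -> R) : measurable D ->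
  leb.-integrable D (EFin \o f) -> leb.-integrable D (EFin \o g) ->
  \int[leb]_(x in D) (f x + g x) =
  \int[leb]_(x in D) f x + \int[leb]_(x in D) g x.
Proof. by move=> mD fi gi; exact: (RintegralD (mu := leb)). Qed.

Lemma leb_RintegralB (D : set R) (f g : R -> R) : measurable D ->
  leb.-integrable D (EFin \o f) -> leb.-integrable D (EFin \o g) ->
  \int[leb]_(x in D) (f x - g x) =
  \int[leb]_(x in D) f x - \int[leb]_(x in D) g x.
Proof. by move=> mD fi gi; exact: (RintegralB (mu := leb)). Qed.

Lemma leb_le_Rintegral (D : set R) (f g : R -> R) : measurable D ->
  leb.-integrable D (EFin \o f) -> leb.-integrable D (EFin \o g) ->
  (forall x, D x -> f x <= g x) ->
  \int[leb]_(x in D) f x <= \int[leb]_(x in D) g x.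
Proof. by move=> mD fi gi fg; exact: (le_Rintegral (mu := leb)). Qed.

Lemma leb_norm_Rintegral_le (D : set R) (f g : R -> R) : measurable D ->
  leb.-integrable D (EFin \o f) -> leb.-integrable D (EFin \o g) ->
  (forall x, D x -> `|f x| <= g x) ->
  `|\int[leb]_(x in D) f x| <= \int[leb]_(x in D) g x.
Proof.
move=> mD fi gi fg; apply: (le_trans (le_normr_Rintegral (mu := leb) mD fi)).
apply: leb_le_Rintegral => //; exact: leb_integrable_norm.
Qed.

Lemma eq_leb_Rintegral (D : set R) (f g : R -> R) :
  (forall x, D x -> f x = g x) ->
  \int[leb]_(x in D) f x = \int[leb]_(x in D) g x.
Proof. by move=> fg; apply: eq_Rintegral => x; rewrite inE; exact: fg. Qed.

(** Tonelli needs the iterated integral of |f| in only one order: a bound g on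
    the inner integrals makes f integrable on the product. *)
Lemma Rintegral_fubini (D E : set R) (f : R -> R -> R) (g : R -> R) :
  measurable D -> measurable E ->
  measurable_fun (D `*` E) (fun z => f z.1 z.2) ->
  (forall x, D x -> leb.-integrable E (EFin \o f x)) ->
  (forall y, E y -> leb.-integrable D (EFin \o f ^~ y)) ->
  leb.-integrable E (EFin \o g) ->
  (forall y, E y -> \int[leb]_(x in D) `|f x y| <= g y) ->
  leb.-integrable D (EFin \o (fun x => \int[leb]_(y in E) f x y)) /\
  \int[leb]_(x in D) \int[leb]_(y in E) f x y =
  \int[leb]_(y in E) \int[leb]_(x in D) f x y.
Proof.
move=> mD mE mf iE iD ig fg.
pose F (z : R * R) : \bar R := ((fun z => f z.1 z.2) \_ (D `*` E) z)%:E.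
have mF : measurable_fun
    (setT : set (measurableTypeR R * measurableTypeR R)%type) F.
  apply/measurable_EFinP; apply: (measurable_restrictT _ _).1 => //.
  exact: measurableX.
have FE x y : F (x, y) = if x \in D then
    (if y \in E then (f x y)%:E else 0%E) else 0%E.
  rewrite /F patchE /= in_setX /=.
  by case: (x \in D) => //=; case: (y \in E).
have F1 x : (\int[leb]_y F (x, y) =
    if x \in D then (\int[leb]_(y in E) f x y)%:E else 0)%E.
  case: ifPn => xD; last first.
    by rewrite integral0_eq// => y _; rewrite FE (negPf xD).
  rewrite /Rintegral fineK; last first.
    by apply: integrable_fin_num => //; apply: iE; exact: set_mem.
  rewrite [RHS]integral_mkcond; apply: eq_integral => y _.
  by rewrite FE xD patchE.
have F2 y : (\int[leb]_x F (x, y) =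
    if y \in E then (\int[leb]_(x in D) f x y)%:E else 0)%E.
  case: ifPn => yE; last first.
    by rewrite integral0_eq// => x _; rewrite FE (negPf yE) if_same.
  rewrite /Rintegral fineK; last first.
    by apply: integrable_fin_num => //; apply: iD; exact: set_mem.
  rewrite [RHS]integral_mkcond; apply: eq_integral => x _.
  by rewrite FE yE patchE.
have absF y : (\int[leb]_x `|F (x, y)| =
    if y \in E then (\int[leb]_(x in D) `|f x y|)%:E else 0)%E.
  case: ifPn => yE; last first.
    by rewrite integral0_eq// => x _; rewrite FE (negPf yE) if_same abse0.
  rewrite /Rintegral fineK; last first.
    apply: integrable_fin_num => //.
    by apply: (integrable_norm (mu := leb)); apply: iD; exact: set_mem.
  rewrite [RHS]integral_mkcond; apply: eq_integral => x _.
  by rewrite FE yE patchE; case: ifP => // _; rewrite abse0.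
have iF : (leb \x leb)%E.-integrable setT F.
  apply/integrable21ltyP => //.
  have /integrableP[mg] := (@integrable_mkcond _ _ _ leb E _ mE).1 ig.
  apply: le_lt_trans; apply: ge0_le_integral => //.
  - by move=> x _; exact: integral_ge0.
  - apply: (@measurable_fun_fubini_tonelli_G _ _ (measurableTypeR R)
      (measurableTypeR R) R leb (abse \o F)) => //=.
    exact: measurableT_comp.
  - exact: measurableT_comp.
  - move=> y _; rewrite absF patchE; case: ifPn => [yE|_]; last by rewrite abse0.
    rewrite /= lee_fin (le_trans _ (ler_norm _))// fg//; exact: set_mem.
have mFu := Fubini iF; have iG := integrable_fubini_F iF.
split.
  apply/(@integrable_mkcond _ _ _ leb D _ mD); move: iG; congr (_.-integrable _ _).
  by apply/funext => y; rewrite /fubini_F F1 patchE.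
move: mFu; under eq_integral do rewrite F1.
under [in RHS]eq_integral do rewrite F2.
move=> mFu; rewrite /Rintegral integral_mkcond [in RHS]integral_mkcond.
congr fine; etransitivity; first etransitivity; [|exact: mFu|].
- by apply: eq_integral => x _; rewrite patchE.
- by apply: eq_integral => x _; rewrite patchE.
Qed.

End integration_tools.

(** * Affine changes of variable *)

Section improper.
Context {R : realType}.
Local Notation leb := (@lebesgue_measure R).

(** The image of Lebesgue measure under x |-> a x + b, scaled by |a|, has the
    right value on half-open intervals, hence is Lebesgue measure. *)
Lemma ge0_integral_affine (f : R -> \bar R) (a b : R) : a != 0 ->
  measurable_fun setT f -> (forall x, (0 <= f x)%E) ->
  (\int[leb]_x f (a * x + b)%R = (`|a|^-1)%:E * \int[leb]_x f x)%E.
Proof.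
move=> a0 mf f0; pose phi (x : measurableTypeR R) : measurableTypeR R := a * x + b.
have mphi : measurable_fun setT phi.
  have cphi : continuous (fun x : R => a * x + b).
    move=> x; apply: cvgD; last exact: cvg_cst.
    by apply: cvgM; [exact: cvg_cst|exact: cvg_id].
  exact: (continuous_measurable_fun cphi).
have na0 : 0 < `|a| by rewrite normr_gt0.
pose na : {nonneg R} := NngNum (ltW na0).
pose push : {measure set (measurableTypeR R) -> \bar R} :=
  measure_function_pushforward__canonical__measure_function_Measure leb mphi.
pose mu : {measure set (measurableTypeR R) -> \bar R} := mscale na push.
have muE : forall A, measurable A -> leb A = mu A.
  apply: lebesgue_measure_unique => X [[c d] _ <-] /=.
  rewrite /mu /= /mscale /push /= /pushforward.
  have [cd|dc] := ltP c d; last first.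
    rewrite set_itv_ge ?bnd_simp -?leNgt// preimage_set0 !measure0 mule0//.
  have [a_gt|a_lt|a00] := ltrgtP 0 a; last by rewrite a00 eqxx in a0.
  - rewrite (_ : phi @^-1` _ = `](c - b) / a, (d - b) / a]%classic); last first.
      apply/seteqP; split=> x /=; rewrite !in_itv /= /phi;
        by rewrite ltr_pdivrMr// ler_pdivlMr// ltrBlDr lerBrDr mulrC.
    rewrite !lebesgue_measure_itv/= !lte_fin cd ltr_pM2r ?invr_gt0// ltrD2r cd.
    rewrite gtr0_norm// -!EFinD -EFinM; congr EFin; field; lra.
  - rewrite (_ : phi @^-1` _ = `[(d - b) / a, (c - b) / a[%classic); last first.
      apply/seteqP; split=> x /=; rewrite !in_itv /= /phi;
        by rewrite ler_ndivrMr// ltr_ndivlMr// ltrBlDr lerBrDr mulrC andbC.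
    rewrite !lebesgue_measure_itv/= !lte_fin cd ltr_nM2r ?invr_lt0// ltrD2r cd.
    rewrite ltr0_norm// -!EFinD -EFinM; congr EFin; field; lra.
have -> : (\int[leb]_x f x = \int[mu]_x f x)%E.
  by apply: eq_measure_integral => A mA _; exact: muE.
rewrite ge0_integral_mscale// muleA -EFinM mulVf ?normr_eq0// mul1e.
by rewrite (ge0_integral_pushforward mphi leb measurableT).
Qed.

Lemma Rintegral_affine (f : R -> R) (a b : R) : a != 0 ->
  leb.-integrable setT (EFin \o f) ->
  leb.-integrable setT (EFin \o (fun x => f (a * x + b))) /\
  \int[leb]_x f (a * x + b) = `|a|^-1 * \int[leb]_x f x.
Proof.
move=> a0 fi; have [mf0 fioo] := integrableP _ _ _ fi.
have mf : @measurable_fun _ _ R (\bar R) setT (EFin \o f) := mf0.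
have caff : continuous (fun x : R => a * x + b).
  move=> x; apply: cvgD; last exact: cvg_cst.
  by apply: cvgM; [exact: cvg_cst|exact: cvg_id].
have maff : measurable_fun setT (fun x : R => a * x + b).
  exact: continuous_measurable_fun.
have fai : leb.-integrable setT (EFin \o (fun x => f (a * x + b))).
  apply/integrableP; split.
    apply/measurable_EFinP; apply: measurableT_comp => //; exact/measurable_EFinP.
  have mnf : measurable_fun setT (fun x => `|(f x)%:E|%E).
    exact: measurableT_comp.
  rewrite /= (ge0_integral_affine b a0 mnf)// lte_mul_pinfty//.
split => //.
pose g : R -> \bar R := EFin \o f.
rewrite /Rintegral.
rewrite [in LHS]integralE [in RHS]integralE.
have E1 := @ge0_integral_affine (g^\+)%E a b a0.
have E2 := @ge0_integral_affine (g^\-)%E a b a0.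
transitivity (fine ((`|a|^-1)%:E * \int[leb]_x (g^\+)%E x
    - (`|a|^-1)%:E * \int[leb]_x (g^\-)%E x)%E).
  congr fine; rewrite -E1 -?E2//; [|exact: measurable_funeneg|exact: measurable_funepos].
  by congr (_ - _)%E; apply: eq_integral => x _; rewrite ?funeposE ?funenegE.
have fp : (\int[leb]_x (g^\+)%E x \is a fin_num)%E.
  exact: (integrable_pos_fin_num (mu := leb)).
have fn : (\int[leb]_x (g^\-)%E x \is a fin_num)%E.
  exact: (integrable_neg_fin_num (mu := leb)).
rewrite -muleBr//; last exact: fin_num_adde_defr.
by rewrite fineM// fin_numB fp fn.
Qed.

End improper.

(** * Derivatives and the fundamental theorem on open domains *)

Section derivation_rules.
Context {R : realType}.
Implicit Types (f g : R -> R) (x df dg c : R).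

Lemma der_cst c x : is_derive x 1 (fun _ : R => c) 0.
Proof. exact: is_derive_cst. Qed.

Lemma der_id x : is_derive x 1 (fun y : R => y) 1.
Proof. exact: is_derive_id. Qed.

Lemma der_add f g x df dg : is_derive x 1 f df -> is_derive x 1 g dg ->
  is_derive x 1 (fun y => f y + g y) (df + dg).
Proof. by move=> *; exact: is_deriveD. Qed.

Lemma der_opp f x df : is_derive x 1 f df ->
  is_derive x 1 (fun y => - f y) (- df).
Proof. by move=> *; exact: is_deriveN. Qed.

Lemma der_mul f g x df dg : is_derive x 1 f df -> is_derive x 1 g dg ->
  is_derive x 1 (fun y => f y * g y) (df * g x + f x * dg).
Proof.
move=> hf hg; apply: is_derive_eq.
by rewrite /GRing.scale /= addrC mulrC.
Qed.

Lemma der_X f x df n : is_derive x 1 f df ->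
  is_derive x 1 (fun y => f y ^+ n) (n%:R * f x ^+ n.-1 * df).
Proof.
move=> hf; have := @is_deriveX R R f n x 1 df hf.
by rewrite exprfctE.
Qed.

Lemma der_inv f x df : f x != 0 -> is_derive x 1 f df ->
  is_derive x 1 (fun y => (f y)^-1) (- (df / f x ^+ 2)).
Proof.
move=> f0 hf; have := @is_deriveV R f x df 1 f0 hf.
by rewrite /GRing.scale /= mulNr mulrC.
Qed.

Lemma der_comp f g x df dg : is_derive (g x) 1 f df -> is_derive x 1 g dg ->
  is_derive x 1 (fun y => f (g y)) (df * dg).
Proof. exact: is_derive1_comp. Qed.

Lemma der_exp f x df : is_derive x 1 f df ->
  is_derive x 1 (fun y => expR (f y)) (expR (f x) * df).
Proof. by move=> hf; apply: der_comp. Qed.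

Lemma der_sin f x df : is_derive x 1 f df ->
  is_derive x 1 (fun y => sin (f y)) (cos (f x) * df).
Proof. by move=> hf; apply: der_comp. Qed.

Lemma der_cos f x df : is_derive x 1 f df ->
  is_derive x 1 (fun y => cos (f y)) (- sin (f x) * df).
Proof. by move=> hf; apply: der_comp. Qed.

Lemma der_atan f x df : is_derive x 1 f df ->
  is_derive x 1 (fun y => atan (f y)) ((1 + f x ^+ 2)^-1 * df).
Proof. by move=> hf; apply: der_comp. Qed.

Lemma der_pow a x : 0 < x -> is_derive x 1 (fun y => y `^ a) (a * x `^ (a - 1)).
Proof. exact: is_derive1_powR. Qed.

Lemma is_derive_continuous f x df : is_derive x 1 f df -> {for x, continuous f}.
Proof.
move=> [d _]; apply: differentiable_continuous; exact/derivable1_diffP.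
Qed.

Lemma is_derive_cvg_at_right f x df l : is_derive x 1 f df -> f x = l ->
  f t @[t --> x^'+] --> l.
Proof.
by move=> /is_derive_continuous cf <-; exact: cvg_at_right_filter.
Qed.

End derivation_rules.

(** On a goal [is_derive x 1 f l], [der] differentiates f by the rules above
    (with hypotheses as base cases) and leaves the side conditions and an
    equation between the result and l. *)
Ltac der := eapply is_derive_eq;
  [repeat first [exact: der_cst | exact: der_id | eassumption
    | notypeclasses refine (der_exp _) | notypeclasses refine (der_sin _)
    | notypeclasses refine (der_cos _) | notypeclasses refine (der_atan _)
    | notypeclasses refine (der_add _ _) | notypeclasses refine (der_opp _)
    | notypeclasses refine (der_mul _ _) | notypeclasses refine (der_inv _ _)
    | notypeclasses refine (der_X _ _) | notypeclasses refine (der_pow _ _)]|rewrite /=].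

Section integrability.
Context {R : realType}.
Local Notation leb := (@lebesgue_measure R).

Lemma integral_segment (F f : R -> R) (a b : R) : a < b ->
  (forall x, a <= x <= b -> is_derive x 1 F (f x)) ->
  (forall x, a <= x <= b -> {for x, continuous f}) ->
  (\int[leb]_(x in `[a, b]) (f x)%:E = (F b - F a)%:E)%E.
Proof.
move=> ab dF cf.
have Fc x : a <= x <= b -> {for x, continuous F}.
  by move=> /dF; exact: is_derive_continuous.
have aab : a <= a <= b by rewrite lexx ltW.
have bab : a <= b <= b by rewrite lexx ltW.
rewrite (@continuous_FTC2 _ f F) //=.
- by apply: continuous_in_subspaceT => x; rewrite inE/= in_itv/=; exact: cf.
- split.
  + move=> x xab; have Dx : a <= x <= b by have := subset_itv_oo_cc xab.
    by case: (dF x Dx).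
  + by apply: cvg_at_right_filter; exact: Fc.
  + by apply: cvg_at_left_filter; exact: Fc.
- move=> x xab; rewrite derive1E.
  have Dx : a <= x <= b by have := subset_itv_oo_cc xab.
  by case: (dF x Dx).
Qed.

(** Evaluation of an absolutely convergent integral over an open domain: it is
    the limit of the integrals over the compact intervals [a n, b n]. *)
Lemma Rintegral_FTC_exhaustion (D : set R) (F f : R -> R) (a b : nat -> R)
    (la lb : R) :
  measurable D -> (forall n, a n < b n) ->
  (forall n x, a n <= x <= b n -> D x) ->
  (forall x, D x -> \forall n \near \oo, a n <= x <= b n) ->
  (forall x, D x -> is_derive x 1 F (f x)) ->
  (forall x, D x -> {for x, continuous f}) ->
  leb.-integrable D (EFin \o f) ->
  F (a n) @[n --> \oo] --> la -> F (b n) @[n --> \oo] --> lb ->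
  \int[leb]_(x in D) f x = lb - la.
Proof.
move=> mD ab abD Dab dF cf fi Fa Fb.
pose f_ n := f \_ `[a n, b n].
have Iab n : `[a n, b n] `<=` D.
  by move=> x /=; rewrite in_itv/= => /abD.
have mf : measurable_fun D f.
  by apply/measurable_EFinP; case/integrableP : fi.
have mf_ n : measurable_fun D (f_ n).
  apply/measurable_restrict => //.
  by apply: measurable_funS mf => // x [].
have fi' : leb.-integrable D (EFin \o (fun x => `|f x|)).
  exact: (integrable_norm (mu := leb)).
have f_f n x : D x -> `|f_ n x| <= `|f x|.
  by move=> Dx; rewrite /f_ patchE; case: ifP => // _; rewrite normr0.
have cvf x : D x -> f_ n x @[n --> \oo] --> f x.
  move=> Dx; apply: cvg_near_cst; have [N _ HN] := Dab x Dx.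
  by exists N => // n /HN xab; rewrite /f_ patchE mem_set //= in_itv.
have [_ lim1] := Rintegral_dominated_cvg mD mf_ fi' f_f cvf.
have E n : \int[leb]_(x in D) f_ n x = F (b n) - F (a n).
  rewrite -Rintegral_mkcondr (_ : D `&` _ = [set` `[a n, b n]]); last first.
    by rewrite setIC; exact/setIidl.
  by rewrite /Rintegral (integral_segment (F := F) (ab n)
    (fun x h => dF x (abD n x h)) (fun x h => cf x (abD n x h))).
have lim2 : F (b n) - F (a n) @[n --> \oo] --> lb - la by exact: cvgB.
have lim3 : \int[leb]_(x in D) f_ n x @[n --> \oo] --> lb - la.
  by under eq_fun do rewrite E.
exact: (cvg_unique _ lim1 lim3).
Qed.

(** By Fatou along the same exhaustion, a nonnegative function with a bounded
    primitive is integrable. *)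
Lemma integrable_primitive_bounded (D : set R) (F f : R -> R) (a b : nat -> R)
    (M : R) :
  measurable D -> (forall n, a n < b n) ->
  (forall n x, a n <= x <= b n -> D x) ->
  (forall x, D x -> \forall n \near \oo, a n <= x <= b n) ->
  (forall x, D x -> is_derive x 1 F (f x)) ->
  (forall x, D x -> {for x, continuous f}) ->
  measurable_fun D f -> (forall x, D x -> 0 <= f x) ->
  (forall n, F (b n) - F (a n) <= M) ->
  leb.-integrable D (EFin \o f).
Proof.
move=> mD ab abD Dab dF cf mf f0 FM.
have Iab n : `[a n, b n] `<=` D.
  by move=> x /=; rewrite in_itv/= => /abD.
pose g (n : nat) : R -> \bar R := EFin \o (f \_ `[a n, b n]).
have mg n : measurable_fun D (g n).
  apply/measurable_EFinP/measurable_restrict => //.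
  by apply: measurable_funS mf => // x [].
have g0 n x : D x -> (0 <= g n x)%E.
  move=> Dx; rewrite /g /= patchE; case: ifP => // _; rewrite lee_fin; exact: f0.
have Eg n : (\int[leb]_(x in D) g n x = (F (b n) - F (a n))%:E)%E.
  have -> : (\int[leb]_(x in D) g n x = \int[leb]_(x in `[a n, b n]) (f x)%:E)%E.
    rewrite [LHS]integral_mkcond [RHS]integral_mkcond; apply: eq_integral => x _.
    rewrite !patchE /g /= patchE; case: ifPn => [xD|xD].
      by case: ifP.
    case: ifPn => // xab; exfalso; move/negP: xD; apply.
    by apply/mem_set/(Iab n)/set_mem.
  by rewrite (integral_segment (F := F) (ab n)
    (fun x h => dF x (abD n x h)) (fun x h => cf x (abD n x h))).
have gf x : D x -> g n x @[n --> \oo] --> (f x)%:E.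
  move=> Dx; apply: cvg_near_cst; have [N _ HN] := Dab x Dx.
  by exists N => // n /HN xab; rewrite /g /= patchE mem_set //= in_itv.
apply/integrableP; split; first exact/measurable_EFinP.
have -> : (\int[leb]_(x in D) `|(EFin \o f) x| =
           \int[leb]_(x in D) limn_einf (g ^~ x))%E.
  apply: eq_integral => x; rewrite inE => Dx /=.
  have [-> _] := cvg_limn_einf_sup (gf x Dx).
  by rewrite ger0_norm// f0.
apply: (@le_lt_trans _ _ M%:E); last exact: ltry.
apply: (le_trans (@fatou _ _ _ leb D mD g mg g0)).
rewrite limn_einf_lim; apply: lime_le; first exact: is_cvg_einfs.
apply: nearW => n; apply: (@le_trans _ _ (\int[leb]_(x in D) g n x)%E).
  by apply: ereal_inf_lbound; exists n => //=.
by rewrite Eg lee_fin.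
Qed.

Lemma is_derive_under_integral (f df : R -> R -> R) (B : set R) (u v a : R)
    (G : R -> R) :
  measurable B -> u < a < v ->
  (forall x, u < x < v -> leb.-integrable B (EFin \o f x)) ->
  (forall x y : R, u < x < v -> B y -> is_derive x 1 (f ^~ y) (df x y)) ->
  leb.-integrable B (EFin \o G) ->
  (forall x y, u < x < v -> B y -> `|df x y| <= G y) ->
  is_derive a 1 (fun x => \int[leb]_(y in B) f x y) (\int[leb]_(y in B) df a y).
Proof.
move=> mB uav fi dfi Gi dfG.
have inI x : `]u, v[%classic x -> u < x < v by rewrite /= in_itv.
have Ia : `]u, v[%classic a by rewrite /= in_itv.
have iI x : `]u, v[%classic x -> leb.-integrable B (EFin \o f x).
  by move=> /inI; exact: fi.
have dI x y : `]u, v[%classic x -> B y -> derivable (f ^~ y) x 1.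
  by move=> /inI ux By; case: (dfi x y ux By).
have eI x y : `]u, v[%classic x -> B y -> partial1of2 f x y = df x y.
  by move=> /inI ux By; rewrite partial1of2E; case: (dfi x y ux By).
have G'i := leb_integrable_norm Gi.
have bI x y : `]u, v[%classic x -> B y -> `|partial1of2 f x y| <= `|G y|.
  by move=> Ix By; rewrite eI// (le_trans _ (ler_norm _))// dfG//; exact: inI.
have G0 y : 0 <= `|G y| by [].
split; first exact: (derivable_under_integral (mu := leb) mB Ia iI dI G0 G'i bI).
rewrite -derive1E (differentiation_under_integral (mu := leb) mB Ia iI dI G0 G'i bI).
by apply: eq_leb_Rintegral => y By; rewrite eI.
Qed.

Lemma continuous_under_integral (f : R -> R -> R) (B : set R) (u v a : R)
    (G : R -> R) :
  measurable B -> u < a < v ->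
  (forall x, u < x < v -> measurable_fun B (f x)) ->
  (forall x y : R, u < x < v -> B y -> {for x, continuous (f ^~ y)}) ->
  leb.-integrable B (EFin \o G) ->
  (forall x y, u < x < v -> B y -> `|f x y| <= G y) ->
  {for a, continuous (fun x => \int[leb]_(y in B) f x y)}.
Proof.
move=> mB uav mf cf Gi fG.
have inI x : `]u, v[%classic x -> u < x < v by rewrite /= in_itv.
have Ia : `]u, v[%classic a by rewrite /= in_itv.
have fi x : `]u, v[%classic x -> leb.-integrable B (EFin \o f x).
  move=> /inI ux; apply: (integrable_bounded_by mB (mf x ux) Gi) => y By.
  exact: fG.
have := @continuity_under_integral R _ _ leb f B mB u v fi _ G Gi _.
move=> /(_ _ _ a); apply; last by rewrite inE.
- by apply: aeW => y By x; rewrite inE => /inI ux; exact: cf.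
- by move=> x /inI ux; apply: aeW => y By; exact: fG.
Qed.

End integrability.

(** * Exponential domination *)

Section domination.
Context {R : realType}.
Local Notation leb := (@lebesgue_measure R).

(** The dominating function on the real line: up to a factor 2 this is
    1 / cosh (d v), of size e^{-d |v|}. *)
Definition sech (d v : R) : R := (expR (d * v) + expR (- (d * v)))^-1.

Lemma sech_gt0 (d v : R) : 0 < sech d v.
Proof. by rewrite invr_gt0 addr_gt0 ?expR_gt0. Qed.

Lemma der_sech (d v : R) :
  is_derive v 1 (sech d) (- (d * (expR (d * v) - expR (- (d * v)))
    / (expR (d * v) + expR (- (d * v))) ^+ 2)).
Proof.
rewrite /sech; der.
  by rewrite gt_eqF// addr_gt0 ?expR_gt0.
congr (- (_ / _)); ring.
Qed.

Lemma integrable_sech (d : R) : 0 < d -> leb.-integrable setT (EFin \o sech d).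
Proof.
move=> d0; have cs v : {for v, continuous (sech d)}.
  exact: is_derive_continuous (der_sech d v).
have dF (v : R) : setT v -> is_derive v 1 (fun v => d^-1 * atan (expR (d * v))) (sech d v).
  move=> _; rewrite /sech; der.
  rewrite expRN; have e0 := expR_gt0 (d * v); field.
  rewrite !gt_eqF//= ?addr_gt0 ?exprn_gt0//.
apply: (integrable_primitive_bounded (a := fun n => - n.+1%:R)
  (b := fun n => n.+1%:R) _ _ _ _ dF (M := d^-1 * pi)) => //.
- by move=> n; rewrite gtrN.
- move=> x _; exists (Num.bound `|x|) => // n /= xn.
  rewrite -ler_norml; apply/ltW/(lt_le_trans (archi_boundP (normr_ge0 x))).
  by rewrite ler_nat leqW.
- exact: continuous_measurable_fun.
- by move=> x _; rewrite ltW// sech_gt0.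
- move=> n; rewrite -mulrBr ler_pM2l ?invr_gt0//.
  have := atan_ltpi2 (expR (d * n.+1%:R)).
  have := atan_gtNpi2 (expR (d * - n.+1%:R)); lra.
Qed.

(** In the exponent, a v - c e^{k v} is maximal where e^{k v} = a / (c k), and
    the bound is the tangent inequality 1 + y <= e^y at that point. *)
Lemma expR_bound (a c k : R) : 0 <= a -> 0 < c -> 0 < k ->
  exists2 K, 0 < K & forall v, expR (a * v - c * expR (k * v)) <= K.
Proof.
move=> a0 c0 k0; have [->|a1] := eqVneq a 0.
  exists 1 => // v; rewrite mul0r sub0r expR_le1 oppr_le0 mulr_ge0 ?expR_ge0//.
  exact: ltW.
have {}a0 : 0 < a by rewrite lt_neqAle eq_sym a1.
pose b := a / k; have b0 : 0 < b by exact: divr_gt0.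
exists (expR (- b * (1 + ln (c / b)))) => [|v]; first exact: expR_gt0.
rewrite ler_expR.
have -> : c * expR (k * v) = b * expR (k * v + ln (c / b)).
  rewrite expRD lnK ?posrE ?divr_gt0//; field; lra.
have := expR_ge1Dx (k * v + ln (c / b)).
rewrite -(ler_pM2l b0) => h.
have -> : a * v = b * (k * v) by rewrite /b; field; lra.
lra.
Qed.

Lemma expR_decay (a c k d : R) : 0 < d <= a -> 0 < c -> 0 < k ->
  exists2 K, 0 < K & forall v, expR (a * v - c * expR (k * v)) <= K * sech d v.
Proof.
move=> /andP[d0 da] c0 k0.
have [K1 K10 H1] := @expR_bound (a + d) c k ltac:(lra) c0 k0.
have [K2 K20 H2] := @expR_bound (a - d) c k ltac:(lra) c0 k0.
exists (K1 + K2) => [|v]; first exact: addr_gt0.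
rewrite ler_pdivlMr ?addr_gt0 ?expR_gt0// mulrDr -!expRD lerD//.
  apply: le_trans (H1 v); rewrite ler_expR; lra.
apply: le_trans (H2 v); rewrite ler_expR; lra.
Qed.

Lemma powR_expR_ln (t a : R) : 0 < t -> t `^ a = expR (a * ln t).
Proof. by move=> t0; rewrite /powR gt_eqF. Qed.

Lemma powR_expR_bound (a s : R) : 0 <= a -> 0 < s ->
  exists2 K, 0 < K & forall t, 0 < t -> t `^ a * expR (- (s * t)) <= K.
Proof.
move=> a0 s0; have [K K0 HK] := @expR_bound a s 1 a0 s0 ltr01.
exists K => // t t0; have := HK (ln t).
by rewrite powR_expR_ln// -expRD mul1r lnK ?posrE.
Qed.

Lemma measurable_pos : measurable (`]0, +oo[%classic : set R).
Proof. exact: measurable_itv. Qed.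

Lemma pos_exhaustion : [/\ forall n, n.+2%:R^-1 < n.+2%:R :> R,
  forall n (x : R), n.+2%:R^-1 <= x <= n.+2%:R -> (`]0, +oo[%classic : set R) x &
  forall x : R, (`]0, +oo[%classic : set R) x ->
    \forall n \near \oo, n.+2%:R^-1 <= x <= n.+2%:R].
Proof.
split.
- move=> n; apply: (@lt_trans _ _ 1); last by rewrite ltr1n.
  by rewrite invf_lt1 ?ltr1n.
- move=> n x /andP[nx _]; rewrite /= in_itv/= andbT.
  by apply: lt_le_trans nx; rewrite invr_gt0.
- move=> x; rewrite /= in_itv/= andbT => x0.
  have xi0 : 0 <= x^-1 by rewrite invr_ge0 ltW.
  exists (Num.bound x + Num.bound x^-1)%N => // n /= xn; apply/andP; split.
    rewrite -[leRHS]invrK lef_pV2 ?posrE ?invr_gt0//.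
    apply/ltW/(lt_le_trans (archi_boundP xi0)).
    by rewrite ler_nat; apply: leqW; apply: leqW; apply: leq_trans xn; exact: leq_addl.
  apply/ltW/(lt_le_trans (archi_boundP (ltW x0))).
  by rewrite ler_nat; apply: leqW; apply: leqW; apply: leq_trans xn; exact: leq_addr.
Qed.

Lemma continuous_pos_measurable (f : R -> R) :
  (forall t : R, 0 < t -> {for t, continuous f}) ->
  measurable_fun (`]0, +oo[%classic : set R) f.
Proof.
move=> cf; apply: open_continuous_measurable_fun; first exact: interval_open.
by move=> t; rewrite inE/= in_itv/= andbT; exact: cf.
Qed.

Lemma inv_dominated_cvg0 (f : R -> R) (K : R) :
  (forall t : R, 0 < t -> `|f t| <= K / t) -> f t @[t --> +oo] --> 0.
Proof.
move=> fK; apply: norm_cvg0.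
have K0 : (K / t) @[t --> +oo] --> (0 : R).
  rewrite -(mulr0 K); apply: cvgM; first exact: cvg_cst.
  by apply/gtr0_cvgV0; [near=> t; near: t; exact: nbhs_pinfty_gt|exact: cvg_id].
apply: (squeeze_cvgr _ _ K0); last exact: cvg_cst.
by near=> t; rewrite normr_ge0/=; apply: fK; near: t; exact: nbhs_pinfty_gt.
Unshelve. all: by end_near. Qed.

Lemma powR_expR_cvg0 (a s : R) : 0 <= a -> 0 < s ->
  t `^ a * expR (- (s * t)) @[t --> +oo] --> 0.
Proof.
move=> a0 s0; have [K K0 HK] := @powR_expR_bound (a + 1) s ltac:(lra) s0.
apply: (@inv_dominated_cvg0 _ K) => t t0.
rewrite ger0_norm ?mulr_ge0 ?powR_ge0 ?expR_ge0// ler_pdivlMr//.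
apply: le_trans (HK t t0); by rewrite mulrAC powRD ?(gt_eqF t0) ?implybT// powRr1 ?(ltW t0).
Qed.

Lemma powR_expR_dominated_cvg0 (f : R -> R) (K a s : R) : 0 <= a -> 0 < s ->
  (forall t : R, 0 < t -> `|f t| <= K * (t `^ a * expR (- (s * t)))) ->
  f t @[t --> +oo] --> 0.
Proof.
move=> a0 s0 fK.
have h : K * (t `^ a * expR (- (s * t))) @[t --> +oo] --> K * 0.
  by apply: cvgM; [exact: cvg_cst|exact: powR_expR_cvg0].
rewrite mulr0 in h; apply: norm_cvg0; apply: (squeeze_cvgr _ _ h); last exact: cvg_cst.
by near=> t; rewrite normr_ge0/=; apply: fK; near: t; exact: nbhs_pinfty_gt.
Unshelve. all: by end_near. Qed.

Lemma Rintegral_FTC_pos (F f : R -> R) (l0 l1 : R) :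
  (forall x : R, 0 < x -> is_derive x 1 F (f x)) ->
  (forall x : R, 0 < x -> {for x, continuous f}) ->
  leb.-integrable `]0, +oo[ (EFin \o f) ->
  F t @[t --> 0^'+] --> l0 -> F t @[t --> +oo] --> l1 ->
  \int[leb]_(x in `]0, +oo[) f x = l1 - l0.
Proof.
move=> dF cf fi F0 F1; have [E1 E2 E3] := pos_exhaustion.
have P x : (`]0, +oo[%classic : set R) x -> 0 < x by rewrite /= in_itv/= andbT.
apply: (Rintegral_FTC_exhaustion measurable_pos E1 E2 E3
  (fun x h => dF x (P x h)) (fun x h => cf x (P x h)) fi); last first.
  move/cvg_pinftyP : F1; apply.
  have := @cvgr_idn R; rewrite -(cvg_shiftn 2); apply: cvg_trans.
  by apply: near_eq_cvg; apply: nearW => n /=; rewrite addn2.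
move/cvg_at_rightP : F0 => /(_ (fun n => n.+2%:R^-1)); apply; split.
  by move=> n; rewrite invr_gt0.
by have := @cvg_harmonic R; rewrite -(cvg_shiftS (@harmonic R)).
Qed.

Lemma integrable_pos_primitive_bounded (F f : R -> R) (M : R) :
  (forall x : R, 0 < x -> is_derive x 1 F (f x)) ->
  (forall x : R, 0 < x -> {for x, continuous f}) ->
  (forall x : R, 0 < x -> 0 <= f x) ->
  (forall x y : R, 0 < x -> 0 < y -> F x - F y <= M) ->
  leb.-integrable `]0, +oo[ (EFin \o f).
Proof.
move=> dF cf f0 FM; have [E1 E2 E3] := pos_exhaustion.
have P x : (`]0, +oo[%classic : set R) x -> 0 < x by rewrite /= in_itv/= andbT.
apply: (integrable_primitive_bounded measurable_pos E1 E2 E3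
  (fun x h => dF x (P x h)) (fun x h => cf x (P x h)) (M := M)).
- exact: continuous_pos_measurable.
- by move=> x /P; exact: f0.
- by move=> n; apply: FM; rewrite ?invr_gt0.
Qed.

Lemma integrable_expRN (s : R) : 0 < s ->
  leb.-integrable `]0, +oo[ (EFin \o (fun t => expR (- (s * t)))).
Proof.
move=> s0.
have dF (x : R) : 0 < x ->
    is_derive x 1 (fun t => - (s^-1 * expR (- (s * t)))) (expR (- (s * x))).
  by move=> x0; der; field; lra.
apply: (integrable_pos_primitive_bounded dF (M := s^-1)).
- by move=> x _; apply: is_derive_continuous; der.
- by move=> x _; exact: expR_ge0.
- move=> x y x0 y0; rewrite opprK.
  have h1 : expR (- (s * y)) <= 1 by rewrite expR_le1 oppr_le0 mulr_ge0// ltW.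
  have h2 := expR_ge0 (- (s * x)); have si : 0 < s^-1 by rewrite invr_gt0.
  nra.
Qed.

(** t^{b-1} / (1 + t^b)^2 has the bounded primitive -1 / (b (1 + t^b)), and
    e^{-st} (1 + t^b)^2 is bounded. *)
Lemma integrable_powR_expRN (b s : R) : 0 < b -> 0 < s ->
  leb.-integrable `]0, +oo[
    (EFin \o (fun t => expR (- (s * t)) * t `^ (b - 1))).
Proof.
move=> b0 s0.
have cp a t : 0 < t -> {for t, continuous (fun t : R => t `^ a)}.
  by move=> t0; apply: is_derive_continuous; exact: der_pow.
have i0 : leb.-integrable `]0, +oo[
    (EFin \o (fun t => t `^ (b - 1) / (1 + t `^ b) ^+ 2)).
  have p0 (x : R) : 0 < 1 + x `^ b by rewrite ltr_pwDl// powR_ge0.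
  have dF (x : R) : 0 < x -> is_derive x 1 (fun t => - (b^-1 * (1 + t `^ b)^-1))
      (x `^ (b - 1) / (1 + x `^ b) ^+ 2).
    move=> x0; der => //; first by rewrite gt_eqF.
    by field; rewrite (gt_eqF (p0 x)) gt_eqF.
  apply: (integrable_pos_primitive_bounded dF (M := b^-1)).
  - move=> x x0; apply: is_derive_continuous; der => //.
    by rewrite gt_eqF// exprn_gt0.
  - by move=> x _; rewrite divr_ge0 ?powR_ge0// exprn_ge0// ltW.
  - move=> x y x0 y0; rewrite opprK.
    have h1 : (1 + y `^ b)^-1 <= 1 by rewrite invf_le1// lerDl powR_ge0.
    have h2 : 0 <= (1 + x `^ b)^-1 by rewrite invr_ge0 ltW.
    have si : 0 < b^-1 by rewrite invr_gt0.
    nra.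
have [K1 K10 H1] := @powR_expR_bound 0 s (lexx _) s0.
have [K2 K20 H2] := @powR_expR_bound (2 * b) s ltac:(lra) s0.
have i1 : leb.-integrable `]0, +oo[ (EFin \o
    (fun t => (2 * K1 + 2 * K2) * (t `^ (b - 1) / (1 + t `^ b) ^+ 2))).
  exact: leb_integrableZl measurable_pos i0.
apply: integrable_bounded_by i1 _ => //.
  apply: continuous_pos_measurable => t t0; apply: is_derive_continuous.
  by der.
move=> t; rewrite /= in_itv/= andbT => t0.
rewrite ger0_norm ?mulr_ge0 ?expR_ge0 ?powR_ge0//.
rewrite mulrC [leRHS]mulrCA ler_wpM2l ?powR_ge0//.
have p0 : 0 < 1 + t `^ b by rewrite ltr_pwDl// powR_ge0.
rewrite ler_pdivlMr ?exprn_gt0//.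
have := H1 t t0; have := H2 t t0; rewrite powRr0.
have -> : t `^ (2 * b) = t `^ b ^+ 2 by rewrite mulrC powRrM -powR_mulrn ?powR_ge0.
move: (t `^ b) (expR_ge0 (- (s * t))) => q; move: (expR _) => e e0 h2 h1.
have : 0 <= e * (1 - q) ^+ 2 by rewrite mulr_ge0 ?sqr_ge0.
nra.
Qed.

End domination.

(** * Laplace transforms and the Gamma function *)

Section laplace.
Context {R : realType}.
Local Notation leb := (@lebesgue_measure R).
Local Notation pos := (`]0, +oo[%classic : set R).

Lemma posP (t : R) : pos t <-> 0 < t.
Proof. by rewrite /= in_itv/= andbT. Qed.

Lemma continuous_expRN (s t : R) : {for t, continuous (fun t => expR (- (s * t)))}.
Proof. by apply: is_derive_continuous; der. Qed.

Lemma laplace_integrableZl (k : R) (f : R -> R) (s : R) :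
  laplace_integrable f s -> laplace_integrable (fun t => k * f t) s.
Proof.
move=> fi; apply: eq_leb_integrable (leb_integrableZl k measurable_pos fi) => //.
by move=> t _; rewrite mulrCA.
Qed.

Lemma laplace_integrableD (f g : R -> R) (s : R) :
  laplace_integrable f s -> laplace_integrable g s ->
  laplace_integrable (fun t => f t + g t) s.
Proof.
move=> fi gi; apply: eq_leb_integrable (leb_integrableD measurable_pos fi gi) => //.
by move=> t _; rewrite mulrDr.
Qed.

Lemma eq_laplace_integrable (f g : R -> R) (s : R) :
  (forall t : R, 0 < t -> f t = g t) ->
  laplace_integrable f s -> laplace_integrable g s.
Proof.
move=> fg; apply: eq_leb_integrable; first exact: measurable_pos.
by move=> t /posP t0; rewrite fg.
Qed.

Lemma laplaceZl (k : R) (f : R -> R) (s : R) :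
  laplace_integrable f s -> laplace (fun t => k * f t) s = k * laplace f s.
Proof.
move=> fi; rewrite /laplace -leb_RintegralZl//.
by apply: eq_leb_Rintegral => t _; rewrite mulrCA.
Qed.

Lemma laplaceD (f g : R -> R) (s : R) :
  laplace_integrable f s -> laplace_integrable g s ->
  laplace (fun t => f t + g t) s = laplace f s + laplace g s.
Proof.
move=> fi gi; rewrite /laplace -leb_RintegralD//.
by apply: eq_leb_Rintegral => t _; rewrite mulrDr.
Qed.

Lemma eq_laplace (f g : R -> R) (s : R) :
  (forall t : R, 0 < t -> f t = g t) -> laplace f s = laplace g s.
Proof. by move=> fg; apply: eq_leb_Rintegral => t /posP t0; rewrite fg. Qed.

Lemma bounded_laplace_integrable (f : R -> R) (M s : R) : 0 < s ->
  measurable_fun pos f -> (forall t : R, 0 < t -> `|f t| <= M) ->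
  laplace_integrable f s.
Proof.
move=> s0 mf fM.
have iM := leb_integrableZl M measurable_pos (integrable_expRN s0).
apply: (integrable_bounded_by measurable_pos _ iM).
  apply: measurable_funM => //; apply: continuous_pos_measurable => t t0.
  by apply: is_derive_continuous; der.
move=> t /posP t0; rewrite normrM ger0_norm ?expR_ge0// mulrC.
by rewrite ler_wpM2r ?expR_ge0// fM.
Qed.

Lemma laplace_cst (k s : R) : 0 < s ->
  laplace_integrable (fun=> k) s /\ laplace (fun=> k) s = k / s.
Proof.
move=> s0; have ik : laplace_integrable (fun=> k) s.
  by apply: (bounded_laplace_integrable (M := `|k|) s0).
split => //; rewrite /laplace.
transitivity (\int[leb]_(t in pos) (k * expR (- (s * t)))).
  by apply: eq_leb_Rintegral => t _; rewrite mulrC.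
rewrite leb_RintegralZl//; last exact: integrable_expRN.
congr (_ * _).
have dF (x : R) : 0 < x ->
    is_derive x 1 (fun t => - (s^-1 * expR (- (s * t)))) (expR (- (s * x))).
  by move=> x0; der; field; lra.
rewrite (Rintegral_FTC_pos dF (l0 := - s^-1) (l1 := 0)) ?sub0r ?opprK//.
- by move=> x _; apply: is_derive_continuous; der.
- exact: integrable_expRN.
- apply: is_derive_cvg_at_right.
  by rewrite mulr0 oppr0 expR0 mulr1.
- apply: (powR_expR_dominated_cvg0 (K := s^-1) (lexx 0) s0) => t t0.
  by rewrite powRr0 mul1r normrN ger0_norm// mulr_ge0 ?expR_ge0// invr_ge0 ltW.
Qed.

Lemma laplace_pow (b s : R) : 0 < b -> 0 < s ->
  laplace_integrable (fun t => t `^ (b - 1)) s /\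
  laplace (fun t => t `^ (b - 1)) s = Gamma b * s `^ (- b).
Proof.
move=> b0 s0; split; first exact: integrable_powR_expRN.
pose h (t : R) := t `^ (b - 1) * expR (- t).
have ih : leb.-integrable pos (EFin \o h).
  apply: eq_leb_integrable (integrable_powR_expRN b0 ltr01) => //.
  by move=> t _; rewrite mul1r mulrC.
have s_neq0 : s != 0 by rewrite gt_eqF.
have [ih' E] := Rintegral_affine 0 s_neq0
  ((leb_integrable_mkcond h measurable_pos).1 ih).
rewrite /Gamma b0 /laplace.
have -> : euler_integral b = s * \int[leb]_t (h \_ pos) (s * t + 0).
  by rewrite E gtr0_norm// mulrA mulfV// mul1r /euler_integral Rintegral_mkcond.
rewrite mulrAC -leb_RintegralZl//.
rewrite [LHS]Rintegral_mkcond; apply: eq_leb_Rintegral => t _.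
rewrite !patchE addr0.
have -> : (s * t \in pos) = (t \in pos).
  by apply/idP/idP; rewrite !inE !posP pmulr_rgt0.
case: ifPn; last by rewrite mulr0.
rewrite inE => /posP t0.
have sb : s `^ (b - 1) = s `^ b / s.
  by rewrite powRB ?s_neq0 ?implybT// powRr1 ?(ltW s0).
rewrite /h powRM ?(ltW s0) ?(ltW t0)// sb powRN.
by field; rewrite s_neq0 gt_eqF// powR_gt0.
Qed.

Lemma Gamma1 : Gamma 1 = 1 :> R.
Proof.
have [_ E] := laplace_cst 1 (@ltr01 R).
have [_] := laplace_pow (@ltr01 R) (@ltr01 R); rewrite powR1 mulr1 => <-.
rewrite -[RHS]divr1 -E; apply: eq_laplace => t t0.
by rewrite subrr powRr0.
Qed.

Lemma Rintegral_indic_pos (a b : R) : 0 < a -> a <= b ->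
  leb.-integrable pos (EFin \o (\1_(`[a, b]%classic) : R -> R)) /\
  \int[leb]_(t in pos) \1_(`[a, b]%classic) t = b - a.
Proof.
move=> a0 ab; split.
  apply: (integrableS (mu := leb) measurableT measurable_pos) => //.
  exact: (integrable_indic_itv a b true false).
rewrite /Rintegral (@integral_indic _ _ _ leb _ measurable_pos)//.
rewrite (_ : _ `&` _ = [set` `[a, b]]); last first.
  apply/setIidl => t; rewrite /= !in_itv/= andbT => /andP[t1 _].
  exact: lt_le_trans t1.
have E : fine (lebesgue_measure ([set` `[a, b]] : set R)) = b - a.
  rewrite lebesgue_measure_itv/= lte_fin -EFinB.
  by move: ab; rewrite le_eqVlt => /predU1P[->|->]//; rewrite ltxx subrr.
by rewrite -E.
Qed.

Lemma Gamma_gt0 (b : R) : 0 < b -> 0 < Gamma b.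
Proof.
move=> b0; rewrite /Gamma b0 /euler_integral.
pose k : R := 2^-1 * expR (- 2).
have k0 : 0 < k by rewrite mulr_gt0 ?invr_gt0 ?expR_gt0.
have [i1 E1] := @Rintegral_indic_pos 1 2 ltr01 (ler1n _ 2).
have ik := leb_integrableZl k measurable_pos i1.
apply: (@lt_le_trans _ _ (\int[leb]_(t in pos) (k * \1_(`[1, 2]%classic) t))).
  by rewrite leb_RintegralZl// E1 mulr_gt0// subr_gt0 ltr1n.
apply: leb_le_Rintegral => //.
  apply: eq_leb_integrable (integrable_powR_expRN b0 ltr01) => //.
  by move=> t _; rewrite mul1r mulrC.
move=> t /posP t0; rewrite indicE.
case: (boolP (t \in _)) => [|_]; last first.
  by rewrite mulr0 mulr_ge0 ?powR_ge0 ?expR_ge0.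
rewrite inE/= in_itv/= mulr1 => /andP[t1 t2].
apply: ler_pM; rewrite ?invr_ge0 ?expR_ge0//; last by rewrite ler_expR lerN2.
apply: (@le_trans _ _ (t `^ (- 1))); last by apply: ler_powR => //; lra.
by rewrite powR_inv1 ?(ltW t0)// lef_pV2 ?posrE.
Qed.

(** Integration by parts; the growth bound on y makes the boundary term at
    infinity vanish. *)
Lemma laplace_derivative (y y' : R -> R) (y0 K c s : R) : 0 < s -> 0 <= c ->
  (forall t : R, 0 < t -> is_derive t 1 y (y' t)) ->
  (forall t : R, 0 < t -> {for t, continuous y'}) ->
  y t @[t --> 0^'+] --> y0 ->
  (forall t : R, 0 < t -> `|y t| <= K * t `^ c) ->
  laplace_integrable y' s ->
  laplace_integrable y s /\ laplace y' s = s * laplace y s - y0.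
Proof.
move=> s0 c0 dy cy' y00 yK iy'.
have cy (t : R) : 0 < t -> {for t, continuous y}.
  by move=> t0; exact: is_derive_continuous (dy t t0).
have iy : laplace_integrable y s.
  have cp : 0 < c + 1 by rewrite ltr_pwDr.
  have iM := leb_integrableZl K measurable_pos (integrable_powR_expRN cp s0).
  apply: (integrable_bounded_by measurable_pos _ iM).
    apply: continuous_pos_measurable => t t0; apply: cvgM; last exact: cy.
    exact: continuous_expRN.
  move=> t /posP t0; rewrite addrK normrM ger0_norm ?expR_ge0// mulrCA.
  by rewrite ler_wpM2l ?expR_ge0// yK.
split => //.
pose z (t : R) := expR (- (s * t)) * y t.
pose z' (t : R) := expR (- (s * t)) * y' t - s * (expR (- (s * t)) * y t).
have dz (t : R) : 0 < t -> is_derive t 1 z (z' t).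
  by move=> t0; have h := dy t t0; rewrite /z /z'; der; ring.
have iz' : leb.-integrable pos (EFin \o z').
  by apply: leb_integrableB => //; exact: leb_integrableZl.
have := Rintegral_FTC_pos dz _ iz' (l0 := y0) (l1 := 0).
rewrite /z' leb_RintegralB//; last exact: leb_integrableZl.
rewrite leb_RintegralZl// -/(laplace y' s) -/(laplace y s) sub0r.
move=> E; suff : laplace y' s - s * laplace y s = - y0 by lra.
apply: E.
- move=> t t0; have h := @continuous_expRN s t.
  apply: cvgB; first by apply: cvgM; [exact: h|exact: cy'].
  by apply: cvgM; [exact: cvg_cst|apply: cvgM; [exact: h|exact: cy]].
- rewrite -[y0]mul1r; apply: cvgM => //; apply: is_derive_cvg_at_right.
  by rewrite mulr0 oppr0 expR0.
- apply: (powR_expR_dominated_cvg0 (K := K) c0 s0) => t t0.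
  rewrite /z normrM ger0_norm ?expR_ge0// mulrA mulrC.
  by rewrite ler_wpM2r ?expR_ge0// yK.
Qed.

(** Transform t^b and its derivative at s = 1. *)
Lemma Gamma_rec_pos (b : R) : 0 < b -> Gamma (b + 1) = b * Gamma b.
Proof.
move=> b0; have b10 : 0 < b + 1 by exact: addr_gt0.
have [i1 E1] := laplace_pow b0 (@ltr01 R).
have [i2 E2] := laplace_pow b10 (@ltr01 R).
have := @laplace_derivative (fun t => t `^ b) (fun t => b * t `^ (b - 1)) 0 1 b 1.
rewrite addrK powR1 mulr1 in E2; rewrite powR1 mulr1 in E1.
case => //; [exact: ltW|..|].
- by move=> t t0; apply: is_derive_continuous; der.
- exact: powR_cvg0.
- by move=> t t0; rewrite mul1r ger0_norm ?powR_ge0.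
- exact: laplace_integrableZl.
- by move=> _; rewrite laplaceZl// E1 E2 mul1r subr0.
Qed.

Lemma Gamma_shift (b : R) (n : nat) : 0 < b ->
  Gamma (b + n%:R) = \prod_(k < n) (b + k%:R) * Gamma b.
Proof.
move=> b0; elim: n => [|n IH]; first by rewrite addr0 big_ord0 mul1r.
rewrite -natr1 addrA Gamma_rec_pos ?ltr_wpDr// IH big_ord_recr/= mulrCA mulrA.
by rewrite [_ * (b + _)]mulrC.
Qed.

(** The value does not depend on the number of steps of the recurrence, as
    long as the argument becomes positive. *)
Lemma Gamma_nonpos (b : R) (n : nat) : b <= 0 -> 0 < b + n%:R ->
  Gamma b = Gamma (b + n%:R) / \prod_(k < n) (b + k%:R).
Proof.
move=> b0 bn.
have main (m p : nat) : 0 < b + m%:R ->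
    Gamma (b + (m + p)%N%:R) / \prod_(k < m + p) (b + k%:R) =
    Gamma (b + m%:R) / \prod_(k < m) (b + k%:R).
  move=> bm; elim: p => [|p IH]; first by rewrite addn0.
  have bmp : 0 < b + (m + p)%N%:R by rewrite natrD addrA ltr_wpDr.
  rewrite addnS -natr1 addrA Gamma_rec_pos// big_ord_recr/= -IH invfM.
  by rewrite mulrC mulrA divfK ?gt_eqF// mulrC.
have bb : 0 < b + (Num.bound b)%:R.
    have := truncnS_gt `|b|; rewrite -/(Num.bound b).
    by rewrite ler0_norm// => ?; lra.
have -> : Gamma b = Gamma (b + (Num.bound b)%:R)
    / \prod_(k < Num.bound b) (b + k%:R).
  by rewrite {1}/Gamma ltNge b0/= /Gamma bb.
have [nb|bn'] := leqP n (Num.bound b).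
  by rewrite -(subnKC nb) main.
by rewrite -(subnKC (ltnW bn')) main.
Qed.

(** This form also holds at the poles, where both sides are 0. *)
Lemma Gamma_recV (b : R) : b <= 0 -> (Gamma b)^-1 = b / Gamma (b + 1).
Proof.
move=> b0; pose m := Num.bound `|b|.
have bm : 0 < b + 1 + m%:R.
  by have := archi_boundP (normr_ge0 b); rewrite -/m {1}ler0_norm// => ?; lra.
have bm1 : 0 < b + m.+1%:R by rewrite -natr1 addrA addrAC.
rewrite (Gamma_nonpos b0 bm1) big_ord_recl/= addr0.
have -> : b + m.+1%:R = b + 1 + m%:R by rewrite -natr1 addrA addrAC.
under eq_bigr do rewrite /bump /= add1n -natr1 addrA addrAC.
have [b1|b1] := leP (b + 1) 0.
  by rewrite [in RHS](Gamma_nonpos b1 bm) !invfM !invrK mulrCA.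
rewrite Gamma_shift// !invfM !invrK mulrCA mulrA mulrAC.
rewrite mulrA mulfK// gt_eqF// prodr_gt0// => k _.
by rewrite ltr_wpDr.
Qed.

End laplace.

(** * Uniqueness of the Laplace transform *)

Section lerch.
Context {R : realType}.
Local Notation leb := (@lebesgue_measure R).
Local Notation pos := (`]0, +oo[%classic : set R).

(** For l > 0, a function of e^{-lt} with values in [0, 1] for t >= 0 and
    maximum 1, reached only at t = (ln 2) / l.  Its powers are combinations of exponentials e^{-st}, s > 0,
    and concentrate at that point. *)
Definition bump_kernel (l t : R) : R := 4 * (expR (- (l * t)) * (1 - expR (- (l * t)))).

Lemma laplace_poly0 (f : R -> R) (l : R) : 0 < l ->
  (forall s : R, 0 < s -> laplace_integrable f s) ->
  (forall s : R, 0 < s -> laplace f s = 0) ->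
  forall (n : nat) (s : R), 0 < s ->
    leb.-integrable pos (EFin \o (fun t => (1 - expR (- (l * t))) ^+ n * (expR (- (s * t)) * f t))) /\
    \int[leb]_(t in pos) ((1 - expR (- (l * t))) ^+ n * (expR (- (s * t)) * f t)) = 0.
Proof.
move=> l0 fi f0; elim=> [|n IH] s s0.
  split.
    by apply: eq_leb_integrable (fi s s0) => // t _; rewrite expr0 mul1r.
  rewrite -[RHS](f0 s s0) /laplace; apply: eq_leb_Rintegral => t _.
  by rewrite expr0 mul1r.
have [i1 E1] := IH s s0; have [i2 E2] := IH (s + l) (addr_gt0 s0 l0).
have E t : (1 - expR (- (l * t))) ^+ n.+1 * (expR (- (s * t)) * f t) =
    (1 - expR (- (l * t))) ^+ n * (expR (- (s * t)) * f t) -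
    (1 - expR (- (l * t))) ^+ n * (expR (- ((s + l) * t)) * f t).
  by rewrite mulrDl opprD expRD exprS; ring.
split.
  by apply: eq_leb_integrable (leb_integrableB _ i1 i2).
have := leb_RintegralB measurable_pos i1 i2; rewrite E1 E2 subrr => Z.
rewrite -[RHS]Z; by apply: eq_leb_Rintegral => t _; rewrite E.
Qed.

Lemma bump_moment0 (f : R -> R) (l : R) : 0 < l ->
  (forall s : R, 0 < s -> laplace_integrable f s) ->
  (forall s : R, 0 < s -> laplace f s = 0) ->
  forall n : nat,
    leb.-integrable pos (EFin \o (fun t => bump_kernel l t ^+ n.+1 * f t)) /\
    \int[leb]_(t in pos) (bump_kernel l t ^+ n.+1 * f t) = 0.
Proof.
move=> l0 fi f0 n; have sn : 0 < n.+1%:R * l by rewrite mulr_gt0.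
have [i1 E1] := laplace_poly0 l0 fi f0 n.+1 sn.
have E t : bump_kernel l t ^+ n.+1 * f t = 4 ^+ n.+1 *
    ((1 - expR (- (l * t))) ^+ n.+1 * (expR (- (n.+1%:R * l * t)) * f t)).
  have -> : - (n.+1%:R * l * t) = n.+1%:R * (- (l * t)) by ring.
  rewrite expRM_natl /bump_kernel !exprMn; ring.
split.
  by apply: eq_leb_integrable (leb_integrableZl (4 ^+ n.+1) _ i1).
have := leb_RintegralZl (4 ^+ n.+1) measurable_pos i1; rewrite E1 mulr0 => Z.
rewrite -[RHS]Z; by apply: eq_leb_Rintegral => t _; rewrite E.
Qed.

Lemma bump_kernelE (l t : R) :
  bump_kernel l t = 1 - (1 - 2 * expR (- (l * t))) ^+ 2.
Proof. rewrite /bump_kernel; ring. Qed.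

Lemma bump_kernel_le (l t0 a t : R) : 0 < l -> expR (- (l * t0)) = 2^-1 ->
  a <= t <= t0 \/ t0 <= t <= a -> bump_kernel l a <= bump_kernel l t.
Proof.
move=> l0 h; rewrite !bump_kernelE lerD2l lerN2.
have hm x y : x <= y -> expR (- (l * y)) <= expR (- (l * x)).
  by move=> xy; rewrite ler_expR lerN2 ler_pM2l.
case=> /andP[/hm h1 /hm h2]; rewrite h in h1 h2.
  have : 0 <= (expR (- (l * a)) - expR (- (l * t)))
              * (expR (- (l * a)) + expR (- (l * t)) - 1).
    by apply: mulr_ge0; lra.
  nra.
have : 0 <= (expR (- (l * t)) - expR (- (l * a)))
            * (1 - expR (- (l * a)) - expR (- (l * t))).
  by apply: mulr_ge0; lra.
nra.
Qed.

(** Choose l with the maximum of the kernel at t0.  If f t0 > 0 then, near t0,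
    f is bounded below, and the n-th moment of f against the kernel is at least
    of order m'^n there, while the rest is of order m^n with m < m' < 1.  Since
    all moments vanish, m'^n is at most a constant times m^n, which fails for
    large n. *)
Lemma lerch_pos (f : R -> R) (t0 : R) :
  (forall t : R, 0 < t -> {for t, continuous f}) ->
  (forall s : R, 0 < s -> laplace_integrable f s) ->
  (forall s : R, 0 < s -> laplace f s = 0) -> 0 < t0 -> f t0 <= 0.
Proof.
move=> cf fi f0 t00; rewrite leNgt; apply/negP => ft0.
pose l := ln 2 / t0; have l0 : 0 < l by rewrite divr_gt0// ln_gt0// ltr1n.
have h : expR (- (l * t0)) = 2^-1.
  by rewrite /l divfK ?gt_eqF// expRN lnK ?posrE.
pose q := bump_kernel l.
have q0 t : 0 < t -> 0 < q t.
  move=> tp; rewrite /q /bump_kernel mulr_gt0// mulr_gt0 ?expR_gt0// subr_gt0.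
  by rewrite expR_lt1 oppr_lt0 mulr_gt0.
have qt0 : q t0 = 1 by rewrite /q bump_kernelE h; field.
have dq (t : R) : is_derive t 1 q (4 * (l * expR (- (l * t)) * (2 * expR (- (l * t)) - 1))).
  rewrite /q /bump_kernel; der; ring.
have cq t : {for t, continuous q} by exact: is_derive_continuous (dq t).
have [d [d0 dt0 fd]] : exists d, [/\ 0 < d, d < t0 &
    forall t, t0 - d <= t <= t0 + d -> f t0 / 2 <= f t].
  have e0 : 0 < f t0 / 2 by lra.
  have /cvgrPdist_lt /(_ _ e0) [/= d1 d10 H] := cf t0 t00.
  exists (Num.min (d1 / 2) (t0 / 2)); split.
  - by rewrite lt_min !divr_gt0.
  - by rewrite gt_min; apply/orP; right; lra.
  - move=> t td; have /H : `|t0 - t| < d1.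
      rewrite /= ltr_norml.
      have := ge_min (d1/2) (d1 / 2) (t0 / 2); rewrite lexx/= => hm; lra.
    by rewrite ltr_norml => ?; lra.
(* The kernel is unimodal, so outside [t0 - d, t0 + d] it is at most m. *)
pose m := Num.max (q (t0 - d)) (q (t0 + d)).
have m0 : 0 < m by rewrite lt_max q0// subr_gt0.
have qlt1 t : t != t0 -> q t < 1.
  move=> tt0; rewrite /q bump_kernelE ltrBlDl ltrDr exprn_even_gt0//=.
  rewrite subr_eq0; apply: contraNneq tt0 => /(congr1 (fun x => 2^-1 * x)).
  rewrite mulrA mulVf// mul1r mulr1 -h => /expR_inj /oppr_inj /mulfI.
  by rewrite gt_eqF// => /(_ isT) ->.
have m1 : m < 1.
  by rewrite gt_max !qlt1//; lra.
have qm t : 0 < t -> ~~ (t0 - d <= t <= t0 + d) -> q t <= m.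
  move=> tp; rewrite negb_and -!ltNge => /orP[ht|ht].
    rewrite le_max; apply/orP; left; apply: (bump_kernel_le l0 h); left; lra.
  rewrite le_max; apply/orP; right; apply: (bump_kernel_le l0 h); right; lra.
pose m' : R := (1 + m) / 2.
have [d' [d'0 d'd qm']] : exists d', [/\ 0 < d', d' <= d &
    forall t, t0 - d' <= t <= t0 + d' -> m' <= q t].
  have e0 : 0 < (1 - m) / 2 by lra.
  have /cvgrPdist_lt /(_ _ e0) [/= d1 d10 H] := cq t0.
  exists (Num.min (d1 / 2) d); split.
  - by rewrite lt_min divr_gt0.
  - by rewrite ge_min lexx orbT.
  - move=> t td; have /H : `|t0 - t| < d1.
      rewrite /= ltr_norml.
      have := ge_min (d1/2) (d1 / 2) d; rewrite lexx/= => hm; lra.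
    by rewrite qt0 ltr_norml /m' => ?; lra.
have m'0 : 0 < m' by rewrite /m'; lra.
pose e := f t0 / 2; have e0 : 0 < e by rewrite /e; lra.
have [iq1 _] := bump_moment0 l0 fi f0 0.
have iq := leb_integrable_norm iq1.
pose M := \int[leb]_(t in pos) `|bump_kernel l t ^+ 1 * f t|.
have [i1 E1] : leb.-integrable pos (EFin \o (\1_(`[t0 - d', t0 + d']%classic) : R -> R)) /\
  \int[leb]_(t in pos) \1_(`[t0 - d', t0 + d']%classic) t = t0 + d' - (t0 - d').
  by apply: Rintegral_indic_pos; lra.
have main n : m' ^+ n.+1 * e * (2 * d') <= m ^+ n * M.
  have [iqn Eqn] := bump_moment0 l0 fi f0 n.
  have iA := leb_integrableZl (m' ^+ n.+1 * e) measurable_pos i1.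
  have iB := leb_integrableZl (m ^+ n) measurable_pos iq.
  have := leb_le_Rintegral measurable_pos (leb_integrableB measurable_pos iA iB) iqn.
  rewrite Eqn leb_RintegralB// !leb_RintegralZl// E1 -/M => H.
  suff : forall t, pos t -> m' ^+ n.+1 * e * \1_(`[t0 - d', t0 + d']%classic) t -
      m ^+ n * `|bump_kernel l t ^+ 1 * f t| <= bump_kernel l t ^+ n.+1 * f t.
    by move/H => {}H; nra.
  move=> t /posP tp; have qt := q0 t tp.
  have B0 : 0 <= m ^+ n * `|bump_kernel l t ^+ 1 * f t|.
    by rewrite mulr_ge0 ?exprn_ge0// ltW.
  rewrite indicE; case: (boolP (t \in _)) => [|_].
    rewrite inE/= in_itv/= mulr1 => td.
    have {}fd : e <= f t by apply: fd; lra.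
    have qn : m' ^+ n.+1 <= bump_kernel l t ^+ n.+1.
      by apply: lerXn2r; rewrite ?nnegrE ?(ltW m'0) ?(ltW qt)//; exact: qm'.
    have : m' ^+ n.+1 * e <= bump_kernel l t ^+ n.+1 * f t.
      by apply: ler_pM => //; [apply: exprn_ge0; exact: ltW|exact: ltW].
    lra.
  rewrite mulr0 sub0r.
  have [td|td] := boolP (t0 - d <= t <= t0 + d).
    have {}fd : e <= f t by exact: fd.
    have : 0 <= bump_kernel l t ^+ n.+1 * f t.
      apply: mulr_ge0; [apply: exprn_ge0; exact: ltW|].
      exact: le_trans (ltW e0) fd.
    lra.
  have : `|bump_kernel l t ^+ n.+1 * f t| <= m ^+ n * `|bump_kernel l t ^+ 1 * f t|.
    rewrite expr1 exprSr -mulrA normrM ler_wpM2r// normrX gtr0_norm//.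
    by apply: lerXn2r; rewrite ?nnegrE ?(ltW m0) ?(ltW qt)//; exact: qm.
  by rewrite ler_norml => /andP[].
have rlt1 : `|m / m'| < 1.
  have r0 : 0 < m / m' by exact: divr_gt0.
  by rewrite gtr0_norm// ltr_pdivrMr// mul1r /m'; lra.
have /cvgr0_norm_lt := cvg_expr rlt1.
have M0 : 0 <= M by exact: Rintegral_ge0.
pose k := m' * e * (2 * d') / (M + 1).
have k0 : 0 < k by rewrite divr_gt0 ?mulr_gt0// ltr_wpDl.
move=> /(_ k k0) [n _ /(_ n (leqnn _))] /=.
have mn0 : 0 < m' ^+ n by exact: exprn_gt0.
have mm0 : 0 < m ^+ n by exact: exprn_gt0.
rewrite expr_div_n ger0_norm ?divr_ge0 ?(ltW mn0) ?(ltW mm0)//.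
rewrite ltr_pdivrMr// /k mulrAC ltr_pdivlMr ?ltr_wpDl// => H.
have := main n; rewrite exprS; nra.
Qed.

(** Lerch's theorem: the preceding lemma applied to f - g and to g - f. *)
Lemma lerch (f g : R -> R) :
  (forall t : R, 0 < t -> {for t, continuous f}) ->
  (forall t : R, 0 < t -> {for t, continuous g}) ->
  (forall s : R, 0 < s -> laplace_integrable f s) ->
  (forall s : R, 0 < s -> laplace_integrable g s) ->
  (forall s : R, 0 < s -> laplace f s = laplace g s) ->
  forall t : R, 0 < t -> f t = g t.
Proof.
have main (h k : R -> R) :
  (forall t : R, 0 < t -> {for t, continuous h}) ->
  (forall t : R, 0 < t -> {for t, continuous k}) ->
  (forall s : R, 0 < s -> laplace_integrable h s) ->
  (forall s : R, 0 < s -> laplace_integrable k s) ->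
  (forall s : R, 0 < s -> laplace h s = laplace k s) ->
  forall t : R, 0 < t -> h t <= k t.
  move=> ch ck ih ik hk t t0.
  have ik' s : 0 < s -> laplace_integrable (fun t => - 1 * k t) s.
    by move=> s0; exact/laplace_integrableZl/ik.
  have := @lerch_pos (fun t => h t + - 1 * k t) t.
  rewrite mulN1r subr_le0; apply => // [u u0|s s0|s s0].
  - apply: cvgD; first exact: ch.
    by apply: cvgM; [exact: cvg_cst|exact: ck].
  - by apply: laplace_integrableD; [exact: ih|exact: ik'].
  - rewrite laplaceD; [|exact: ih|exact: ik'].
    by rewrite laplaceZl ?hk// ?mulN1r ?subrr//; exact: ik.
move=> cf cg iF ig fg t t0; apply/eqP; rewrite eq_le !main// => s s0.
by rewrite fg.
Qed.

End lerch.

(** * Laplace transform of an Abel integral *)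

Section convolution.
Context {R : realType}.
Local Notation leb := (@lebesgue_measure R).
Local Notation pos := (`]0, +oo[%classic : set R).

(** The real and imaginary parts of the transform of e^{i (b t + c)}, obtained
    from an explicit primitive. *)
Lemma laplace_sin (a b c : R) : 0 < a ->
  leb.-integrable pos (EFin \o (fun t => expR (- (a * t)) * sin (b * t + c))) /\
  \int[leb]_(t in pos) (expR (- (a * t)) * sin (b * t + c)) =
  (a * sin c + b * cos c) / (a ^+ 2 + b ^+ 2).
Proof.
move=> a0; pose N := a ^+ 2 + b ^+ 2.
have N0 : 0 < N by rewrite ltr_pwDl ?exprn_gt0 ?sqr_ge0.
pose F (t : R) := - (N^-1 * (expR (- (a * t)) * (a * sin (b * t + c) + b * cos (b * t + c)))).
have dF (t : R) : 0 < t -> is_derive t 1 F (expR (- (a * t)) * sin (b * t + c)).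
  move=> _; rewrite /F; der; move: N0; rewrite /N => N0; field; exact: lt0r_neq0.
have cf (t : R) : {for t, continuous (fun t => expR (- (a * t)) * sin (b * t + c))}.
  by apply: is_derive_continuous; der.
have fi : leb.-integrable pos (EFin \o (fun t => expR (- (a * t)) * sin (b * t + c))).
  apply: (bounded_laplace_integrable (M := 1) a0).
    by apply: continuous_pos_measurable => t _; apply: is_derive_continuous; der.
  by move=> t _; rewrite ler_norml sin_geN1 sin_le1.
split => //.
rewrite (Rintegral_FTC_pos dF _ fi (l0 := - (N^-1 * (a * sin c + b * cos c))) (l1 := 0)).
- by rewrite sub0r opprK mulrC.
- by move=> t _; exact: cf.
- by apply: is_derive_cvg_at_right; rewrite /F !mulr0 oppr0 expR0 mul1r add0r.
- apply: (powR_expR_dominated_cvg0 (K := N^-1 * (`|a| + `|b|)) (lexx 0) a0) => t t0.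
  rewrite /F normrN powRr0 mul1r normrM -mulrA.
  rewrite gtr0_norm ?invr_gt0// ler_pM2l ?invr_gt0// normrM mulrC.
  rewrite [X in _ * X]ger0_norm ?expR_ge0// ler_wpM2r ?expR_ge0//.
  apply: (le_trans (ler_normD _ _)); rewrite !normrM lerD//.
    by rewrite -[leRHS]mulr1 ler_wpM2l// ler_norml sin_geN1 sin_le1.
  by rewrite -[leRHS]mulr1 ler_wpM2l// ler_norml cos_geN1 cos_le1.
Qed.

Lemma measurable_fun_fst (D E : set R) (f : R -> R) : measurable D ->
  measurable E -> measurable_fun D f ->
  measurable_fun (D `*` E) (fun z : R * R => f z.1).
Proof.
move=> mD mE mf; apply: (@measurable_comp _ _ _ _ _ _ D f (D `*` E) fst) => //.
  by move=> _ [[x y] [/= hx hy] <-].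
exact: measurable_funTS.
Qed.

Lemma measurable_fun_snd (D E : set R) (f : R -> R) : measurable D ->
  measurable E -> measurable_fun E f ->
  measurable_fun (D `*` E) (fun z : R * R => f z.2).
Proof.
move=> mD mE mf; apply: (@measurable_comp _ _ _ _ _ _ E f (D `*` E) snd) => //.
  by move=> _ [[x y] [/= hx hy] <-].
exact: measurable_funTS.
Qed.

(** Extending the kernel by 0 to negative u turns integrals over ]0, t[ into
    integrals over ]0, +oo[, as Fubini requires. *)
Definition kernel (m : R) : R -> R := (fun u => u `^ (- m)) \_ pos.

Lemma measurable_kernel (m : R) : measurable_fun setT (kernel m).
Proof.
apply: (measurable_restrictT _ measurable_pos).1.
by apply: continuous_pos_measurable => t t0; apply: is_derive_continuous; der.
Qed.

Lemma kernelE (m u : R) : kernel m u = if 0 < u then u `^ (- m) else 0.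
Proof.
rewrite /kernel patchE; case: ifPn => [|/negP h].
  by rewrite inE => /posP ->.
by case: ifPn => // u0; exfalso; apply: h; rewrite inE; apply/posP.
Qed.

Definition laplace_kernel (m s : R) : R -> R :=
  (fun u => expR (- (s * u)) * u `^ (- m)) \_ pos.

Lemma shifted_kernel (m s : R) : m < 1 -> 0 < s -> forall tau : R, 0 < tau ->
  leb.-integrable pos (EFin \o (fun t : R => laplace_kernel m s (1 * t - tau))) /\
  \int[leb]_(t in pos) laplace_kernel m s (1 * t - tau) =
    Gamma (1 - m) * s `^ (m - 1).
Proof.
move=> m1 s0 tau tau0; have m1' : 0 < 1 - m by rewrite subr_gt0.
have [iK0 EK0] := laplace_pow m1' s0.
rewrite /laplace_integrable /laplace (_ : 1 - m - 1 = - m) in iK0 EK0; last by ring.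
have iK := (leb_integrable_mkcond _ measurable_pos).1 iK0.
have [i1 E1] := Rintegral_affine (- tau) (oner_neq0 R) iK.
rewrite normr1 invr1 mul1r in E1.
split; first exact: (@leb_integrableS _ pos setT).
rewrite (_ : m - 1 = - (1 - m)); last by rewrite opprB.
rewrite -EK0 [RHS]Rintegral_mkcond -E1 [LHS]Rintegral_mkcond.
apply: eq_leb_Rintegral => t _; rewrite patchE; case: ifPn => // /negP tn.
rewrite patchE ifN//; apply/negP; rewrite inE => /posP h; apply: tn.
rewrite inE; apply/posP; clear -h tau0; lra.
Qed.

(** The transform of a convolution is the product of the transforms.  As the
    kernel is positive, the inner integrals of the absolute values are computed
    exactly, which gives the bound that Fubini requires. *)
Lemma laplace_convolution (m s : R) (g : R -> R) : 0 < m < 1 -> 0 < s ->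
  laplace_integrable g s ->
  (forall t : R, 0 < t -> leb.-integrable `]0, t[
     (EFin \o (fun tau => (t - tau) `^ (- m) * g tau))) ->
  let c t := \int[leb]_(tau in `]0, t[) ((t - tau) `^ (- m) * g tau) in
  laplace_integrable c s /\
  laplace c s = Gamma (1 - m) * s `^ (m - 1) * laplace g s.
Proof.
move=> /andP[m0 m1] s0 ig ic c.
pose f (t tau : R) : R := expR (- (s * t)) * (kernel m (t - tau) * g tau).
have mg : measurable_fun pos g.
  have mh := leb_integrable_measurable ig.
  apply: (eq_measurable_fun (fun t => expR (s * t) * (expR (- (s * t)) * g t))).
    by move=> t _; rewrite mulrA -expRD subrr expR0 mul1r.
  apply: measurable_funM => //; apply: continuous_pos_measurable => t _.
  by apply: is_derive_continuous; der.
have mf : measurable_fun (pos `*` pos) (fun z : R * R => f z.1 z.2).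
  have mE : measurable (pos `*` pos) by exact: measurableX.
  apply: measurable_funM; last apply: measurable_funM.
  - apply: (measurable_fun_fst (f := fun t => expR (- (s * t)))) => //.
    by apply: continuous_pos_measurable => t _; exact: continuous_expRN.
  - apply: (measurableT_comp (measurable_kernel m)).
    by apply: measurable_funB; apply: measurable_funTS.
  - exact: measurable_fun_snd.
have sub (t : R) : 0 < t -> `]0, t[ `<=` pos.
  by move=> t0 x /=; rewrite !in_itv/= andbT => /andP[].
have ft (t tau : R) : 0 < t -> pos tau -> f t tau = expR (- (s * t)) *
    ((fun tau => (t - tau) `^ (- m) * g tau) \_ `]0, t[) tau.
  move=> t0 /posP tau0; rewrite /f kernelE patchE subr_gt0; congr (_ * _).
  case: ifPn => tt; case: ifPn => //.
  - by move=> /negP h; exfalso; apply: h; rewrite inE/= in_itv/= tau0.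
  - by rewrite inE/= in_itv/= tau0 (negPf tt).
  - by rewrite mul0r.
have ic' (t : R) : 0 < t -> leb.-integrable pos (EFin \o
    ((fun tau => (t - tau) `^ (- m) * g tau) \_ `]0, t[)).
  move=> t0; apply: (@leb_integrableS _ pos setT) => //.
  by apply: (leb_integrable_mkcond _ _).1; [exact: measurable_itv|exact: ic].
have it (t : R) : pos t -> leb.-integrable pos (EFin \o f t).
  move=> /posP t0.
  have i1 := ic' t t0.
  apply: eq_leb_integrable (leb_integrableZl (expR (- (s * t))) _ i1) => // tau h.
  by rewrite ft.
have Et (t : R) : pos t -> \int[leb]_(tau in pos) f t tau = expR (- (s * t)) * c t.
  move=> /posP t0.
  have i1 := ic' t t0.
  rewrite /c -[X in _ * Rintegral _ X _](setIidr (sub t t0)) Rintegral_mkcondr.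
  rewrite -leb_RintegralZl//; apply: eq_leb_Rintegral => tau h.
  by rewrite ft.
pose K := laplace_kernel m s.
have Ktau (t tau : R) : 0 < t -> 0 < tau -> f t tau =
    (expR (- (s * tau)) * g tau) * K (1 * t - tau).
  move=> t0 tau0; rewrite /f /K /laplace_kernel mul1r kernelE patchE.
  case: ifPn => tt; last first.
    case: ifPn => //; last by rewrite !(mul0r, mulr0).
    by rewrite inE => /posP h; rewrite h in tt.
  rewrite ifT; last by rewrite inE; apply/posP.
  rewrite (_ : - (s * t) = - (s * tau) + - (s * (t - tau))); last by ring.
  by rewrite expRD; ring.
have affpos := @shifted_kernel m s m1 s0.
have itau (tau : R) : pos tau -> leb.-integrable pos (EFin \o f ^~ tau).
  move=> /posP tau0; have [i1 _] := affpos tau tau0.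
  apply: eq_leb_integrable (leb_integrableZl (expR (- (s * tau)) * g tau) _ i1) => //.
  by move=> t /posP t0; rewrite Ktau.
have G0 : 0 <= Gamma (1 - m) * s `^ (m - 1).
  by rewrite mulr_ge0 ?powR_ge0// ltW// Gamma_gt0// subr_gt0.
have iG := leb_integrableZl (Gamma (1 - m) * s `^ (m - 1)) measurable_pos
  (leb_integrable_norm ig).
have [] := Rintegral_fubini measurable_pos measurable_pos mf it itau iG.
  move=> tau /posP tau0; have [i1 E1] := affpos tau tau0.
  rewrite -E1 mulrC -leb_RintegralZl//.
  rewrite le_eqVlt; apply/orP; left; apply/eqP/eq_leb_Rintegral => t /posP t0.
  rewrite Ktau// normrM [X in _ * X]ger0_norm// /K /laplace_kernel patchE; case: ifP => // _.
  by rewrite mulr_ge0 ?expR_ge0 ?powR_ge0.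
move=> ifc Efc; split.
  by apply: eq_leb_integrable ifc => // t h; rewrite Et.
rewrite /laplace -leb_RintegralZl//.
transitivity (\int[leb]_(t in pos) \int[leb]_(tau in pos) f t tau).
  by apply: eq_leb_Rintegral => t h; rewrite Et.
rewrite Efc; apply: eq_leb_Rintegral => tau /posP tau0.
have [i1 E1] := affpos tau tau0.
rewrite -E1 mulrC -leb_RintegralZl//.
by apply: eq_leb_Rintegral => t /posP t0; rewrite Ktau.
Qed.

End convolution.

(** * Abel integrals of functions with a power singularity *)

Lemma derive_ge0_le {R : realType} (f df : R -> R) (x y : R) : x <= y ->
  (forall z, x <= z <= y -> is_derive z 1 f (df z)) ->
  (forall z, x <= z <= y -> 0 <= df z) -> f x <= f y.
Proof.
move=> xy dfz df0.
have inz z : z \in `[x, y] -> x <= z <= y by rewrite in_itv.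
have [||c cxy E] := @MVT_segment R f df x y xy.
- by move=> z /subset_itv_oo_cc /inz; exact: dfz.
- apply: continuous_in_subspaceT => z; rewrite inE => /inz /dfz.
  exact: is_derive_continuous.
- by rewrite -subr_ge0 E mulr_ge0 ?subr_ge0// df0// inz.
Qed.


Section abel.
Context {R : realType}.
Local Notation leb := (@lebesgue_measure R).
Local Notation pos := (`]0, +oo[%classic : set R).

Lemma powR_le_neg (a x y : R) : a <= 0 -> 0 < x -> x <= y -> y `^ a <= x `^ a.
Proof.
move=> a0 x0 xy; rewrite !powR_expR_ln ?(lt_le_trans x0)//.
by rewrite ler_expR ler_wnM2l// ler_ln ?posrE// (lt_le_trans x0).
Qed.

Lemma integrable_powR_itv (a t : R) : 0 < a -> 0 < t ->
  leb.-integrable `]0, t[ (EFin \o (fun tau => tau `^ (a - 1))).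
Proof.
move=> a0 t0; have sub : `]0, t[ `<=` pos.
  by move=> x /=; rewrite !in_itv/= andbT => /andP[].
have i := leb_integrableS (measurable_itv `]0, t[) measurable_pos sub
  (integrable_powR_expRN a0 (ltr01 : (0 : R) < 1)).
apply: (integrable_bounded_by _ _ (leb_integrableZl (expR t) _ i)) => //.
  apply: measurable_funS sub _ => //; apply: continuous_pos_measurable => x x0.
  exact: is_derive_continuous (der_pow (a - 1) x0).
move=> x; rewrite /= in_itv/= => /andP[x0 xt].
rewrite ger0_norm ?powR_ge0// mulrA -expRD ler_peMl ?powR_ge0//.
by rewrite mul1r -expR0 ler_expR subr_ge0 ltW.
Qed.

Lemma integrable_powR_itv_sub (m t : R) : m < 1 -> 0 < t ->
  leb.-integrable `]0, t[ (EFin \o (fun tau => (t - tau) `^ (- m))).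
Proof.
move=> m1 t0; have m0 : 0 < 1 - m by rewrite subr_gt0.
have := integrable_powR_itv m0 t0; rewrite addrAC subrr add0r.
move=> /(leb_integrable_mkcond _ (measurable_itv _)).1 i.
have n1 : - 1 != 0 :> R by rewrite oppr_eq0 oner_eq0.
have [j _] := Rintegral_affine t n1 i.
apply/leb_integrable_mkcond => //.
apply: eq_leb_integrable j => // tau _; rewrite !patchE mulN1r addrC.
rewrite (_ : (t - tau \in _) = (tau \in `]0, t[%classic))//.
by apply/idP/idP; rewrite !inE/= !in_itv/=; lra.
Qed.

(** Each of the two factors is singular at one end only: compare tau with
    t / 2. *)
Lemma beta_major (m a t tau : R) : 0 < m -> a < 1 -> 0 < tau < t ->
  (t - tau) `^ (- m) * tau `^ (a - 1) <=
  (t / 2) `^ (- m) * tau `^ (a - 1) + (t / 2) `^ (a - 1) * (t - tau) `^ (- m).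
Proof.
move=> m0 a1 /andP[tau0 taut]; have t20 : 0 < t / 2 by rewrite divr_gt0// (lt_trans tau0).
have [h|h] := leP tau (t / 2).
  rewrite -[leLHS]addr0; apply: lerD; last by rewrite mulr_ge0 ?powR_ge0.
  by rewrite ler_wpM2r ?powR_ge0// powR_le_neg ?oppr_le0 ?(ltW m0)//; lra.
rewrite -[leLHS]add0r; apply: lerD; first by rewrite mulr_ge0 ?powR_ge0.
by rewrite mulrC ler_wpM2r ?powR_ge0// powR_le_neg ?subr_le0 ?(ltW a1) ?(ltW h).
Qed.

Variables (m a K : R) (g : R -> R).
Hypotheses (m01 : 0 < m < 1) (a01 : 0 < a < 1).
Hypothesis cg : forall t : R, 0 < t -> {for t, continuous g}.
Hypothesis gK : forall t : R, 0 < t -> `|g t| <= K * t `^ (a - 1).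

Let itv_pos (t : R) : `]0, t[ `<=` pos.
Proof. by move=> x /=; rewrite !in_itv/= andbT => /andP[]. Qed.

Let integrable_beta (t : R) : 0 < t ->
  leb.-integrable `]0, t[ (EFin \o (fun tau => (t - tau) `^ (- m) * tau `^ (a - 1))).
Proof.
have /andP[m0 m1] := m01; have /andP[a0 a1] := a01.
move=> t0; have i1 := integrable_powR_itv a0 t0; have i2 := integrable_powR_itv_sub m1 t0.
have mI := measurable_itv (`]0, t[ : interval R).
apply: (integrable_bounded_by mI _ (leb_integrableD mI
  (leb_integrableZl ((t / 2) `^ (- m)) mI i1) (leb_integrableZl ((t / 2) `^ (a - 1)) mI i2))).
  by apply: measurable_funM; [exact: leb_integrable_measurable i2|exact: leb_integrable_measurable i1].
move=> x; rewrite /= in_itv/= => hx; rewrite ger0_norm ?mulr_ge0 ?powR_ge0//.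
exact: beta_major.
Qed.

Lemma integrable_abel (t : R) : 0 < t ->
  leb.-integrable `]0, t[ (EFin \o (fun tau => (t - tau) `^ (- m) * g tau)).
Proof.
move=> t0; have /andP[m0 m1] := m01; have mI := measurable_itv (`]0, t[ : interval R).
have i2 := integrable_powR_itv_sub m1 t0.
apply: (integrable_bounded_by mI _ (leb_integrableZl K mI (integrable_beta t0))).
  apply: measurable_funM; first exact: leb_integrable_measurable i2.
  exact: measurable_funS measurable_pos (@itv_pos t) (continuous_pos_measurable cg).
move=> x; rewrite /= in_itv/= => /andP[x0 xt].
by rewrite normrM (ger0_norm (powR_ge0 _ _)) mulrCA ler_wpM2l ?powR_ge0// gK.
Qed.

(** Rescaling tau = t th puts the integral on the fixed interval ]0, 1[, where
    dominated convergence applies. *)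
Lemma continuous_abel (t : R) : 0 < t ->
  {for t, continuous (fun t : R => \int[leb]_(tau in `]0, t[) ((t - tau) `^ (- m) * g tau))}.
Proof.
move=> t0; have /andP[m0 m1] := m01; have /andP[a0 a1] := a01.
pose c t := t * \int[leb]_(th in `]0, 1[) ((t - t * th) `^ (- m) * g (t * th)).
have scale (s : R) : 0 < s ->
    leb.-integrable `]0, 1[ (EFin \o (fun th => (s - s * th) `^ (- m) * g (s * th))) /\
    \int[leb]_(tau in `]0, s[) ((s - tau) `^ (- m) * g tau) = c s.
  move=> s0; have := (leb_integrable_mkcond _ (measurable_itv `]0, s[)).1 (integrable_abel s0).
  move=> i; have [] := Rintegral_affine 0 (lt0r_neq0 s0) i.
  have E x : ((fun tau => (s - tau) `^ (- m) * g tau) \_ `]0, s[) (s * x + 0) =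
      ((fun th => (s - s * th) `^ (- m) * g (s * th)) \_ `]0, 1[) x.
    rewrite !patchE addr0 (_ : (s * x \in _) = (x \in `]0, 1[%classic))//.
    apply/idP/idP; rewrite !inE/= !in_itv/= => /andP[h1 h2].
      by rewrite -(pmulr_rgt0 _ s0) h1/= -(ltr_pM2l s0) mulr1.
    by rewrite mulr_gt0//= gtr_pMr.
  move=> i'; rewrite (gtr0_norm s0) => E'; split.
    apply/leb_integrable_mkcond => //; exact: eq_leb_integrable i'.
  rewrite [LHS]Rintegral_mkcond -[LHS](mulVKf (lt0r_neq0 s0)) -E' /c; congr (_ * _).
  by rewrite [RHS]Rintegral_mkcond; apply: eq_leb_Rintegral => x _.
have cE s (s0 : 0 < s) := (scale s s0).2.
have near_pos : \forall s \near t, 0 < s by exact: lt_nbhsr.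
suff cc : {for t, continuous c}.
  rewrite /prop_for/= /continuous_at cE//; apply: cvg_trans cc.
  by apply: near_eq_cvg; near=> s; rewrite cE//; near: s.
apply: cvgM; first exact: cvg_id.
have t20 : 0 < t / 2 by rewrite divr_gt0.
have mI := measurable_itv (`]0, 1[ : interval R).
pose K' := (t / 2) `^ (- m) * (K * (t / 2) `^ (a - 1)).
have K0 : 0 <= K.
  have := le_trans (normr_ge0 _) (gK t0); rewrite pmulr_lge0//; exact: powR_gt0.
apply: (@continuous_under_integral R (fun s th => (s - s * th) `^ (- m) * g (s * th))
  `]0, 1[%classic (t / 2) (t + 1) t (fun th => K' * ((1 - th) `^ (- m) * th `^ (a - 1)))) => //.
- by apply/andP; split; lra.
- move=> s /andP[s0 _]; exact: leb_integrable_measurable (scale s (lt_trans t20 s0)).1.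
- move=> s th /andP[s0 _]; rewrite /= in_itv/= => /andP[th0 th1].
  have sp := lt_trans t20 s0.
  have sth : 0 < s - s * th by rewrite -[s in s - _]mulr1 -mulrBr mulr_gt0// subr_gt0.
  have h1 : {for s, continuous (fun s : R => s - s * th)}.
    by apply: is_derive_continuous; der; reflexivity.
  have h2 : {for s, continuous (fun s : R => s * th)}.
    by apply: is_derive_continuous; der; reflexivity.
  apply: cvgM; first exact: (cvg_comp _ _ h1 (is_derive_continuous (der_pow (- m) sth))).
  exact: (cvg_comp _ _ h2 (cg (mulr_gt0 sp th0))).
- apply: leb_integrableZl => //; exact: integrable_beta.
- move=> s th /andP[s0 _]; rewrite /= in_itv/= => /andP[th0 th1].
  have sp := lt_trans t20 s0.
  rewrite normrM (ger0_norm (powR_ge0 _ _)).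
  have -> : s - s * th = s * (1 - th) by ring.
  rewrite powRM ?(ltW sp) ?subr_ge0 ?(ltW th1)//.
  have h1 : s `^ (- m) <= (t / 2) `^ (- m) by rewrite powR_le_neg ?oppr_le0 ?ltW.
  have h2 : s `^ (a - 1) <= (t / 2) `^ (a - 1) by rewrite powR_le_neg ?subr_le0 ?ltW.
  have h3 := gK (mulr_gt0 sp th0); rewrite powRM ?(ltW sp) ?(ltW th0)// in h3.
  apply: (@le_trans _ _ ((t / 2) `^ (- m) * (1 - th) `^ (- m) * (K * ((t / 2) `^ (a - 1) * th `^ (a - 1))))).
    apply: ler_pM => //; first by rewrite mulr_ge0 ?powR_ge0.
      by rewrite ler_wpM2r ?powR_ge0.
    by apply: (le_trans h3); rewrite ler_wpM2l// ler_wpM2r ?powR_ge0.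
  by rewrite le_eqVlt; apply/orP; left; apply/eqP; rewrite /K'; ring.
Unshelve. all: by end_near. Qed.

End abel.

(** Adding and subtracting k t^n makes y monotone: y + k t^n increases and
    y - k t^n decreases, so both have the same limit at 0. *)
Lemma limit_of_integrable_derivative {R : realType} (y dy : R -> R) (k n : R) : 0 < n ->
  (forall t : R, 0 < t -> is_derive t 1 y (dy t)) ->
  (forall t : R, 0 < t -> `|dy t| <= k * (n * t `^ (n - 1))) ->
  exists2 c, y t @[t --> 0^'+] --> c & forall t, 0 < t -> `|y t - c| <= k * t `^ n.
Proof.
move=> n0 dyd dyk.
have k0 : 0 <= k.
  have := le_trans (normr_ge0 _) (dyk 1 ltr01); rewrite pmulr_lge0// mulr_gt0//.
have dk (t : R) : 0 < t -> is_derive t 1 (fun t => k * t `^ n) (k * (n * t `^ (n - 1))).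
  by move=> t0; der; rewrite mul0r add0r.
have bd (t : R) : 0 < t -> - (k * (n * t `^ (n - 1))) <= dy t <= k * (n * t `^ (n - 1)).
  by move=> t0; rewrite -ler_norml; exact: dyk.
pose g t := y t + k * t `^ n; pose h t := k * t `^ n - y t.
have gm s t : 0 < s -> s <= t -> g s <= g t.
  move=> s0 st; apply: (derive_ge0_le (df := fun y => dy y + k * (n * y `^ (n - 1))) st).
    by move=> z /andP[sz _]; have z0 := lt_le_trans s0 sz; have := dk z z0; have := dyd z z0 => *; der.
  by move=> z /andP[sz _]; have /andP[] := bd z (lt_le_trans s0 sz); lra.
have hm s t : 0 < s -> s <= t -> h s <= h t.
  move=> s0 st; apply: (derive_ge0_le (df := fun y => k * (n * y `^ (n - 1)) - dy y) st).
    by move=> z /andP[sz _]; have z0 := lt_le_trans s0 sz; have := dk z z0; have := dyd z z0 => *; der.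
  by move=> z /andP[sz _]; have /andP[] := bd z (lt_le_trans s0 sz); lra.
have hg s t : 0 < s -> 0 < t -> - h t <= g s.
  move=> s0 t0; have kk (u : R) : 0 < u -> 0 <= k * u `^ n by rewrite mulr_ge0 ?powR_ge0.
  have gh (u : R) : 0 < u -> - h u <= g u by move=> u0; have := kk u u0; rewrite /h /g; lra.
  have [st|ts] := leP s t.
    by apply: le_trans (gh s s0); rewrite lerN2 hm.
  by apply: (le_trans (gh t t0)); rewrite gm// ltW.
pose A := [set g x | x in `]0, +oo[].
have lbA : has_lbound A by exists (- h 1) => _ [x /posP x0 <-]; exact: hg.
have A0 : A !=set0 by exists (g 1), 1 => //; apply/posP.
have gc : g t @[t --> 0^'+] --> inf A.
  apply: (nondecreasing_at_right_cvgr (b := +oo%O)) => // x z.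
  by rewrite !in_itv/= !andbT => x0 _; exact: gm.
exists (inf A).
  have p0 : k * t `^ n @[t --> 0^'+] --> 0.
    rewrite -[0 in X in _ --> X](mulr0 k); apply: cvgM; [exact: cvg_cst|exact: powR_cvg0].
  have E : g \- (fun t => k * t `^ n) = y by apply/funext => t; rewrite /g /= addrK.
  have H : (g \- (fun t => k * t `^ n)) t @[t --> 0^'+] --> inf A - 0 by exact: cvgB.
  by rewrite E subr0 in H.
move=> t t0; have h1 : inf A <= g t by apply: inf_lbound => //; exists t => //; apply/posP.
have h2 : - h t <= inf A by apply: lb_le_inf => // _ [x /posP x0 <-]; exact: hg.
by move: h1 h2; rewrite /g /h ler_norml => h1 h2; apply/andP; split; lra.
Qed.

(** * The pole 1 / (1 - p e^{-w}) *)

Section pole.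
Context {R : realType}.
Local Notation leb := (@lebesgue_measure R).
Variables (p : R) (p0 : 0 < p).
Implicit Types (v th : R).

(** With w = v + i th, pole_den is |1 - p e^{-w}|^2, and pole_re, pole_im are the
    real and imaginary parts of h = 1 / (1 - p e^{-w}).  The primed functions are
    those of h' = h - h^2. *)
Definition pole_den v th : R :=
  1 - 2 * (p * expR (- v)) * cos th + (p * expR (- v)) ^+ 2.
Definition pole_re v th : R := (1 - p * expR (- v) * cos th) / pole_den v th.
Definition pole_im v th : R := - (p * expR (- v) * sin th / pole_den v th).
Definition pole_re' v th : R :=
  pole_re v th - (pole_re v th ^+ 2 - pole_im v th ^+ 2).
Definition pole_im' v th : R := pole_im v th - 2 * pole_re v th * pole_im v th.

Let y0 v : 0 < p * expR (- v). Proof. by rewrite mulr_gt0 ?expR_gt0. Qed.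

Lemma pole_denE1 v th : pole_den v th =
  (1 - p * expR (- v) * cos th) ^+ 2 + (p * expR (- v) * sin th) ^+ 2.
Proof.
have := cos2Dsin2 th; rewrite /pole_den => h.
transitivity (1 - 2 * (p * expR (- v)) * cos th + (p * expR (- v)) ^+ 2 * (cos th ^+ 2 + sin th ^+ 2)).
  by rewrite h mulr1.
ring.
Qed.

Lemma pole_denE2 v th : pole_den v th =
  (p * expR (- v) - cos th) ^+ 2 + sin th ^+ 2.
Proof.
have := cos2Dsin2 th; rewrite /pole_den => h.
transitivity ((cos th ^+ 2 + sin th ^+ 2) - 2 * (p * expR (- v)) * cos th + (p * expR (- v)) ^+ 2).
  by rewrite h.
ring.
Qed.

Lemma pole_den_gt0 v th : sin th != 0 -> 0 < pole_den v th.
Proof.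
by move=> s0; rewrite pole_denE2 ltr_wpDl ?sqr_ge0// lt_neqAle eq_sym sqrf_eq0 s0 sqr_ge0.
Qed.

Lemma pole_den_ge v th : (1 - p * expR (- v)) ^+ 2 <= pole_den v th.
Proof. by rewrite /pole_den; have := y0 v; have := cos_le1 th; nra. Qed.

Lemma pole_sqr v th : pole_den v th != 0 ->
  pole_re v th ^+ 2 + pole_im v th ^+ 2 = (pole_den v th)^-1.
Proof.
move=> N0; rewrite /pole_re /pole_im sqrrN !expr_div_n -mulrDl -pole_denE1.
by field.
Qed.

Lemma pole_le v th (c : R) : 0 < pole_den v th -> 0 < c ->
  c ^+ 2 <= pole_den v th -> `|pole_re v th| <= c^-1 /\ `|pole_im v th| <= c^-1.
Proof.
move=> N0 c0 cN.
have h : pole_re v th ^+ 2 + pole_im v th ^+ 2 <= c^-1 ^+ 2.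
  by rewrite pole_sqr ?gt_eqF// exprVn lef_pV2 ?posrE// exprn_gt0.
have := sqr_ge0 (pole_re v th); have := sqr_ge0 (pole_im v th) => h1 h2.
have ci : 0 <= c^-1 by rewrite invr_ge0 ltW.
by split; rewrite -ler_sqr ?nnegrE// real_normK ?num_real//; lra.
Qed.

Let im2 v th : pole_im v th ^+ 2 =
  (p * expR (- v)) ^+ 2 * (1 - cos th ^+ 2) / pole_den v th ^+ 2.
Proof.
rewrite /pole_im sqrrN expr_div_n exprMn; congr (_ * _ / _).
by have := cos2Dsin2 th => h; lra.
Qed.

Lemma der_pole_den_v v th : is_derive v 1 (pole_den ^~ th)
  (2 * (p * expR (- v)) * cos th - 2 * (p * expR (- v)) ^+ 2).
Proof.
rewrite /pole_den; der; ring.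
Qed.

Lemma der_pole_den_th v th : is_derive th 1 (pole_den v)
  (2 * (p * expR (- v)) * sin th).
Proof. by rewrite /pole_den; der; ring. Qed.

Lemma der_pole_re_v v th : pole_den v th != 0 ->
  is_derive v 1 (pole_re ^~ th) (pole_re' v th).
Proof.
move=> N0; have h := der_pole_den_v v th; rewrite /pole_re; der.
rewrite /pole_re' im2 /pole_re; move: N0.
rewrite /pole_den => N0; field; exact: N0.
Qed.

Lemma der_pole_im_v v th : pole_den v th != 0 ->
  is_derive v 1 (pole_im ^~ th) (pole_im' v th).
Proof.
move=> N0; have h := der_pole_den_v v th; rewrite /pole_im; der.
rewrite /pole_im' /pole_im /pole_re; move: N0.
rewrite /pole_den => N0; field; exact: N0.
Qed.

Lemma der_pole_re_th v th : pole_den v th != 0 ->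
  is_derive th 1 (pole_re v) (- pole_im' v th).
Proof.
move=> N0; have h := der_pole_den_th v th; rewrite /pole_re; der.
rewrite /pole_im' /pole_im /pole_re; move: N0.
rewrite /pole_den => N0; field; exact: N0.
Qed.

Lemma der_pole_im_th v th : pole_den v th != 0 ->
  is_derive th 1 (pole_im v) (pole_re' v th).
Proof.
move=> N0; have h := der_pole_den_th v th; rewrite /pole_im; der.
rewrite /pole_re' im2 /pole_re.
transitivity (- (p * expR (- v) * cos th * pole_den v th
  - 2 * (p * expR (- v)) ^+ 2 * sin th ^+ 2) / pole_den v th ^+ 2).
  by field.
have -> : sin th ^+ 2 = 1 - cos th ^+ 2 by have := cos2Dsin2 th => h2; lra.
move: N0; rewrite /pole_den => N0; field; exact: N0.
Qed.

End pole.

(** * Cauchy's formula on a ray, in logarithmic coordinates *)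

Section real_line.
Context {R : realType}.
Local Notation leb := (@lebesgue_measure R).

Lemma real_exhaustion : [/\ forall n, - n.+1%:R < n.+1%:R :> R &
  forall x : R, \forall n \near \oo, - n.+1%:R <= x <= n.+1%:R].
Proof.
split => [n|x]; first by rewrite gtrN.
exists (Num.bound `|x|) => // n /= xn.
rewrite -ler_norml; apply/ltW/(lt_le_trans (archi_boundP (normr_ge0 x))).
by rewrite ler_nat leqW.
Qed.

Lemma Rintegral_FTC_real (F f : R -> R) (l0 l1 : R) :
  (forall x : R, is_derive x 1 F (f x)) ->
  (forall x : R, {for x, continuous f}) ->
  leb.-integrable setT (EFin \o f) ->
  F (- n.+1%:R) @[n --> \oo] --> l0 -> F n.+1%:R @[n --> \oo] --> l1 ->
  \int[leb]_x f x = l1 - l0.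
Proof.
move=> dF cf fi F0 F1; have [E1 E2] := real_exhaustion.
apply: (@Rintegral_FTC_exhaustion R setT F f _ _ l0 l1 measurableT E1 _ _ _ _ fi F0 F1).
- by [].
- by move=> x _; exact: E2.
- by move=> x _; exact: cf.
Qed.

Lemma cvgn_natr_y : n.+1%:R @[n --> \oo] --> (+oo : set_system R).
Proof.
have := @cvgr_idn R; rewrite -(cvg_shiftn 1); apply: cvg_trans.
by apply: near_eq_cvg; apply: nearW => n /=; rewrite addn1.
Qed.

Lemma sech_cvg0 (d : R) : 0 < d -> (sech d (- n.+1%:R) @[n --> \oo] --> 0) /\
  (sech d n.+1%:R @[n --> \oo] --> 0).
Proof.
move=> d0; have E n : sech d (- n.+1%:R) = sech d n.+1%:R.
  by rewrite /sech mulrN opprK addrC.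
suff h : sech d n.+1%:R @[n --> \oo] --> 0.
  by split => //; under eq_fun do rewrite E.
have h : sech d t @[t --> +oo] --> 0.
  apply: (@inv_dominated_cvg0 _ _ d^-1) => t t0.
  rewrite gtr0_norm ?sech_gt0// -invfM lef_pV2 ?posrE ?mulr_gt0 ?addr_gt0 ?expR_gt0//.
  by have := expR_ge1Dx (d * t); have := expR_gt0 (- (d * t)); lra.
by move/cvg_pinftyP : h; apply; exact: cvgn_natr_y.
Qed.

Lemma sech_dominated_cvg0 (d : R) (f : R -> R) (M : R) (u : nat -> R) :
  (forall v, `|f v| <= M * sech d v) -> sech d (u n) @[n --> \oo] --> 0 ->
  f (u n) @[n --> \oo] --> 0.
Proof.
move=> fM su; have h : M * sech d (u n) @[n --> \oo] --> M * 0.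
  by apply: cvgM; [exact: cvg_cst|exact: su].
rewrite mulr0 in h; apply: norm_cvg0; apply: (squeeze_cvgr _ _ h); last exact: cvg_cst.
by apply: nearW => n; rewrite normr_ge0/=.
Qed.

Lemma integrable_sech_dominated (d M : R) (f : R -> R) : 0 < d -> continuous f ->
  (forall v, `|f v| <= M * sech d v) -> leb.-integrable setT (EFin \o f).
Proof.
move=> d0 cf fM.
apply: (integrable_bounded_by _ _ (leb_integrableZl M _ (integrable_sech d0))) => //.
exact: continuous_measurable_fun.
Qed.

End real_line.

Lemma lipschitz_segment {R : realType} (f df : R -> R) (M x y : R) : x <= y ->
  (forall z, x <= z <= y -> is_derive z 1 f (df z)) ->
  (forall z, x <= z <= y -> `|df z| <= M) -> `|f y - f x| <= M * (y - x).
Proof.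
move=> xy dfz dfM.
have inz z : z \in `[x, y] -> x <= z <= y by rewrite in_itv.
have [||c cxy E] := @MVT_segment R f df x y xy.
- by move=> z /subset_itv_oo_cc /inz; exact: dfz.
- apply: continuous_in_subspaceT => z; rewrite inE => /inz /dfz.
  exact: is_derive_continuous.
- by rewrite E normrM (ger0_norm (_ : 0 <= y - x)) ?subr_ge0// ler_wpM2r ?subr_ge0// dfM// inz.
Qed.

(** C and S are the real and imaginary parts of a function F (v + i th), and
    C' and S' those of its derivative: the first four fields are the
    Cauchy-Riemann equations.  The bound allows |F| to be as large as e^{-v} for
    v -> - oo, up to a factor which is integrable at both ends; the last field
    says that F is real on the real axis. *)
Record holomorphic_pair {R : realType} (b d K : R) (C S C' S' : R -> R -> R) :
    Prop := HolomorphicPair {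
  hol_dCv : forall v th : R, is_derive v 1 (C ^~ th) (C' v th) ;
  hol_dSv : forall v th : R, is_derive v 1 (S ^~ th) (S' v th) ;
  hol_dCth : forall v th : R, is_derive th 1 (C v) (- S' v th) ;
  hol_dSth : forall v th : R, is_derive th 1 (S v) (C' v th) ;
  hol_cC' : forall v th : R, {for v, continuous (C' ^~ th)} ;
  hol_cS' : forall v th : R, {for v, continuous (S' ^~ th)} ;
  hol_bound : forall v th : R, 0 <= th <= b ->
    [/\ `|C v th| <= K * sech d v * (1 + expR (- v)),
        `|S v th| <= K * sech d v * (1 + expR (- v)),
        `|C' v th| <= K * sech d v * (1 + expR (- v)) &
        `|S' v th| <= K * sech d v * (1 + expR (- v))] ;
  hol_real : forall v : R, S v 0 = 0 }.

Section cauchy_constant.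
Context {R : realType}.
Local Notation leb := (@lebesgue_measure R).
(** U and V are the imaginary and real parts of F / (1 - p e^{-w}); D is the
    real part of its derivative.  The integral of U over v does not depend on th,
    because its derivative is the integral over the line of D, the v-derivative
    of V, and V vanishes at both ends.  As th -> 0 the integrand tends to 0 except
    at the pole v0 = ln p; subtracting F (v0) times the imaginary part of the pole,
    whose integral is th - pi, leaves a function dominated uniformly in th. *)
Variables (b d K p : R) (C S C' S' : R -> R -> R).
Hypotheses (bpi : 0 < b < pi) (d01 : 0 < d <= 1) (p0 : 0 < p).
Hypothesis hol : holomorphic_pair b d K C S C' S'.

Let d0 : 0 < d. Proof. by case/andP: d01. Qed.

Let U (th v : R) := C v th * pole_im p v th + S v th * pole_re p v th.
Let V (th v : R) := C v th * pole_re p v th - S v th * pole_im p v th.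
Let D (th v : R) := C' v th * pole_re p v th + C v th * pole_re' p v th -
  (S' v th * pole_im p v th + S v th * pole_im' p v th).

Let sin_pos (th : R) : 0 < th < b -> 0 < sin th.
Proof.
move=> /andP[t0 tb]; apply: sin_gt0_pi; rewrite t0 (lt_trans tb)//.
by case/andP: bpi.
Qed.

Let den0 (v th : R) : 0 < th < b -> pole_den p v th != 0.
Proof. by move=> /sin_pos s0; rewrite gt_eqF// pole_den_gt0// gt_eqF. Qed.

Let derU (v th : R) : 0 < th < b -> is_derive th 1 (U ^~ v) (D th v).
Proof.
move=> hth; have N0 := den0 v hth.
have h1 := hol_dCth hol v th; have h2 := hol_dSth hol v th.
have h3 := der_pole_re_th N0; have h4 := der_pole_im_th N0.
rewrite /U /D; der; ring.
Qed.

Let derV (v th : R) : 0 < th < b -> is_derive v 1 (V th) (D th v).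
Proof.
move=> hth; have N0 := den0 v hth.
have h1 := hol_dCv hol v th; have h2 := hol_dSv hol v th.
have h3 := der_pole_re_v N0; have h4 := der_pole_im_v N0.
by rewrite /V /D; der.
Qed.

Let contD (v th : R) : 0 < th < b -> {for v, continuous (D th)}.
Proof.
move=> hth; have N0 := den0 v hth.
have h1 := is_derive_continuous (hol_dCv hol v th).
have h2 := is_derive_continuous (hol_dSv hol v th).
have h3 := is_derive_continuous (der_pole_re_v N0).
have h4 := is_derive_continuous (der_pole_im_v N0).
have h5 := hol_cC' hol (v := v) (th := th).
have h6 := hol_cS' hol (v := v) (th := th).
have h7 : {for v, continuous (pole_re' p ^~ th)}.
  apply: cvgB; first exact: h3.
  by apply: cvgB; apply: cvgM => //.
have h8 : {for v, continuous (pole_im' p ^~ th)}.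
  apply: cvgB; first exact: h4.
  by apply: cvgM => //; apply: cvgM => //; exact: cvg_cst.
by apply: cvgB; apply: cvgD; apply: cvgM.
Qed.

(** The bound on F grows like 1 + e^{-v}, which the pole absorbs: it decays
    like 1 / (1 + p e^{-v}). *)
Let cp := 1 + p^-1.

Let cpP (v : R) : (1 + expR (- v)) / (1 + p * expR (- v)) <= cp.
Proof.
have e0 := expR_gt0 (- v); have pi0 : 0 < p^-1 by rewrite invr_gt0.
rewrite ler_pdivrMr ?addr_gt0 ?mulr_gt0//.
have -> : cp * (1 + p * expR (- v)) = 1 + expR (- v) + (p^-1 + p * expR (- v)).
  by rewrite /cp; field; rewrite gt_eqF.
by rewrite lerDl addr_ge0 ?ltW// mulr_gt0.
Qed.

Let K0 : 0 <= K.
Proof.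
have b0 : 0 <= (0 : R) <= b by rewrite lexx/= ltW//; case/andP: bpi.
have [h _ _ _] := hol_bound hol 0 b0.
have := le_trans (normr_ge0 _) h.
rewrite -mulrA pmulr_lge0// mulr_gt0 ?sech_gt0// addr_gt0 ?expR_gt0//.
Qed.

Let norm2 (a1 a2 x1 x2 A X : R) : `|a1| <= A -> `|a2| <= A -> `|x1| <= X ->
  `|x2| <= X -> `|a1 * x1 + a2 * x2| <= 2 * (A * X).
Proof.
move=> h1 h2 h3 h4; apply: (le_trans (ler_normD _ _)); rewrite !normrM.
have : `|a1| * `|x1| <= A * X by apply: ler_pM.
have : `|a2| * `|x2| <= A * X by apply: ler_pM.
lra.
Qed.

Let norm2B (a1 a2 x1 x2 A X : R) : `|a1| <= A -> `|a2| <= A -> `|x1| <= X ->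
  `|x2| <= X -> `|a1 * x1 - a2 * x2| <= 2 * (A * X).
Proof.
move=> h1 h2 h3 h4; rewrite -mulrN; apply: norm2 => //; by rewrite normrN.
Qed.

Let pole'_le (q1 q2 B : R) : `|q1| <= B -> `|q2| <= B ->
  `|q1 - (q1 ^+ 2 - q2 ^+ 2)| <= B + 2 * (B * B) /\
  `|q2 - 2 * q1 * q2| <= B + 2 * (B * B).
Proof.
move=> h1 h2; split.
  apply: (le_trans (ler_normB _ _)); apply: lerD => //.
  by rewrite !expr2; apply: norm2B.
apply: (le_trans (ler_normB _ _)); apply: lerD => //.
by rewrite -mulrA normrM ger0_norm// ler_pM2l// normrM ler_pM.
Qed.

(** For a < th < b one has pole_den >= k^2 (1 + p e^{-v})^2 with
    k = (1 - cos a) / 2, as cos th <= cos a. *)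
Let bounds (a : R) : 0 < a < b -> exists2 M, 0 <= M & forall th v : R,
  a < th < b -> [/\ `|U th v| <= M * sech d v, `|V th v| <= M * sech d v &
    `|D th v| <= M * sech d v].
Proof.
move=> ab; pose k := (1 - cos a) / 2.
have s0 := sin_pos ab.
have k1 : k <= 1 by have := cos_geN1 a; rewrite /k; lra.
have k0 : 0 < k.
  by have := cos2Dsin2 a; have := cos_le1 a; rewrite /k; nra.
have ki : 0 < k^-1 by rewrite invr_gt0.
have cp0 : 0 <= cp by rewrite addr_ge0// invr_ge0 ltW.
exists (K * cp * k^-1 * (4 + 4 * k^-1)) => [|th v ath].
  by rewrite !mulr_ge0// ?addr_ge0 ?mulr_ge0// ltW.
have [a0 ab'] := andP ab; have [b0 bpi'] := andP bpi; have [ath' thb] := andP ath.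
have hth : 0 < th < b by rewrite (lt_trans a0).
have cth : cos th <= cos a.
  rewrite ltW// ltr_cos// in_itv/=; lra.
pose y := p * expR (- v); have y0 : 0 < y by rewrite mulr_gt0 ?expR_gt0.
pose B := (k * (1 + y))^-1.
have [h1 h2] : `|pole_re p v th| <= B /\ `|pole_im p v th| <= B.
  apply: pole_le; first by rewrite pole_den_gt0// gt_eqF// sin_pos.
    by rewrite mulr_gt0// addr_gt0.
  rewrite /pole_den -/y.
  have : 0 <= (1 - k) * (1 - y) ^+ 2 by rewrite mulr_ge0 ?sqr_ge0// subr_ge0.
  have : 0 <= (k - k ^+ 2) * (1 + y) ^+ 2.
    by rewrite mulr_ge0 ?sqr_ge0//; nra.
  have : 0 <= y * (1 - 2 * k - cos th).
    by rewrite mulr_ge0// ?(ltW y0)// /k; lra.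
  nra.
pose E := K * sech d v * (1 + expR (- v)).
have E0 : 0 <= E.
  by rewrite !mulr_ge0// ?(ltW (sech_gt0 _ _))// addr_ge0// expR_ge0.
have B0 : 0 <= B := le_trans (normr_ge0 _) h1.
have Bk : B <= k^-1.
  by rewrite /B invfM ler_piMr ?(ltW ki)// invf_le1; lra.
have EB : E * B <= K * cp * k^-1 * sech d v.
  rewrite /E /B invfM.
  have -> : K * sech d v * (1 + expR (- v)) * (k^-1 / (1 + y)) =
    (K * k^-1 * sech d v) * ((1 + expR (- v)) / (1 + y)) by ring.
  have -> : K * cp * k^-1 * sech d v = (K * k^-1 * sech d v) * cp by ring.
  apply: ler_wpM2l; last exact: cpP.
  by rewrite !mulr_ge0// ?(ltW (sech_gt0 _ _))// ltW.
have EB0 : 0 <= E * B by exact: mulr_ge0.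
have EBB : E * B * B <= K * cp * k^-1 * sech d v * k^-1 by exact: ler_pM.
have h0b : 0 <= th <= b by rewrite !ltW//; case/andP: hth.
have [b1 b2 b3 b4] := hol_bound hol v h0b.
rewrite -/E in b1 b2 b3 b4.
have fin : 2 * (E * B) + 2 * (E * (B + 2 * (B * B))) <=
    K * cp * k^-1 * (4 + 4 * k^-1) * sech d v by nra.
have EBB0 : 0 <= E * (B * B) by apply: mulr_ge0 => //; exact: mulr_ge0.
have UV : 2 * (E * B) <= K * cp * k^-1 * (4 + 4 * k^-1) * sech d v.
  by apply: le_trans fin; nra.
have [h3 h4] := pole'_le h1 h2.
split.
- by apply: le_trans UV; apply: norm2.
- by apply: le_trans UV; apply: norm2B.
- apply: le_trans fin; rewrite /D.
  have -> : C' v th * pole_re p v th + C v th * pole_re' p v th -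
      (S' v th * pole_im p v th + S v th * pole_im' p v th) =
    (C' v th * pole_re p v th - S' v th * pole_im p v th) +
    (C v th * pole_re' p v th - S v th * pole_im' p v th) by ring.
  by apply: (le_trans (ler_normD _ _)); apply: lerD; apply: norm2B.
Qed.

Let contU (v th : R) : 0 < th < b -> {for v, continuous (U th)}.
Proof.
move=> hth; have N0 := den0 v hth.
have h1 := is_derive_continuous (hol_dCv hol v th).
have h2 := is_derive_continuous (hol_dSv hol v th).
have h3 := is_derive_continuous (der_pole_re_v N0).
have h4 := is_derive_continuous (der_pole_im_v N0).
by apply: cvgD; apply: cvgM.
Qed.

Let integrable_U (th : R) : 0 < th < b -> leb.-integrable setT (EFin \o U th).
Proof.
move=> hth; have [t0 tb] := andP hth.
have [M _ HM] := bounds (a := th / 2) ltac:(lra).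
apply: (integrable_sech_dominated (M := M) d0) => v; first exact: contU.
by have [] := HM th v ltac:(lra).
Qed.

Let integral_D (th : R) : 0 < th < b -> \int[leb]_v D th v = 0.
Proof.
move=> hth; have [t0 tb] := andP hth.
have [M _ HM] := bounds (a := th / 2) ltac:(lra).
have [S1 S2] := sech_cvg0 d0.
have VM v : `|V th v| <= M * sech d v by have [] := HM th v ltac:(lra).
have iD : leb.-integrable setT (EFin \o D th).
  apply: (integrable_sech_dominated (M := M) d0) => v; first exact: contD.
  by have [] := HM th v ltac:(lra).
rewrite (Rintegral_FTC_real (fun v => @derV v th hth)
  (fun v => @contD v th hth) iD (sech_dominated_cvg0 VM S1) (sech_dominated_cvg0 VM S2)).
exact: subrr.
Qed.

Let derI (th : R) : 0 < th < b ->
  is_derive th 1 (fun th => \int[leb]_v U th v) 0.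
Proof.
move=> hth; have [t0 tb] := andP hth.
have [M M0 HM] := bounds (a := th / 2) ltac:(lra).
have h : is_derive th 1 (fun x => \int[leb]_v U x v) (\int[leb]_v D th v).
  apply: (@is_derive_under_integral R U D setT (th / 2) b th
    (fun v => M * sech d v)) => //.
  - by apply/andP; split => //; lra.
  - by move=> x hx; apply: integrable_U; lra.
  - by move=> x v hx _; apply: derU; lra.
  - exact: leb_integrableZl (integrable_sech d0).
  - by move=> x v hx _; have [] := HM x v hx.
by rewrite integral_D in h.
Qed.

Let I_cst (x y : R) : 0 < x < b -> 0 < y < b ->
  \int[leb]_v U x v = \int[leb]_v U y v.
Proof.
wlog xy : x y / x <= y.
  move=> W hx hy; have [xy|/ltW yx] := leP x y; first exact: W.
  by apply/esym/W.
move=> hx hy.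
have hz z : z \in `[x, y] -> 0 < z < b.
  by rewrite in_itv/= => /andP[xz zy]; lra.
have [||c _ E] := @MVT_segment R (fun th => \int[leb]_v U th v) (fun=> 0) x y xy.
- by move=> z /subset_itv_oo_cc /hz; exact: derI.
- apply: continuous_in_subspaceT => z; rewrite inE => /hz /derI.
  exact: is_derive_continuous.
- by apply/esym/eqP; rewrite -subr_eq0 E mul0r.
Qed.

Let ysech (v : R) : p * expR (- v) / (1 + p * expR (- v)) ^+ 2 <=
  2 * (p + p^-1) * sech d v.
Proof.
have e0 := expR_gt0 v; have e'0 := expR_gt0 (- v).
have ee : expR v * expR (- v) = 1 by rewrite -expRD subrr expR0.
have y0 : 0 < p * expR (- v) by exact: mulr_gt0.
have p'0 : 0 < p^-1 by rewrite invr_gt0.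
have [_ d1] := andP d01.
have h (x : R) : expR (d * x) <= 1 + expR x.
  have [x0|x0] := leP 0 x.
    apply: (@le_trans _ _ (expR x)); last by rewrite lerDr.
    by rewrite ler_expR; nra.
  apply: (@le_trans _ _ 1); last by rewrite lerDl expR_ge0.
  by rewrite expR_le1 mulr_ge0_le0// ltW.
rewrite ler_pdivrMr ?exprn_gt0 ?addr_gt0// mulrAC.
rewrite ler_pdivlMr ?addr_gt0 ?expR_gt0//.
have h1 := h v; have h2 := h (- v); rewrite mulrN in h2.
set A := expR (d * v) in h1 *; set B := expR (- (d * v)) in h2 *.
have hAB : A + B <= 2 * (expR v + expR (- v)).
  have : 0 <= (expR v - expR (- v)) ^+ 2 by exact: sqr_ge0.
  have : 2 <= expR v + expR (- v).
    have : 0 <= (expR v - 1) ^+ 2 * expR (- v) by rewrite mulr_ge0 ?sqr_ge0// ltW.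
    have -> : (expR v - 1) ^+ 2 * expR (- v) =
      expR v * (expR v * expR (- v)) - 2 * (expR v * expR (- v)) + expR (- v) by ring.
    by rewrite ee; lra.
  lra.
apply: (@le_trans _ _ (p * expR (- v) * (2 * (expR v + expR (- v))))).
  by rewrite ler_pM2l.
have -> : p * expR (- v) * (2 * (expR v + expR (- v))) =
    2 * p * (expR v * expR (- v)) + 2 * p^-1 * (p * expR (- v)) ^+ 2.
  by field; rewrite gt_eqF.
rewrite ee; set y := p * expR (- v) in y0 *.
have : 0 <= p * y by rewrite mulr_ge0// ltW.
have : 0 <= p * y ^+ 2 by rewrite mulr_ge0 ?sqr_ge0// ltW.
have : 0 <= p^-1 * y by rewrite mulr_ge0// ltW.
nra.
Qed.

(** An explicit primitive is atan ((p e^{-v} - cos th) / sin th), which goes from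
    pi / 2 at - oo to th - pi / 2 at + oo. *)
Let integral_pole_im (th : R) : 0 < th < b ->
  leb.-integrable setT (EFin \o (pole_im p ^~ th)) /\
  \int[leb]_v pole_im p v th = th - pi.
Proof.
move=> hth; have s0 := sin_pos hth; have sn0 : sin th != 0 by rewrite gt_eqF.
have y0 (v : R) : 0 < p * expR (- v) by rewrite mulr_gt0 ?expR_gt0.
pose k := (1 - cos th) / 2.
have k0 : 0 < k.
  by have := cos2Dsin2 th; have := cos_le1 th; rewrite /k; nra.
have den (v : R) : 0 < pole_den p v th by exact: pole_den_gt0.
have ci : continuous (pole_im p ^~ th).
  by move=> v; apply: is_derive_continuous (der_pole_im_v (den0 v hth)).
have qM v : `|pole_im p v th| <= (k^-1 * (2 * (p + p^-1))) * sech d v.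
  rewrite /pole_im normrN ger0_norm; last first.
    by rewrite ltW// divr_gt0// mulr_gt0.
  apply: (@le_trans _ _ (k^-1 * (p * expR (- v) / (1 + p * expR (- v)) ^+ 2))).
    rewrite mulrCA -[leLHS]mulrA ler_pM2l// -invfM ler_pdivrMr//.
    have kd : 0 < k * (1 + p * expR (- v)) ^+ 2.
      by apply: mulr_gt0 => //; apply: exprn_gt0; apply: addr_gt0.
    rewrite mulrC ler_pdivlMr//.
    have := sin_le1 th; rewrite /pole_den /k.
    have := cos_geN1 th; have := y0 v; set y := p * expR (- v) => {}y0 c1 s1.
    have : 0 <= (1 + cos th) * (1 - y) ^+ 2 by rewrite mulr_ge0 ?sqr_ge0//; lra.
    have : 0 <= (1 - sin th) * ((1 - cos th) / 2 * (1 + y) ^+ 2).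
      by rewrite !mulr_ge0 ?sqr_ge0//; [lra|have := k0; rewrite /k; lra].
    nra.
  by rewrite -[leRHS]mulrA ler_pM2l ?invr_gt0// ysech.
have iq : leb.-integrable setT (EFin \o (pole_im p ^~ th)).
  exact: (integrable_sech_dominated d0 ci qM).
split => //.
pose A (v : R) := atan ((p * expR (- v) - cos th) / sin th).
have dA (v : R) : is_derive v 1 A (pole_im p v th).
  rewrite /A; der; rewrite /pole_im pole_denE2.
  have := den v; rewrite pole_denE2 => dv.
  field; rewrite sn0/= gt_eqF//= addrC gt_eqF//.
have A1 : A (- n.+1%:R) @[n --> \oo] --> pi / 2.
  rewrite /A; apply: (@cvg_comp _ _ _ _ atan _ +oo); last exact: cvgy_atan.
  apply/cvgryPge => a; have [N HN] : exists N : nat, (`|a * sin th| + 1) / p < N%:R.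
    exists (Num.bound ((`|a * sin th| + 1) / p)); apply: archi_boundP.
    by rewrite divr_ge0 ?addr_ge0// ltW.
  exists N => // n /= Nn; rewrite ler_pdivlMr// opprK.
  have h1 : N%:R <= n.+1%:R :> R by rewrite ler_nat leqW.
  have := expR_ge1Dx (n.+1%:R : R); move: HN; rewrite ltr_pdivrMr// => HN h2.
  have := ler_norm (a * sin th); have := cos_le1 th.
  have : p * N%:R <= p * expR n.+1%:R by rewrite ler_pM2l//; lra.
  lra.
have A2 : A n.+1%:R @[n --> \oo] --> th - pi / 2.
  have -> : th - pi / 2 = atan (- (cos th / sin th)).
    have E : - (cos th / sin th) = tan (th - pi / 2).
      by rewrite /tan sinBpihalf cosBpihalf mulNr.
    have [t0 tb] := andP hth; have [_ bp] := andP bpi.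
    rewrite E tanK// in_itv/=; lra.
  have -> : - (cos th / sin th) = (p * 0 - cos th) / sin th.
    by rewrite mulr0 sub0r mulNr.
  rewrite /A; apply: (@cvg_comp _ _ _ _ atan _ (nbhs ((p * 0 - cos th) / sin th))).
    apply: cvgM; last exact: cvg_cst.
    apply: cvgB; last exact: cvg_cst.
    apply: cvgM; first exact: cvg_cst.
    by have := @cvgn_expR R; rewrite -(cvg_shiftn 1); under eq_fun do rewrite addn1.
  exact: continuous_atan.
rewrite (Rintegral_FTC_real dA ci iq A1 A2); lra.
Qed.

Let v0 := ln p.

Let yE (v : R) : p * expR (- v) = expR (- (v - v0)).
Proof. by rewrite opprB addrC expRD /v0 lnK ?posrE// mulrC. Qed.

(** For |v - v0| >= 1 the pole is bounded below uniformly in th, including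
    th = 0: there |1 - y| >= k (1 + y) for y = p e^{-v}, y <= e^{-1} or y >= e. *)
Let far : exists2 M, 0 <= M & forall th v : R, 0 < th < b ->
  1 <= `|v - v0| ->
  `|U th v - C v0 0 * pole_im p v th| <= M * sech d v.
Proof.
pose e1 : R := expR (-1); pose k := (1 - e1) / (1 + e1).
have e10 : 0 < e1 by exact: expR_gt0.
have e11 : e1 < 1 by rewrite expR_lt1 ltrN10.
have k0 : 0 < k by apply: divr_gt0; [rewrite subr_gt0|exact: addr_gt0].
have kE : k * (1 + e1) = 1 - e1 by rewrite /k divfK// gt_eqF// addr_gt0.
have ki : 0 < k^-1 by rewrite invr_gt0.
have cp0 : 0 <= cp by rewrite addr_ge0// invr_ge0 ltW.
pose M1 := 2 * (K * cp * k^-1).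
pose M2 := `|C v0 0| * (k^-1 ^+ 2 * (2 * (p + p^-1))).
have M10 : 0 <= M1 by rewrite !mulr_ge0// ltW.
have M20 : 0 <= M2.
  by rewrite !mulr_ge0// ?exprn_ge0 ?(ltW ki)// addr_ge0// ?invr_ge0 ltW.
exists (M1 + M2) => [|th v hth vv0]; first exact: addr_ge0.
pose y := p * expR (- v); have y0 : 0 < y by rewrite mulr_gt0 ?expR_gt0.
have ky : k * (1 + y) <= `|1 - y|.
  have [vp|vn] := leP 0 (v - v0).
    rewrite ger0_norm// in vv0.
    have ye : y <= e1 by rewrite /y yE ler_expR lerN2.
    apply: le_trans (ler_norm _).
    have : 0 <= (1 + k) * (e1 - y) by rewrite mulr_ge0 ?subr_ge0// addr_ge0// ltW.
    lra.
  rewrite ltr0_norm// in vv0.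
  have ye : e1^-1 <= y.
    by rewrite /y yE /e1 -expRN opprK ler_expR.
  have k1 : k <= 1 by rewrite /k ler_pdivrMr ?addr_gt0//; lra.
  have ye1 : 1 <= y * e1 by rewrite -ler_pdivrMr// mul1r.
  have : 0 <= (1 - k) * (y * e1 - 1) by rewrite mulr_ge0// subr_ge0.
  rewrite distrC => h; apply: le_trans (ler_norm _).
  rewrite -(ler_pM2r e10); nra.
have ky0 : 0 < k * (1 + y) by rewrite mulr_gt0// addr_gt0.
have dge : (k * (1 + y)) ^+ 2 <= pole_den p v th.
  apply: le_trans (pole_den_ge p0 v th); rewrite -/y -[leRHS]real_normK ?num_real//.
  by rewrite ler_sqr ?nnegrE// ltW.
have s0 := sin_pos hth.
have dgt : 0 < pole_den p v th by rewrite pole_den_gt0// gt_eqF.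
have [h1 h2] := pole_le dgt ky0 dge.
pose B := (k * (1 + y))^-1.
pose E := K * sech d v * (1 + expR (- v)).
have E0 : 0 <= E.
  by rewrite !mulr_ge0// ?(ltW (sech_gt0 _ _))// addr_ge0// expR_ge0.
have EB : E * B <= K * cp * k^-1 * sech d v.
  rewrite /E /B invfM.
  have -> : K * sech d v * (1 + expR (- v)) * (k^-1 / (1 + y)) =
    (K * k^-1 * sech d v) * ((1 + expR (- v)) / (1 + y)) by ring.
  have -> : K * cp * k^-1 * sech d v = (K * k^-1 * sech d v) * cp by ring.
  apply: ler_wpM2l; last exact: cpP.
  by rewrite !mulr_ge0// ?(ltW (sech_gt0 _ _))// ltW.
have h0b : 0 <= th <= b by rewrite !ltW//; case/andP: hth.
have [b1 b2 _ _] := hol_bound hol v h0b.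
rewrite mulrDl; apply: (le_trans (ler_normB _ _)); apply: lerD.
  by apply: (@le_trans _ _ (2 * (E * B))); [exact: norm2|rewrite /M1; lra].
rewrite normrM /M2 -mulrA ler_wpM2l// /pole_im normrN ger0_norm; last first.
  by rewrite ltW// divr_gt0// mulr_gt0.
apply: (@le_trans _ _ (k^-1 ^+ 2 * (y / (1 + y) ^+ 2))); last first.
  by rewrite -[leRHS]mulrA ler_wpM2l ?exprn_ge0 ?(ltW ki)// ysech.
rewrite exprVn mulrCA -[leLHS]mulrA ler_pM2l// -invfM -exprMn.
rewrite ler_pdivrMr// mulrC ler_pdivlMr ?exprn_gt0//.
have := sin_le1 th; have : 0 < (k * (1 + y)) ^+ 2 by rewrite exprn_gt0.
nra.
Qed.

(** Near v0, F (v + i th) - F (v0) is at most a constant times |v - v0| + th,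
    while 1 / (1 - p e^{-w}) is at most a constant times 1 / max (|v - v0|, th). *)
Let near_pole : exists2 b', 0 < b' < b & exists M, forall th v : R,
  0 < th < b' -> `|v - v0| <= 1 ->
  `|U th v - C v0 0 * pole_im p v th| <= M.
Proof.
have [b0 bpi'] := andP bpi.
have h2 : 0 < 2^-1 :> R by rewrite invr_gt0.
have cc0 : {for (0 : R), continuous cos} by apply: is_derive_continuous (is_derive_cos 0).
have /cvgrPdist_lt /(_ _ h2) [/= b1 b10 Hb1] := cc0.
exists (Num.min (b1 / 2) (b / 2)).
  by rewrite lt_min gt_min !divr_gt0//=; apply/orP; right; lra.
pose e1 : R := expR (-1); have e10 : 0 < e1 by exact: expR_gt0.
pose M := K * (1 + expR (1 - v0)).
have M0 : 0 <= M by rewrite mulr_ge0// addr_ge0// expR_ge0.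
exists (2 * M + M * e1^-1 + 2 * M) => th v /andP[t0]; rewrite lt_min => /andP[tb1 tb] vv0.
have hth : 0 < th < b by rewrite t0/=; lra.
have sech1 (w : R) : sech d w <= 1.
  rewrite invf_le1 ?addr_gt0 ?expR_gt0//.
  have := expR_ge1Dx (d * w); have := expR_ge1Dx (- (d * w)); lra.
have Mb (w z : R) : `|w - v0| <= 1 -> 0 <= z <= b ->
    [/\ `|C w z| <= M, `|S w z| <= M, `|C' w z| <= M & `|S' w z| <= M].
  move=> wv0 hz; have [c1 c2 c3 c4] := hol_bound hol w hz.
  have h : K * sech d w * (1 + expR (- w)) <= M.
    rewrite /M -mulrA ler_wpM2l//.
    apply: (@le_trans _ _ (1 * (1 + expR (- w)))).
      by rewrite ler_wpM2r// addr_ge0// expR_ge0.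
    rewrite mul1r lerD2l ler_expR; move: wv0; rewrite ler_norml; lra.
  by split; [exact: le_trans c1 h|exact: le_trans c2 h|exact: le_trans c3 h|exact: le_trans c4 h].
have zb z : 0 <= z <= th -> 0 <= z <= b by move=> ?; lra.
have L1 : `|C v th - C v 0| <= M * th.
  rewrite -[th in leRHS]subr0; apply: (@lipschitz_segment _ _ (fun z => - S' v z)).
  - exact: ltW.
  - by move=> z _; exact: hol_dCth hol v z.
  - by move=> z /zb hz; rewrite normrN; case: (Mb v z vv0 hz).
have L2 : `|S v th| <= M * th.
  rewrite -[S v th]subr0 -(hol_real hol v) -[th in leRHS]subr0.
  apply: (@lipschitz_segment _ _ (fun z => C' v z)).
  - exact: ltW.
  - by move=> z _; exact: hol_dSth hol v z.
  - by move=> z /zb hz; case: (Mb v z vv0 hz).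
have b00 : 0 <= (0 : R) <= b by rewrite lexx ltW.
have L3 : `|C v 0 - C v0 0| <= M * `|v - v0|.
  move: vv0; have [vp|vn] := leP v0 v => vv0.
    rewrite (ger0_norm (_ : 0 <= v - v0)) ?subr_ge0// in vv0 *.
    apply: (@lipschitz_segment _ (C ^~ 0) (fun z => C' z 0)) => //.
    - by move=> z _; exact: hol_dCv hol z 0.
    - move=> z hz; have hz' : `|z - v0| <= 1 by rewrite ler_norml; lra.
      by case: (Mb z 0 hz' b00).
  rewrite distrC [`|v - v0|]distrC.
  rewrite (gtr0_norm (_ : 0 < v0 - v)) ?subr_gt0//.
  rewrite distrC (gtr0_norm (_ : 0 < v0 - v)) ?subr_gt0// in vv0.
  apply: (@lipschitz_segment _ (C ^~ 0) (fun z => C' z 0)) => //.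
  - exact: ltW.
  - by move=> z _; exact: hol_dCv hol z 0.
  - move=> z hz; have hz' : `|z - v0| <= 1 by rewrite ler_norml; lra.
    by case: (Mb z 0 hz' b00).
have s0 := sin_pos hth.
have dgt : 0 < pole_den p v th by rewrite pole_den_gt0// gt_eqF.
have sth : th / 2 <= sin th.
  have inz z : z \in `[0, th] -> 0 <= z <= th by rewrite in_itv.
  have [|c /inz cth E] := @MVT_segment R sin cos 0 th (ltW t0).
  - by apply: continuous_subspaceT => z; exact: is_derive_continuous (is_derive_sin z).
  rewrite sin0 !subr0 in E; rewrite E mulrC ler_pM2r//.
  have : `|0 - c| < b1 by rewrite sub0r normrN ger0_norm; lra.
  by move=> /Hb1; rewrite cos0 ltr_norml; lra.
have qth (q : R) : `|q| <= (th / 2)^-1 -> th * `|q| <= 2.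
  by rewrite invfM invrK mulrC => h; rewrite mulrC -ler_pdivlMr.
have [q1 q2] : `|pole_re p v th| <= (th / 2)^-1 /\ `|pole_im p v th| <= (th / 2)^-1.
  apply: (pole_le dgt); first by rewrite divr_gt0.
  rewrite pole_denE2; apply: (@le_trans _ _ (sin th ^+ 2)); last by rewrite lerDr sqr_ge0.
  by rewrite ler_sqr ?nnegrE ?(ltW s0)// divr_ge0// ltW.
have q3 : `|v - v0| * `|pole_im p v th| <= e1^-1.
  have [->|vn] := eqVneq (v - v0) 0; first by rewrite normr0 mul0r invr_ge0 ltW.
  have c0 : 0 < e1 * `|v - v0| by rewrite mulr_gt0// normr_gt0.
  have cN : (e1 * `|v - v0|) ^+ 2 <= pole_den p v th.
    apply: le_trans (pole_den_ge p0 v th); rewrite yE.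
    rewrite -[leRHS]real_normK ?num_real// ler_sqr ?nnegrE// ?(ltW c0)//.
    set h := v - v0 in vv0 *.
    have e2 : e1 <= expR (- h).
      rewrite ler_expR lerN2; apply: le_trans vv0; exact: ler_norm.
    have [hp|hn] := leP 0 h.
      rewrite (ger0_norm hp); apply: le_trans (ler_norm _).
      have := expR_ge1Dx h; have eh : expR h * expR (- h) = 1.
        by rewrite -expRD subrr expR0.
      have := expR_gt0 (- h); nra.
    rewrite (ltr0_norm hn) distrC; apply: le_trans (ler_norm _).
    have := expR_ge1Dx (- h).
    have e11 : e1 <= 1 by rewrite expR_le1 lerN10.
    nra.
  have [_ hq] := pole_le dgt c0 cN.
  rewrite invfM in hq.
  by rewrite mulrC -ler_pdivlMr ?normr_gt0.
have -> : U th v - C v0 0 * pole_im p v th =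
    (C v th - C v 0) * pole_im p v th + (C v 0 - C v0 0) * pole_im p v th
    + S v th * pole_re p v th by rewrite /U; ring.
apply: (le_trans (ler_normD _ _)); apply: lerD; last first.
  rewrite normrM; apply: (@le_trans _ _ (M * (th * `|pole_re p v th|))).
    by rewrite mulrA ler_wpM2r.
  by rewrite [2 * M]mulrC ler_wpM2l// qth.
apply: (le_trans (ler_normD _ _)); apply: lerD.
  rewrite normrM; apply: (@le_trans _ _ (M * (th * `|pole_im p v th|))).
    by rewrite mulrA ler_wpM2r.
  by rewrite [2 * M]mulrC ler_wpM2l// qth.
rewrite normrM; apply: (@le_trans _ _ (M * (`|v - v0| * `|pole_im p v th|))).
  by rewrite mulrA ler_wpM2r.
by rewrite ler_wpM2l.
Qed.

Let pointwise (v : R) : v != v0 ->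
  {for (0 : R), continuous (fun th => U th v - C v0 0 * pole_im p v th)}.
Proof.
move=> vv0; have N0 : pole_den p v 0 != 0.
  rewrite gt_eqF// (lt_le_trans _ (pole_den_ge p0 v 0))// exprn_even_gt0//= subr_eq0.
  rewrite yE -expR0; apply: contra vv0 => /eqP/expR_inj/esym/eqP.
  by rewrite oppr_eq0 subr_eq0.
have h1 := is_derive_continuous (hol_dCth hol v 0).
have h2 := is_derive_continuous (hol_dSth hol v 0).
have h3 := is_derive_continuous (der_pole_re_th N0).
have h4 := is_derive_continuous (der_pole_im_th N0).
apply: cvgB; last by apply: cvgM => //; exact: cvg_cst.
by apply: cvgD; apply: cvgM.
Qed.

(** Cauchy's formula for F at ln p, on the two rays arg s = th and arg s = - th
    (s = e^w), which contribute conjugate values. *)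
Theorem cauchy_ray (th : R) : 0 < th < b ->
  leb.-integrable setT
    (EFin \o (fun v => C v th * pole_im p v th + S v th * pole_re p v th)) /\
  \int[leb]_v (C v th * pole_im p v th + S v th * pole_re p v th) =
  - pi * C (ln p) 0.
Proof.
move=> hth; split; first exact: integrable_U.
have [b' /andP[b'0 b'b] [M HM]] := near_pole.
have [M' M'0 HM'] := far.
pose s1 : R := expR (d * (`|v0| + 1)); have s10 : 0 < s1 by exact: expR_gt0.
(* The angles t_ n decrease to 0 and stay below both b' and b. *)
pose t_ (n : nat) : R := b' / n.+2%:R.
have t_b' n : 0 < t_ n < b'.
  by rewrite divr_gt0//= ltr_pdivrMr// ltr_pMr// ltr1n.
have t_b n : 0 < t_ n < b.
  by have /andP[-> h] := t_b' n; rewrite (lt_trans h).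
have t0 : t_ n @[n --> \oo] --> 0.
  rewrite -(mulr0 b'); apply: cvgM; first exact: cvg_cst.
  by have := @cvg_harmonic R; rewrite -(cvg_shiftS (@harmonic R)).
pose f_ (n : nat) (v : R) := U (t_ n) v - C v0 0 * pole_im p v (t_ n).
pose E : set R := setT `\ v0.
have mE : measurable E by apply: measurableD.
have fbound n v : `|f_ n v| <= (2 * `|M| * s1 + M') * sech d v.
  have [h1|/ltW h1] := leP `|v - v0| 1; last first.
    apply: (le_trans (HM' _ _ (t_b n) h1)); rewrite ler_wpM2r ?(ltW (sech_gt0 _ _))//.
    by rewrite lerDr !mulr_ge0// ltW.
  apply: (le_trans (HM _ _ (t_b' n) h1)); apply: (le_trans (ler_norm _)).
  rewrite mulrDl; apply: (@le_trans _ _ (2 * `|M| * s1 * sech d v)); last first.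
    by rewrite lerDl mulr_ge0// ltW// sech_gt0.
  rewrite ler_pdivlMr ?addr_gt0 ?expR_gt0//.
  have -> : 2 * `|M| * s1 = `|M| * (s1 + s1) by ring.
  rewrite ler_wpM2l// lerD// ler_expR -?mulrN ler_pM2l//.
    have := ler_norm v0; move: h1; rewrite ler_norml; lra.
  have := ler_norm (- v0); rewrite normrN; move: h1; rewrite ler_norml; lra.
have iG := leb_integrableS mE measurableT (@subsetT _ E)
  (leb_integrableZl (2 * `|M| * s1 + M') measurableT (integrable_sech d0)).
have iU n := integrable_U (t_b n).
have iq n := integral_pole_im (t_b n).
have iqz n := leb_integrableZl (C v0 0) measurableT (iq n).1.
have mf n : measurable_fun E (f_ n).
  apply: (@measurable_funS _ _ _ _ setT) => //.
  exact: leb_integrable_measurable (leb_integrableB measurableT (iU n) (iqz n)).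
have fcvg v : E v -> f_ n v @[n --> \oo] --> 0.
  move=> [_ /eqP vv0].
  have E0 : U 0 v - C v0 0 * pole_im p v 0 = 0.
    have Z : pole_im p v 0 = 0 by rewrite /pole_im sin0; ring.
    by rewrite /U (hol_real hol) Z; ring.
  have h : U t v - C v0 0 * pole_im p v t @[t --> (0 : R)] --> (0 : R).
    by rewrite -[X in _ --> X]E0; exact: pointwise.
  exact: (cvg_comp t_ (fun t => U t v - C v0 0 * pole_im p v t) t0 h).
have [_ lim1] := Rintegral_dominated_cvg mE mf iG (fun n v _ => fbound n v) fcvg.
have lim2 : \int[leb]_(v in E) f_ n v @[n --> \oo] -->
    \int[leb]_v U th v - C v0 0 * (0 - pi).
  have Ef n : \int[leb]_(v in E) f_ n v = \int[leb]_v U th v - C v0 0 * (t_ n - pi).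
    transitivity (\int[leb]_v f_ n v).
      rewrite /Rintegral integral_setD1//; apply/measurable_EFinP.
      apply: (@measurable_funS _ _ _ _ setT) => //.
      exact: leb_integrable_measurable (leb_integrableB measurableT (iU n) (iqz n)).
    rewrite (leb_RintegralB measurableT (iU n) (iqz n)).
    by rewrite (leb_RintegralZl _ measurableT (iq n).1) (iq n).2 (I_cst (t_b n) hth).
  under eq_fun do rewrite Ef.
  apply: cvgB; first exact: cvg_cst.
  apply: cvgM; first exact: cvg_cst.
  by apply: cvgB => //; exact: cvg_cst.
have := cvg_unique _ lim1 lim2.
rewrite [X in X = _](_ : _ = 0); last first.
  by rewrite /Rintegral integral0.
rewrite -/(U th) /v0 => /(_ (@norm_hausdorff _ _)) H.
have -> : \int[leb]_v (C v th * pole_im p v th + S v th * pole_re p v th) =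
  \int[leb]_v U th v by [].
have {H}H : 0 = \int[leb]_v U th v - C (ln p) 0 * (0 - pi) by exact: H.
lra.
Qed.

End cauchy_constant.

(** * Inverse Laplace transforms as ray integrals *)

Section ray_transform.
Context {R : realType}.
Local Notation leb := (@lebesgue_measure R).
Local Notation pos := (`]0, +oo[%classic : set R).
Variables (b d K Th : R) (C S C' S' : R -> R -> R).
Hypotheses (bpi : 0 < b < pi) (d01 : 0 < d <= 1) (Thb : 0 < Th < b).
Hypothesis cosTh : cos Th < 0.
Hypothesis hol : holomorphic_pair b d K C S C' S'.

(** The integral of e^{st} F (ln s) / (2 i pi) along the two rays, in the
    coordinate v = ln |s|.  The ray Th lies in the left half-plane, so e^{st}
    decays on it. *)
Definition ray_integrand (t v : R) : R :=
  expR (v + t * expR v * cos Th) *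
  (C v Th * sin (Th + t * expR v * sin Th) + S v Th * cos (Th + t * expR v * sin Th)).

Definition ray_transform (t : R) : R := pi^-1 * \int[leb]_v ray_integrand t v.

Let d0 : 0 < d. Proof. by case/andP: d01. Qed.

Let K0 : 0 <= K.
Proof.
have hb : 0 <= Th <= b by case/andP: Thb => h1 h2; rewrite !ltW.
have [h _ _ _] := hol_bound hol 0 hb; have := le_trans (normr_ge0 _) h.
by rewrite pmulr_lge0 ?addr_gt0 ?expR_gt0// pmulr_lge0 ?sech_gt0.
Qed.

Let bound (v : R) : expR v * (`|C v Th| + `|S v Th|) <= 2 * K * sech d v * (1 + expR v).
Proof.
have hb : 0 <= Th <= b by case/andP: Thb => h1 h2; rewrite !ltW.
have [h1 h2 _ _] := hol_bound hol v hb.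
have e0 := expR_gt0 v; have ee : expR v * expR (- v) = 1 by rewrite -expRD subrr expR0.
have -> : 2 * K * sech d v * (1 + expR v) = expR v * (2 * (K * sech d v * (1 + expR (- v)))).
  transitivity (2 * K * sech d v * (expR v * expR (- v) + expR v)); last by ring.
  by rewrite ee.
by rewrite ler_pM2l//; lra.
Qed.

Let integrand_le (t v : R) : `|ray_integrand t v| <=
  expR (t * expR v * cos Th) * (expR v * (`|C v Th| + `|S v Th|)).
Proof.
rewrite /ray_integrand normrM (ger0_norm (expR_ge0 _)) [v + _]addrC expRD.
rewrite -(mulrA (expR _) (expR v)) !ler_pM2l ?expR_gt0//.
apply: (le_trans (ler_normD _ _)); rewrite !normrM.
have h1 : `|sin (Th + t * expR v * sin Th)| <= 1 by rewrite ler_norml sin_geN1 sin_le1.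
have h2 : `|cos (Th + t * expR v * sin Th)| <= 1 by rewrite ler_norml cos_geN1 cos_le1.
by rewrite lerD// ler_piMr.
Qed.

Lemma ray_integrand_dominated (tau : R) : 0 < tau ->
  exists2 M, 0 <= M & forall t v : R, tau <= t -> `|ray_integrand t v| <= M * sech d v.
Proof.
move=> tau0; have c0 : 0 < - (tau * cos Th) by rewrite oppr_gt0 pmulr_rlt0.
have [M0 M00 H0] := expR_bound (lexx 0) c0 (ltr01 : (0 : R) < 1).
have [M1 M10 H1] := expR_bound (ler01 : (0 : R) <= 1) c0 (ltr01 : (0 : R) < 1).
exists (2 * K * (M0 + M1)); first by rewrite !mulr_ge0// addr_ge0// ltW.
move=> t v taut; apply: (le_trans (integrand_le t v)).
apply: (le_trans (ler_wpM2l (expR_ge0 _) (bound v))).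
have -> : 2 * K * (M0 + M1) * sech d v = 2 * K * sech d v * (M0 + M1) by ring.
rewrite mulrCA ler_wpM2l ?mulr_ge0 ?(ltW (sech_gt0 _ _))// mulrDr mulr1.
have h : t * expR v * cos Th <= - (- (tau * cos Th) * expR (1 * v)).
  rewrite mul1r mulNr opprK mulrAC ler_pM2r ?expR_gt0// ler_wnM2r// ltW//.
rewrite lerD//.
  by apply: (le_trans _ (H0 v)); rewrite ler_expR mul0r add0r.
by apply: (le_trans _ (H1 v)); rewrite -expRD ler_expR addrC lerD// mul1r.
Qed.

Let cC (v : R) : {for v, continuous (C ^~ Th)}.
Proof. exact: is_derive_continuous (hol_dCv hol v Th). Qed.

Let cS (v : R) : {for v, continuous (S ^~ Th)}.
Proof. exact: is_derive_continuous (hol_dSv hol v Th). Qed.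

Let measurable_integrand (t : R) : measurable_fun setT (ray_integrand t).
Proof.
have mC : measurable_fun setT (C ^~ Th) by exact: continuous_measurable_fun.
have mS : measurable_fun setT (S ^~ Th) by exact: continuous_measurable_fun.
have me (a : R) : measurable_fun setT (fun v => t * expR v * a).
  apply: measurable_funM; last exact: measurable_cst.
  apply: measurable_funM; first exact: measurable_cst.
  exact: measurable_expR.
have ms : measurable_fun setT (fun v => Th + t * expR v * sin Th).
  by apply: measurable_funD => //; exact: measurable_cst.
apply: measurable_funM.
  apply: (measurableT_comp (@measurable_expR R)).
  by apply: measurable_funD => //; exact: measurable_id.
apply: measurable_funD; apply: measurable_funM => //.
  exact: (measurableT_comp (continuous_measurable_fun (@continuous_sin R))).
exact: (measurableT_comp (continuous_measurable_fun (@continuous_cos R))).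
Qed.

Lemma integrable_ray_integrand (t : R) : 0 < t -> leb.-integrable setT (EFin \o ray_integrand t).
Proof.
move=> t0; have [M M0 HM] := ray_integrand_dominated t0.
apply: (integrable_bounded_by _ _ (leb_integrableZl M _ (integrable_sech d0))) => //.
by move=> v _; exact: HM.
Qed.

Let laplace_integrand (p v : R) : 0 < p ->
  leb.-integrable pos (EFin \o (fun t => expR (- (p * t)) * ray_integrand t v)) /\
  \int[leb]_(t in pos) (expR (- (p * t)) * ray_integrand t v) =
  - (C v Th * pole_im p v Th + S v Th * pole_re p v Th).
Proof.
move=> p0; have e0 := expR_gt0 v.
have a0 : 0 < p - expR v * cos Th by have : expR v * cos Th < 0 by [rewrite pmulr_rlt0|]; lra.
have [i1 E1] := laplace_sin (expR v * sin Th) Th a0.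
have [i2 E2] := laplace_sin (expR v * sin Th) (Th + pi / 2) a0.
have i1' := leb_integrableZl (C v Th) measurable_pos i1.
have i2' := leb_integrableZl (S v Th) measurable_pos i2.
have Ef (t : R) : pos t -> expR v *
    (C v Th * (expR (- ((p - expR v * cos Th) * t)) * sin (expR v * sin Th * t + Th)) +
     S v Th * (expR (- ((p - expR v * cos Th) * t)) * sin (expR v * sin Th * t + (Th + pi / 2)))) =
    expR (- (p * t)) * ray_integrand t v.
  have E : expR (- (p * t)) * expR (v + t * expR v * cos Th) =
      expR v * expR (- ((p - expR v * cos Th) * t)).
    by rewrite -!expRD; congr expR; ring.
  move=> _; rewrite addrA sinDpihalf /ray_integrand (mulrA (expR (- (p * t)))) E.
  by rewrite (_ : expR v * sin Th * t + Th = Th + t * expR v * sin Th); ring.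
have i3 := leb_integrableZl (expR v) measurable_pos (leb_integrableD measurable_pos i1' i2').
split; first exact: eq_leb_integrable Ef i3.
rewrite -(eq_leb_Rintegral Ef) leb_RintegralZl//; last exact: leb_integrableD.
rewrite leb_RintegralD// !leb_RintegralZl// E1 E2 sinDpihalf cosDpihalf.
have sT : 0 < sin Th by case/andP: Thb; case/andP: bpi => *; apply: sin_gt0_pi; lra.
have N0 : 0 < pole_den p v Th by rewrite pole_den_gt0// gt_eqF.
have ee : expR (- v) = (expR v)^-1 by rewrite expRN.
have ND : (p - expR v * cos Th) ^+ 2 + (expR v * sin Th) ^+ 2 = expR v ^+ 2 * pole_den p v Th.
  by rewrite pole_denE2 ee; field; rewrite gt_eqF.
have n2 : (p - expR v * cos Th) * cos Th + expR v * sin Th * - sin Th = p * cos Th - expR v.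
  transitivity (p * cos Th - expR v * (cos Th ^+ 2 + sin Th ^+ 2)); first by ring.
  by rewrite cos2Dsin2 mulr1.
by rewrite n2 ND /pole_im /pole_re ee; field; rewrite !gt_eqF.
Qed.

(** By Fubini, since the transform in t of e^{st} is 1 / (p - s); the resulting
    integral over v is the one in Cauchy's formula. *)
Theorem laplace_ray_transform (p : R) : 0 < p ->
  laplace_integrable ray_transform p /\ laplace ray_transform p = C (ln p) 0.
Proof.
move=> p0; have p1 : 0 < (pi : R)^-1 by rewrite invr_gt0 pi_gt0.
have c0 : 0 < - cos Th by rewrite oppr_gt0.
pose g (v : R) := 2 * K * (p^-1 + (- cos Th)^-1) * sech d v.
have [|||||i E] := @Rintegral_fubini R pos setT
  (fun t v => expR (- (p * t)) * ray_integrand t v) g measurable_pos measurableT.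
- have mn (h : R -> R) : measurable_fun setT h -> measurable_fun (pos `*` setT) (fun z : R * R => h z.2).
    by move=> mh; exact: measurable_fun_snd.
  have mtc (a : R) : measurable_fun (pos `*` setT) (fun z : R * R => z.1 * expR z.2 * a).
    apply: measurable_funM; last exact: measurable_cst.
    by apply: measurable_funM; [exact: measurable_funTS|apply: mn; exact: measurable_expR].
  have mC : measurable_fun setT (C ^~ Th) by exact: continuous_measurable_fun.
  have mS : measurable_fun setT (S ^~ Th) by exact: continuous_measurable_fun.
  have ms : measurable_fun (pos `*` setT) (fun z : R * R => Th + z.1 * expR z.2 * sin Th).
    by apply: measurable_funD => //; exact: measurable_cst.
  apply: measurable_funM.
    apply: (measurable_fun_fst (f := fun t => expR (- (p * t)))) => //.
    by apply: continuous_pos_measurable => t _; exact: continuous_expRN.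
  apply: measurable_funM.
    apply: (measurableT_comp (@measurable_expR R)).
    by apply: measurable_funD => //; exact: measurable_funTS.
  apply: measurable_funD; apply: measurable_funM.
  + exact: (mn _ mC).
  + exact: (measurableT_comp (continuous_measurable_fun (@continuous_sin R))).
  + exact: (mn _ mS).
  + exact: (measurableT_comp (continuous_measurable_fun (@continuous_cos R))).
- by move=> t /posP t0; exact: leb_integrableZl (integrable_ray_integrand t0).
- by move=> v _; case: (laplace_integrand v p0).
- exact: leb_integrableZl (integrable_sech d0).
- move=> v _; have e0 := expR_gt0 v.
  have a0 : 0 < p - expR v * cos Th by have : expR v * cos Th < 0 by [rewrite pmulr_rlt0|]; lra.
  have [i E] := laplace_cst (expR v * (`|C v Th| + `|S v Th|)) a0.
  apply: (@le_trans _ _ (expR v * (`|C v Th| + `|S v Th|) / (p - expR v * cos Th))).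
    rewrite -E; apply: leb_le_Rintegral => //.
    + by apply: leb_integrable_norm; case: (laplace_integrand v p0).
    + move=> t _.
      rewrite normrM (ger0_norm (expR_ge0 _)).
      apply: (le_trans (ler_wpM2l (expR_ge0 _) (integrand_le t v))).
      have -> : expR (- ((p - expR v * cos Th) * t)) =
          expR (- (p * t)) * expR (t * expR v * cos Th) by rewrite -expRD; congr expR; ring.
      by rewrite (mulrA (expR (- (p * t)))).
  rewrite ler_pdivrMr//; apply: (le_trans (bound v)).
  rewrite /g.
  have -> : 2 * K * (p^-1 + (- cos Th)^-1) * sech d v * (p - expR v * cos Th) =
    2 * K * sech d v * (1 + expR v + p / - cos Th + p^-1 * (expR v * - cos Th)).
    by field; rewrite ?oppr_eq0 (lt_eqF cosTh) (gt_eqF p0).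
  rewrite ler_wpM2l ?mulr_ge0 ?(ltW (sech_gt0 _ _))//.
  have h1 : 0 <= p / - cos Th by rewrite divr_ge0// ltW.
  have h2 : 0 <= p^-1 * (expR v * - cos Th) by rewrite !mulr_ge0 ?invr_ge0// ltW.
  lra.
have Et (t : R) : pos t -> pi^-1 * (\int[leb]_v (expR (- (p * t)) * ray_integrand t v)) =
    expR (- (p * t)) * ray_transform t.
  move=> /posP t0; rewrite /ray_transform.
  by rewrite (leb_RintegralZl (expR (- (p * t))) measurableT (integrable_ray_integrand t0)) mulrCA.
split; first exact: eq_leb_integrable Et (leb_integrableZl _ measurable_pos i).
rewrite /laplace -(eq_leb_Rintegral Et) (leb_RintegralZl pi^-1 measurable_pos i) E.
have [iU EU] := cauchy_ray bpi d01 p0 hol Thb.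
rewrite (eq_leb_Rintegral (g := fun v => - 1 *
    (C v Th * pole_im p v Th + S v Th * pole_re p v Th))); last first.
  by move=> v _; rewrite (laplace_integrand v p0).2 mulN1r.
rewrite (leb_RintegralZl (- 1) measurableT iU) EU mulN1r mulNr opprK mulrA.
by rewrite (mulVf (lt0r_neq0 (pi_gt0 R))) mul1r.
Qed.

End ray_transform.

(** * The functions with transform s^{g-1} e^{-x s^nu} *)

Lemma sin_lipschitz {R : realType} (x y : R) : `|sin y - sin x| <= `|y - x|.
Proof.
wlog xy : x y / x <= y.
  move=> H; have [/H//|/ltW/H] := leP x y.
  by rewrite distrC [`|y - x|]distrC.
rewrite (ger0_norm (_ : 0 <= y - x)) ?subr_ge0// -[y - x]mul1r.
apply: (@lipschitz_segment R (fun z => sin z) (fun z => cos z) 1 x y xy) => z _.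
by rewrite ler_norml cos_geN1 cos_le1.
Qed.

(** |e^{-a} e^{i (phi + be)} - e^{i phi}| <= a + |be|, imaginary parts. *)
Lemma exp_sin_sub_le {R : realType} (a be phi : R) : 0 <= a ->
  `|expR (- a) * sin (phi + be) - sin phi| <= a + `|be|.
Proof.
move=> a0; have -> : expR (- a) * sin (phi + be) - sin phi =
  (expR (- a) - 1) * sin (phi + be) + (sin (phi + be) - sin phi) by ring.
apply: (le_trans (ler_normD _ _)); apply: lerD.
  rewrite normrM; apply: (@le_trans _ _ (`|expR (- a) - 1| * 1)).
    by rewrite ler_wpM2l// ler_norml sin_geN1 sin_le1.
  have h1 : expR (- a) <= 1 by rewrite -expR0 ler_expR oppr_le0.
  by rewrite mulr1 distrC ger0_norm ?subr_ge0//; have := expR_ge1Dx (- a); lra.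
by have := sin_lipschitz phi (phi + be); rewrite [phi + be - phi]addrAC subrr add0r.
Qed.

Lemma exp_sin_sub_le2 {R : realType} (a be phi : R) : 0 <= a ->
  `|expR (- a) * sin (phi + be) - sin phi| <= 2.
Proof.
move=> a0; apply: (le_trans (ler_normB _ _)); rewrite normrM (ger0_norm (expR_ge0 _)).
have h (c : R) : `|sin c| <= 1 by rewrite ler_norml sin_geN1 sin_le1.
have h1 : expR (- a) <= 1 by rewrite -expR0 ler_expR oppr_le0.
by rewrite -[2]/(1 + 1) lerD// mulr_ile1// expR_ge0.
Qed.

(** One integration of a Taylor remainder bound. *)
Lemma taylor_step {R : realType} (h dh : R -> R) (c : R) (n : nat) (x : R) : 0 <= x ->
  h 0 = 0 -> (forall y : R, is_derive y 1 h (dh y)) ->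
  (forall y, 0 <= y <= x -> `|dh y| <= c * (y ^+ n / n`!%:R)) ->
  `|h x| <= c * (x ^+ n.+1 / n.+1`!%:R).
Proof.
move=> x0 h0 hd hb.
have f0 : n`!%:R != 0 :> R by rewrite pnatr_eq0 -lt0n fact_gt0.
have n1 : 1 + n%:R != 0 :> R by rewrite addrC natr1 pnatr_eq0.
have dp (y : R) : is_derive y 1 (fun y => c * (y ^+ n.+1 / n.+1`!%:R)) (c * (y ^+ n / n`!%:R)).
  by der; rewrite factS natrM -natr1; field; rewrite f0 addrC n1.
have p0 : c * (0 ^+ n.+1 / n.+1`!%:R) = 0 by rewrite expr0n/= !(mul0r, mulr0).
have bd y : 0 <= y <= x -> - (c * (y ^+ n / n`!%:R)) <= dh y <= c * (y ^+ n / n`!%:R).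
  by rewrite -ler_norml; exact: hb.
have H1 : h 0 + c * (0 ^+ n.+1 / n.+1`!%:R) <= h x + c * (x ^+ n.+1 / n.+1`!%:R).
  apply: (derive_ge0_le (df := fun y => dh y + c * (y ^+ n / n`!%:R)) x0) => y hy.
  by have /andP[] := bd y hy; lra.
have H2 : c * (0 ^+ n.+1 / n.+1`!%:R) - h 0 <= c * (x ^+ n.+1 / n.+1`!%:R) - h x.
  apply: (derive_ge0_le (df := fun y => c * (y ^+ n / n`!%:R) - dh y) x0) => y hy.
  by have /andP[] := bd y hy; lra.
by rewrite p0 h0 in H1 H2; rewrite ler_norml; apply/andP; split; lra.
Qed.

Lemma exp_coeff_le {R : realType} (z : R) (n : nat) : 0 <= z -> z ^+ n / n`!%:R <= expR z.
Proof.
move=> z0; case: n => [|n]; first by rewrite expr0 fact0 divr1; have := expR_ge1Dx z; lra.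
by have := expR_ge1Dxn n z0; lra.
Qed.

(** In what follows the two rays are arg s = Th and arg s = - Th with
    pi / 2 < Th < b < pi.  As nu <= 1 / 2, nu b < pi / 2, so that e^{-x s^nu} does
    not grow on them. *)
Section stable.
Context {R : realType}.
Local Notation leb := (@lebesgue_measure R).
Local Notation pos := (`]0, +oo[%classic : set R).
Variables (nu Th b : R).
Hypotheses (nu0 : 0 < nu) (nu2 : nu <= 2^-1) (Th0 : pi / 2 < Th) (Thb : Th < b) (bpi : b < pi).

Let pi0 : 0 < pi :> R := pi_gt0 R.
Let Tpos : 0 < Th. Proof. by apply: lt_trans Th0; rewrite divr_gt0. Qed.
Let b0 : 0 < b. Proof. exact: lt_trans Tpos Thb. Qed.

Let cosTh : cos Th < 0.
Proof.
have h2 : 0 <= pi / 2 :> R by rewrite divr_ge0// ltW.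
have h3 := lt_trans Thb bpi.
rewrite -(cos_pihalf R) ltr_cos// in_itv/=.
  by rewrite h2 (le_trans (ltW Th0) (ltW h3)).
by rewrite (ltW Tpos) (ltW h3).
Qed.

Let c_ := cos (nu * b).

Let nub : nu * b < pi / 2.
Proof.
apply: (@le_lt_trans _ _ (2^-1 * b)); first by rewrite ler_pM2r.
by rewrite mulrC ltr_pM2r.
Qed.

Let c0 : 0 < c_.
Proof.
apply: cos_gt0_pihalf; rewrite nub andbT.
by apply: (@lt_trans _ _ 0); rewrite ?oppr_lt0 ?divr_gt0// mulr_gt0.
Qed.

Let cos_ge (th : R) : 0 <= th <= b -> c_ <= cos (nu * th).
Proof.
move=> /andP[t0 tb].
have h : nu * th <= nu * b by rewrite ler_pM2l.
have hpi : nu * b <= pi by rewrite (le_trans (ltW nub))// ler_pdivrMr// ler_peMr// ?ler1n// ltW.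
rewrite leNgt ltr_cos// ?in_itv/= ?hpi ?(le_trans h)// -?leNgt ?mulr_ge0 ?(ltW nu0)// ltW//.
Qed.

Lemma cos_nuTh_gt0 : 0 < cos (nu * Th).
Proof. by apply: (lt_le_trans c0); apply: cos_ge; rewrite !ltW. Qed.

(** symbol_re and symbol_im are the real and imaginary parts of
    s^{-be} e^{-x s^nu} at s = e^{v + i th}, and the primed functions those of its
    derivative in v. *)
Definition symbol_abs (be x v th : R) := expR (- be * v - x * expR (nu * v) * cos (nu * th)).
Definition symbol_arg (be x v th : R) := be * th + x * expR (nu * v) * sin (nu * th).
Definition symbol_re be x v th := symbol_abs be x v th * cos (symbol_arg be x v th).
Definition symbol_im be x v th := - (symbol_abs be x v th * sin (symbol_arg be x v th)).
Definition symbol_re' be x v th := - be * symbol_re be x v th - x * nu * symbol_re (be - nu) x v th.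
Definition symbol_im' be x v th := - be * symbol_im be x v th - x * nu * symbol_im (be - nu) x v th.

Let symbol_absB be x v th : symbol_abs (be - nu) x v th = expR (nu * v) * symbol_abs be x v th.
Proof. by rewrite /symbol_abs -expRD; congr expR; ring. Qed.

Let symbol_argB be x v th : symbol_arg (be - nu) x v th = symbol_arg be x v th - nu * th.
Proof. by rewrite /symbol_arg; ring. Qed.

Let symbol_reB be x v th : symbol_re (be - nu) x v th =
  expR (nu * v) * (cos (nu * th) * symbol_re be x v th - sin (nu * th) * symbol_im be x v th).
Proof. by rewrite /symbol_re /symbol_im symbol_absB symbol_argB cosB; ring. Qed.

Let symbol_imB be x v th : symbol_im (be - nu) x v th =
  expR (nu * v) * (cos (nu * th) * symbol_im be x v th + sin (nu * th) * symbol_re be x v th).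
Proof. by rewrite /symbol_re /symbol_im symbol_absB symbol_argB sinB; ring. Qed.

Lemma der_symbol (be x v th : R) :
  [/\ is_derive v 1 (symbol_re be x ^~ th) (symbol_re' be x v th),
      is_derive v 1 (symbol_im be x ^~ th) (symbol_im' be x v th),
      is_derive th 1 (symbol_re be x v) (- symbol_im' be x v th) &
      is_derive th 1 (symbol_im be x v) (symbol_re' be x v th)].
Proof.
split; rewrite /symbol_re' /symbol_im' ?symbol_reB ?symbol_imB /symbol_re /symbol_im /symbol_abs /symbol_arg; der; ring.
Qed.

Let norm_cos_le (a : R) : `|cos a| <= 1. Proof. by rewrite ler_norml cos_geN1 cos_le1. Qed.
Let norm_sin_le (a : R) : `|sin a| <= 1. Proof. by rewrite ler_norml sin_geN1 sin_le1. Qed.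

Lemma symbol_le (be x v th : R) : `|symbol_re be x v th| <= symbol_abs be x v th /\
  `|symbol_im be x v th| <= symbol_abs be x v th.
Proof.
have e0 := expR_ge0 (- be * v - x * expR (nu * v) * cos (nu * th)).
by rewrite /symbol_im normrN !normrM (ger0_norm e0); split; apply: ler_piMr.
Qed.

Let continuous_symbol' (be x v th : R) : {for v, continuous (symbol_re' be x ^~ th)} /\
  {for v, continuous (symbol_im' be x ^~ th)}.
Proof.
have [/is_derive_continuous h1 /is_derive_continuous h1' _ _] := der_symbol be x v th.
have [/is_derive_continuous h2 /is_derive_continuous h2' _ _] := der_symbol (be - nu) x v th.
by split; apply: cvgB; apply: cvgM => //; exact: cvg_cst.
Qed.

Let symbol_im0 (be x v : R) : symbol_im be x v 0 = 0.
Proof. by rewrite /symbol_im /symbol_arg !mulr0 sin0 mulr0 addr0 sin0 mulr0 oppr0. Qed.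

Let hol_symbol (be x d K : R) : (forall v th : R, 0 <= th <= b ->
    symbol_abs be x v th <= K * sech d v * (1 + expR (- v)) /\
    `|be| * symbol_abs be x v th + `|x| * nu * symbol_abs (be - nu) x v th
       <= K * sech d v * (1 + expR (- v))) ->
  holomorphic_pair b d K (symbol_re be x) (symbol_im be x) (symbol_re' be x) (symbol_im' be x).
Proof.
move=> H; have dd be' v th := der_symbol be' x v th.
split; try by move=> v th; case: (dd be v th).
- by move=> v th; case: (continuous_symbol' be x v th).
- by move=> v th; case: (continuous_symbol' be x v th).
- move=> v th hth; have [h1 h2] := H v th hth.
  have [a1 a2] := symbol_le be x v th; have [a3 a4] := symbol_le (be - nu) x v th.
  have xn : 0 <= `|x| * nu by rewrite mulr_ge0// ltW.
  split; rewrite ?(le_trans a1 h1) ?(le_trans a2 h1)//; apply: le_trans h2.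
    apply: (le_trans (ler_normB _ _)).
    rewrite (normrM (- be)) (normrM (x * nu)) (normrM x) normrN (gtr0_norm nu0).
    by rewrite lerD ?ler_wpM2l.
  apply: (le_trans (ler_normB _ _)).
    rewrite (normrM (- be)) (normrM (x * nu)) (normrM x) normrN (gtr0_norm nu0).
  by rewrite lerD ?ler_wpM2l.
- by move=> v; rewrite symbol_im0.
Qed.

Let absle (K d be x v th : R) : 0 <= th <= b -> 0 < x -> 0 < K ->
  expR ((1 - be) * v - x * c_ * expR (nu * v)) <= K * sech d v ->
  symbol_abs be x v th <= K * sech d v * (1 + expR (- v)).
Proof.
move=> hth x0 Kp h; apply: (@le_trans _ _ (K * sech d v * expR (- v))); last first.
  by rewrite ler_wpM2l ?mulr_ge0 ?(ltW Kp) ?(ltW (sech_gt0 _ _))// lerDr.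
apply: le_trans (ler_wpM2r (expR_ge0 _) h); rewrite -expRD ler_expR.
have e0 := expR_gt0 (nu * v).
have : x * expR (nu * v) * c_ <= x * expR (nu * v) * cos (nu * th).
  by rewrite ler_pM2l ?mulr_gt0//; exact: cos_ge.
lra.
Qed.

(** For x > 0 the factor e^{-x s^nu} gives the decay at + oo. *)
Lemma holomorphic_symbol (be x : R) : be < 1 -> 0 < x -> exists d K, 0 < d <= 1 /\
  holomorphic_pair b d K (symbol_re be x) (symbol_im be x) (symbol_re' be x) (symbol_im' be x).
Proof.
move=> be1 x0; have a0 : 0 < 1 - be by rewrite subr_gt0.
pose d := Num.min 1 (1 - be).
have d0 : 0 < d by rewrite lt_min ltr01 a0.
have d1 : d <= 1 - be by rewrite ge_min lexx orbT.
have hd : 0 < d <= 1 - be by rewrite d0 d1.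
have hd' : 0 < d <= 1 - be + nu by rewrite d0 (le_trans d1)// lerDl ltW.
have xc0 : 0 < x * c_ by rewrite mulr_gt0.
have [K0 K00 H0] := expR_decay hd xc0 nu0.
have [K1 K10 H1] := expR_decay hd' xc0 nu0.
exists d, (K0 + `|be| * K0 + x * nu * K1); split.
  by rewrite d0 ge_min lexx.
apply: hol_symbol => v th hth.
have h0 := absle hth x0 K00 (H0 v).
have h1 : symbol_abs (be - nu) x v th <= K1 * sech d v * (1 + expR (- v)).
  apply: (absle hth x0 K10); rewrite (_ : 1 - (be - nu) = 1 - be + nu); last by ring.
  exact: H1.
set q := sech d v * (1 + expR (- v)).
have q0 : 0 < q by rewrite mulr_gt0 ?sech_gt0 ?addr_gt0 ?expR_gt0.
rewrite -!mulrA -/q in h0 h1 *; rewrite !mulrDl (gtr0_norm x0).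
clearbody q; rewrite !mulrA.
have t1 := mulr_ge0 (ltW K00) (ltW q0).
have t2 : `|be| * symbol_abs be x v th <= `|be| * K0 * q by rewrite -mulrA ler_wpM2l.
have t3 : x * nu * symbol_abs (be - nu) x v th <= x * nu * K1 * q.
  by rewrite -[leRHS]mulrA ler_wpM2l// mulr_ge0// ltW.
have t4 := mulr_ge0 (mulr_ge0 (mulr_ge0 (ltW x0) (ltW nu0)) (ltW K10)) (ltW q0).
have t5 := mulr_ge0 (mulr_ge0 (normr_ge0 be) (ltW K00)) (ltW q0).
split; lra.
Qed.

(** At x = 0 the factor e^{-x s^nu} is gone, and |s|^{-be} is small against
    1 + e^{-v} at both ends for 0 < be < 1 only. *)
Lemma holomorphic_symbol_pow (be : R) : 0 < be < 1 -> exists d K, 0 < d <= 1 /\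
  holomorphic_pair b d K (symbol_re be 0) (symbol_im be 0) (symbol_re' be 0) (symbol_im' be 0).
Proof.
move=> /andP[be0 be1]; pose d := Num.min be (1 - be).
have d0 : 0 < d by rewrite lt_min be0 subr_gt0.
have d1 : d <= be by rewrite ge_min lexx.
have d2 : d <= 1 - be by rewrite ge_min lexx orbT.
exists d, 2; split; first by rewrite d0 (le_trans d1)// ltW.
apply: hol_symbol => v th hth; rewrite normr0 !mul0r addr0 (gtr0_norm be0).
set q := 2 * _ * _.
suff h : symbol_abs be 0 v th <= q.
  by split => //; apply: le_trans h; rewrite ler_piMl ?expR_ge0// ltW.
rewrite /q /sech mulrAC ler_pdivlMr ?addr_gt0 ?expR_gt0// /symbol_abs !mul0r subr0 mulrDr -!expRD.
have h (a : R) : -1 <= a <= 0 -> expR (a * v) <= 1 + expR (- v).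
  move=> /andP[h1 h2]; have [v0|v0] := leP 0 v.
    apply: (@le_trans _ _ 1); last by rewrite lerDl expR_ge0.
    by rewrite -expR0 ler_expR mulr_le0_ge0.
  apply: (@le_trans _ _ (expR (- v))); last by rewrite lerDr.
  by rewrite ler_expR; nra.
have -> : - be * v + d * v = (d - be) * v by ring.
have -> : - be * v + - (d * v) = (- d - be) * v by ring.
have h1 := h (d - be) ltac:(lra); have h2 := h (- d - be) ltac:(lra); lra.
Qed.

(** For be = 1 neither term is admissible at - oo, but their difference is
    smaller by a factor e^{nu v}. *)
Lemma holomorphic_symbol_sub (x : R) : 0 < x -> exists d K, 0 < d <= 1 /\
  holomorphic_pair b d K
   (fun v th => symbol_re 1 x v th - symbol_re 1 0 v th) (fun v th => symbol_im 1 x v th - symbol_im 1 0 v th)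
   (fun v th => symbol_re' 1 x v th - symbol_re' 1 0 v th) (fun v th => symbol_im' 1 x v th - symbol_im' 1 0 v th).
Proof.
move=> x0; have hd : 0 < nu <= nu by rewrite nu0 lexx.
have xc0 : 0 < x * c_ by rewrite mulr_gt0.
have [K1 K10 H1] := expR_decay hd xc0 nu0.
pose K := 4 * (1 + x) + x * nu * K1.
have nu1 : nu <= 1 by rewrite (le_trans nu2)// invf_le1// ler1n.
exists nu, K; split; first by rewrite nu0.
have dd x' v th := der_symbol 1 x' v th.
have hC (v th : R) : 0 <= th <= b ->
    `|symbol_re 1 x v th - symbol_re 1 0 v th| <= 4 * (1 + x) * (sech nu v * (1 + expR (- v))) /\
    `|symbol_im 1 x v th - symbol_im 1 0 v th| <= 4 * (1 + x) * (sech nu v * (1 + expR (- v))).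
  move=> hth.
  pose a := x * expR (nu * v) * cos (nu * th).
  pose be := x * expR (nu * v) * sin (nu * th).
  have y0 : 0 < x * expR (nu * v) by rewrite mulr_gt0// expR_gt0.
  have a0 : 0 <= a by rewrite mulr_ge0 ?(ltW y0)// (le_trans (ltW c0))// cos_ge.
  have ale : a + `|be| <= 2 * (x * expR (nu * v)).
    rewrite mulr2n mulrDl mul1r lerD//.
      by rewrite ler_piMr ?(ltW y0)// cos_le1.
    by rewrite normrM (gtr0_norm y0) ler_piMr ?(ltW y0).
  have E1 : symbol_re 1 x v th - symbol_re 1 0 v th =
     expR (- v) * (expR (- a) * sin ((th + pi / 2) + be) - sin (th + pi / 2)).
    rewrite /symbol_re /symbol_abs /symbol_arg !mul0r subr0 addr0 !mul1r mulN1r expRD.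
    by rewrite addrAC !sinDpihalf -/a -/be; ring.
  have E2 : symbol_im 1 x v th - symbol_im 1 0 v th =
     expR (- v) * - (expR (- a) * sin (th + be) - sin th).
    rewrite /symbol_im /symbol_abs /symbol_arg !mul0r subr0 addr0 !mul1r mulN1r expRD.
    by rewrite -/a -/be; ring.
  have main (m : R) : `|m| <= a + `|be| -> `|m| <= 2 ->
    `|expR (- v) * m| <= 4 * (1 + x) * (sech nu v * (1 + expR (- v))).
    move=> m1 m2; rewrite normrM (gtr0_norm (expR_gt0 _)).
    rewrite /sech mulrA mulrAC ler_pdivlMr ?addr_gt0 ?expR_gt0//.
    have e1 : 0 < 1 + expR (- v) by rewrite addr_gt0 ?expR_gt0.
    have [v0|v0] := leP 0 v.
      apply: (@le_trans _ _ (2 * (1 + 1))); last first.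
        have : 0 <= x * (1 + expR (- v)) by rewrite mulr_ge0// ltW.
        by have := expR_gt0 (- v); lra.
      rewrite mulrAC mulrC; apply: ler_pM => //.
      rewrite mulrDr -!expRD; apply: lerD; rewrite -expR0 ler_expR.
        by have : nu * v <= 1 * v by [rewrite ler_wpM2r|]; lra.
      by have : 0 <= nu * v by [rewrite mulr_ge0// ltW|]; lra.
    have eq1 : expR (nu * v) <= 1 by rewrite -expR0 ler_expR nmulr_lle0// ltW.
    have ee : expR (nu * v) * expR (- (nu * v)) = 1 by rewrite -expRD subrr expR0.
    apply: (@le_trans _ _ (expR (- v) * (2 * (x * expR (nu * v))) * (expR (nu * v) + expR (- (nu * v))))).
      rewrite ler_pM2r ?addr_gt0 ?expR_gt0// ler_pM2l ?expR_gt0//; exact: (le_trans m1).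
    have -> : expR (- v) * (2 * (x * expR (nu * v))) * (expR (nu * v) + expR (- (nu * v))) =
      expR (- v) * (2 * x) * (expR (nu * v) ^+ 2 + expR (nu * v) * expR (- (nu * v))) by ring.
    rewrite ee; apply: (@le_trans _ _ (expR (- v) * (2 * x) * (1 + 1))).
      by rewrite ler_pM2l ?mulr_gt0 ?expR_gt0// lerD// expr_le1// expR_ge0.
    have : 0 < x * expR (- v) by rewrite mulr_gt0 ?expR_gt0.
    by have := expR_gt0 (- v); lra.
  by rewrite E1 E2; split; apply: main; rewrite ?normrN ?exp_sin_sub_le ?exp_sin_sub_le2.
have xn : 0 < x * nu by rewrite mulr_gt0.
have hD (v th : R) : 0 <= th <= b ->
    symbol_abs (1 - nu) x v th <= K1 * (sech nu v * (1 + expR (- v))).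
  move=> hth; rewrite mulrA; apply: (absle hth x0 K10).
  by rewrite (_ : 1 - (1 - nu) = nu) ?H1//; ring.
split.
- by move=> v th; have [h1 _ _ _] := dd x v th; have [h2 _ _ _] := dd 0 v th; der.
- by move=> v th; have [_ h1 _ _] := dd x v th; have [_ h2 _ _] := dd 0 v th; der.
- by move=> v th; have [_ _ h1 _] := dd x v th; have [_ _ h2 _] := dd 0 v th; der; ring.
- by move=> v th; have [_ _ _ h1] := dd x v th; have [_ _ _ h2] := dd 0 v th; der.
- move=> v th; have [h1 _] := continuous_symbol' 1 x v th; have [h2 _] := continuous_symbol' 1 0 v th.
  exact: cvgB.
- move=> v th; have [_ h1] := continuous_symbol' 1 x v th; have [_ h2] := continuous_symbol' 1 0 v th.
  exact: cvgB.
- move=> v th hth; have [h1 h2] := hC v th hth; have h3 := hD v th hth.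
  have [a1 a2] := symbol_le (1 - nu) x v th.
  set q := sech nu v * (1 + expR (- v)) in h1 h2 h3.
  have q0 : 0 < q by rewrite mulr_gt0 ?sech_gt0 ?addr_gt0 ?expR_gt0.
  rewrite -!(mulrA K) -/q.
  have k1 : x * nu * symbol_abs (1 - nu) x v th <= x * nu * K1 * q by rewrite -[leRHS]mulrA ler_pM2l.
  have k2 := mulr_ge0 (mulr_ge0 (ltW xn) (ltW K10)) (ltW q0).
  have KE : K * q = 4 * (1 + x) * q + x * nu * K1 * q := mulrDl _ _ _.
  have l1 : 4 * (1 + x) * q <= K * q by rewrite KE lerDl.
  split; [exact: le_trans h1 l1|exact: le_trans h2 l1| |].
    rewrite /symbol_re' !mul0r subr0.
    have -> : - (1) * symbol_re 1 x v th - x * nu * symbol_re (1 - nu) x v th - - (1) * symbol_re 1 0 v th =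
      - (symbol_re 1 x v th - symbol_re 1 0 v th) - x * nu * symbol_re (1 - nu) x v th by ring.
    apply: (le_trans (ler_normB _ _)); rewrite normrN KE; apply: lerD => //.
    by apply: le_trans k1; rewrite normrM (gtr0_norm xn) ler_pM2l.
  rewrite /symbol_im' !mul0r subr0.
  have -> : - (1) * symbol_im 1 x v th - x * nu * symbol_im (1 - nu) x v th - - (1) * symbol_im 1 0 v th =
    - (symbol_im 1 x v th - symbol_im 1 0 v th) - x * nu * symbol_im (1 - nu) x v th by ring.
  apply: (le_trans (ler_normB _ _)); rewrite normrN KE; apply: lerD => //.
  by apply: le_trans k1; rewrite normrM (gtr0_norm xn) ler_pM2l.
- by move=> v; rewrite !symbol_im0 subrr.
Qed.

(** stab g t x is the inverse transform of s^{g-1} e^{-x s^nu}, as an integral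
    over the rays (for g = 1 and x fixed, a one-sided stable density).  For g = 0
    the integral diverges at v -> - oo, and only the difference stab_diff with its
    value at x = 0 makes sense. *)
Definition stab_integrand (g t x v : R) : R :=
  expR (g * v + t * expR v * cos Th - x * expR (nu * v) * cos (nu * Th)) *
  sin (g * Th + t * expR v * sin Th - x * expR (nu * v) * sin (nu * Th)).

Definition stab (g t x : R) : R := pi^-1 * \int[leb]_v stab_integrand g t x v.

Definition stab_diff (g t x : R) : R :=
  pi^-1 * \int[leb]_v (stab_integrand g t x v - stab_integrand g t 0 v).

(** Modulus of the complex integrand at x = 0, an upper bound for every x >= 0. *)
Definition stab_major (g t v : R) : R := expR (g * v + t * expR v * cos Th).

Lemma stab_majorD (g h t v : R) : stab_major (g + h) t v = expR (h * v) * stab_major g t v.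
Proof. by rewrite /stab_major -expRD; congr expR; ring. Qed.

Lemma stab_major_homo (g t t' v : R) : t <= t' -> stab_major g t' v <= stab_major g t v.
Proof.
move=> tt; rewrite /stab_major ler_expR lerD2l ler_wnM2r ?(ltW cosTh)// ler_wpM2r// expR_ge0.
Qed.

Lemma continuous_stab_major (g t : R) : continuous (stab_major g t).
Proof. by move=> v; apply: is_derive_continuous; rewrite /stab_major; der; reflexivity. Qed.

Lemma stab_major_decay (g t : R) : 0 < g -> 0 < t ->
  exists2 K, 0 < K & forall v, stab_major g t v <= K * sech g v.
Proof.
move=> g0 t0; have hg : 0 < g <= g by rewrite g0 lexx.
have c : 0 < - (t * cos Th) by rewrite oppr_gt0 pmulr_rlt0.
have [K K0 HK] := expR_decay hg c ltr01; exists K => // v.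
apply: le_trans (HK v); rewrite /stab_major ler_expR mul1r.
by rewrite le_eqVlt; apply/orP; left; apply/eqP; ring.
Qed.

Lemma integrable_stab_major (g t : R) : 0 < g -> 0 < t ->
  leb.-integrable setT (EFin \o stab_major g t).
Proof.
move=> g0 t0; have [K K0 HK] := stab_major_decay g0 t0.
apply: (integrable_sech_dominated (M := K) g0); first exact: continuous_stab_major.
by move=> v; rewrite gtr0_norm ?expR_gt0.
Qed.

(** d/dx multiplies by - s^nu and d/dt by s: both act on the family by a shift
    of g. *)
Lemma der_stab_integrand (g t x v : R) :
  [/\ is_derive x 1 (fun y => stab_integrand g t y v) (- stab_integrand (g + nu) t x v),
      is_derive t 1 (fun s => stab_integrand g s x v) (stab_integrand (g + 1) t x v) &
      is_derive v 1 (stab_integrand g t x) (g * stab_integrand g t x v +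
        t * stab_integrand (g + 1) t x v - x * nu * stab_integrand (g + nu) t x v)].
Proof.
have E h c : stab_integrand (g + h) t x v = expR (h * v) *
  expR (g * v + t * expR v * cos Th - x * expR (nu * v) * cos (nu * Th)) *
  (sin (g * Th + t * expR v * sin Th - x * expR (nu * v) * sin (nu * Th)) * cos (h * Th) +
   cos (g * Th + t * expR v * sin Th - x * expR (nu * v) * sin (nu * Th)) * sin (h * Th)) + 0 * c.
  rewrite /stab_integrand -expRD -sinD; have -> : (g + h) * Th + t * expR v * sin Th -
    x * expR (nu * v) * sin (nu * Th) = g * Th + t * expR v * sin Th -
    x * expR (nu * v) * sin (nu * Th) + h * Th by ring.
  by rewrite mul0r addr0; congr (expR _ * _); ring.
rewrite !(E _ 0) !mul0r !addr0 !mul1r; split; rewrite /stab_integrand; der; ring.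
Qed.

Lemma continuous_stab_integrand (g t x : R) : continuous (stab_integrand g t x).
Proof. by move=> v; have [_ _] := der_stab_integrand g t x v; exact: is_derive_continuous. Qed.

Let nuT0 : 0 < cos (nu * Th) := cos_nuTh_gt0.

Lemma stab_integrand_le (g t x v : R) : 0 <= x -> `|stab_integrand g t x v| <= stab_major g t v.
Proof.
move=> x0; rewrite /stab_integrand normrM (gtr0_norm (expR_gt0 _)).
apply: (@le_trans _ _ (expR (g * v + t * expR v * cos Th - x * expR (nu * v) * cos (nu * Th)))).
  by rewrite ler_piMr ?expR_ge0.
by rewrite ler_expR lerBlDr lerDl !mulr_ge0 ?expR_ge0// ltW.
Qed.

Lemma stab_integrand_sub_le (g t x v : R) : 0 <= x ->
  `|stab_integrand g t x v - stab_integrand g t 0 v| <= 2 * x * stab_major (g + nu) t v.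
Proof.
move=> x0; pose a := x * expR (nu * v) * cos (nu * Th).
pose be := - (x * expR (nu * v) * sin (nu * Th)).
have y0 : 0 <= x * expR (nu * v) by rewrite mulr_ge0 ?expR_ge0.
have a0 : 0 <= a by rewrite mulr_ge0 // ltW.
have ale : a + `|be| <= 2 * (x * expR (nu * v)).
  rewrite mulr2n mulrDl mul1r lerD//; first by rewrite ler_piMr ?cos_le1.
  by rewrite normrN normrM (ger0_norm y0) ler_piMr.
have -> : stab_integrand g t x v - stab_integrand g t 0 v = stab_major g t v *
   (expR (- a) * sin (g * Th + t * expR v * sin Th + be) - sin (g * Th + t * expR v * sin Th)).
  by rewrite /stab_integrand /stab_major !mul0r !subr0 expRD -/a -/be; ring.
rewrite normrM (gtr0_norm (expR_gt0 _)) stab_majorD.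
have -> : 2 * x * (expR (nu * v) * stab_major g t v) = stab_major g t v * (2 * (x * expR (nu * v))) by ring.
by rewrite ler_pM2l ?expR_gt0// (le_trans (exp_sin_sub_le _ _ a0)).
Qed.

Lemma integrable_stab (g t x : R) : 0 < g -> 0 < t -> 0 <= x ->
  leb.-integrable setT (EFin \o stab_integrand g t x).
Proof.
move=> g0 t0 x0; apply: (integrable_bounded_by _ _ (integrable_stab_major g0 t0)) => //.
  exact: continuous_measurable_fun (@continuous_stab_integrand g t x).
by move=> v _; exact: stab_integrand_le.
Qed.

Lemma integrable_stab_diff (g t x : R) : 0 <= g -> 0 < t -> 0 <= x ->
  leb.-integrable setT (EFin \o (fun v => stab_integrand g t x v - stab_integrand g t 0 v)).
Proof.
move=> g0 t0 x0; have gn : 0 < g + nu by rewrite ltr_wpDl.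
apply: (integrable_bounded_by _ _ (leb_integrableZl (2 * x) _ (integrable_stab_major gn t0))) => //.
  apply: continuous_measurable_fun => v.
  by apply: cvgB; exact: continuous_stab_integrand.
by move=> v _; exact: stab_integrand_sub_le.
Qed.

Lemma stab_diffE (g t x : R) : 0 < g -> 0 < t -> 0 <= x ->
  stab_diff g t x = stab g t x - stab g t 0.
Proof.
move=> g0 t0 x0; rewrite /stab_diff /stab -mulrBr.
by rewrite (leb_RintegralB measurableT (integrable_stab g0 t0 x0) (integrable_stab g0 t0 (lexx 0))).
Qed.

Let derZ (F : R -> R) (x l : R) : is_derive x 1 F l -> is_derive x 1 (fun y => pi^-1 * F y) (pi^-1 * l).
Proof. by move=> dF; der; rewrite mul0r add0r. Qed.

Lemma der_stab_x (g t x : R) : 0 < g -> 0 < t -> 0 < x ->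
  is_derive x 1 (stab g t) (- stab (g + nu) t x).
Proof.
move=> g0 t0 x0; rewrite /stab -mulrN; apply: derZ.
have gn : 0 < g + nu by rewrite addr_gt0.
rewrite -mulN1r -(leb_RintegralZl (- 1) measurableT (integrable_stab gn t0 (ltW x0))).
apply: (@is_derive_under_integral R (stab_integrand g t)
   (fun x v => -1 * stab_integrand (g + nu) t x v) setT 0 (x + 1) x (stab_major (g + nu) t)) => //.
- by rewrite x0 ltrDl ltr01.
- by move=> y /andP[y0 _]; exact: integrable_stab (ltW y0).
- by move=> y v _ _; rewrite mulN1r; case: (der_stab_integrand g t y v).
- exact: integrable_stab_major.
- by move=> y v /andP[y0 _] _; rewrite mulN1r normrN stab_integrand_le// ltW.
Qed.

Lemma der_stab_t (g t x : R) : 0 < g -> 0 < t -> 0 <= x ->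
  is_derive t 1 (fun s => stab g s x) (stab (g + 1) t x).
Proof.
move=> g0 t0 x0; apply: derZ; have g1 : 0 < g + 1 by rewrite addr_gt0.
have t20 : 0 < t / 2 by rewrite divr_gt0.
apply: (@is_derive_under_integral R (fun s => stab_integrand g s x)
   (fun s => stab_integrand (g + 1) s x) setT (t / 2) (t + 1) t (stab_major (g + 1) (t / 2))) => //.
- by apply/andP; split; lra.
- by move=> s /andP[s0 _]; apply: integrable_stab => //; exact: lt_trans s0.
- by move=> s v _ _; case: (der_stab_integrand g s x v).
- exact: integrable_stab_major.
- move=> s v /andP[s0 _] _; apply: (le_trans (stab_integrand_le _ _ _ x0)).
  by apply: stab_major_homo; exact: ltW.
Qed.

Lemma der_stab_diff_x (g t x : R) : 0 <= g -> 0 < t -> 0 < x ->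
  is_derive x 1 (stab_diff g t) (- stab (g + nu) t x).
Proof.
move=> g0 t0 x0; rewrite /stab -mulrN; apply: derZ.
have gn : 0 < g + nu by rewrite ltr_wpDl.
rewrite -mulN1r -(leb_RintegralZl (- 1) measurableT (integrable_stab gn t0 (ltW x0))).
apply: (@is_derive_under_integral R (fun y v => stab_integrand g t y v - stab_integrand g t 0 v)
   (fun x v => -1 * stab_integrand (g + nu) t x v) setT 0 (x + 1) x (stab_major (g + nu) t)) => //.
- by rewrite x0 ltrDl ltr01.
- by move=> y /andP[y0 _]; exact: integrable_stab_diff (ltW y0).
- move=> y v _ _; have [h _ _] := der_stab_integrand g t y v; der.
  by rewrite addr0 mulN1r.
- exact: integrable_stab_major.
- by move=> y v /andP[y0 _] _; rewrite mulN1r normrN stab_integrand_le// ltW.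
Qed.

Lemma der_stab_diff_t (g t x : R) : 0 <= g -> 0 < t -> 0 <= x ->
  is_derive t 1 (fun s => stab_diff g s x) (stab (g + 1) t x - stab (g + 1) t 0).
Proof.
move=> g0 t0 x0; have g1 : 0 < g + 1 by rewrite ltr_wpDl.
rewrite -(stab_diffE g1 t0 x0); apply: derZ.
have t20 : 0 < t / 2 by rewrite divr_gt0.
have gn : 0 < g + 1 + nu by rewrite addr_gt0.
apply: (@is_derive_under_integral R (fun s v => stab_integrand g s x v - stab_integrand g s 0 v)
   (fun s v => stab_integrand (g + 1) s x v - stab_integrand (g + 1) s 0 v)
   setT (t / 2) (t + 1) t (fun v => 2 * x * stab_major (g + 1 + nu) (t / 2) v)) => //.
- by apply/andP; split; lra.
- by move=> s /andP[s0 _]; apply: integrable_stab_diff => //; exact: lt_trans s0.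
- move=> s v _ _; have [_ h1 _] := der_stab_integrand g s x v.
  by have [_ h2 _] := der_stab_integrand g s 0 v; der.
- exact: leb_integrableZl (integrable_stab_major _ _).
- move=> s v /andP[s0 _] _; apply: (le_trans (stab_integrand_sub_le _ _ _ x0)).
  by rewrite ler_wpM2l ?mulr_ge0// stab_major_homo// ltW.
Qed.

Let ray_integrand_symbol (be x t v : R) :
  ray_integrand Th (symbol_re be x) (symbol_im be x) t v = stab_integrand (1 - be) t x v.
Proof.
rewrite /ray_integrand /symbol_re /symbol_im /symbol_abs /symbol_arg /stab_integrand.
have -> : (1 - be) * v + t * expR v * cos Th - x * expR (nu * v) * cos (nu * Th) =
  (v + t * expR v * cos Th) + (- be * v - x * expR (nu * v) * cos (nu * Th)) by ring.
have -> : (1 - be) * Th + t * expR v * sin Th - x * expR (nu * v) * sin (nu * Th) =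
  (Th + t * expR v * sin Th) - (be * Th + x * expR (nu * v) * sin (nu * Th)) by ring.
by rewrite (expRD (v + t * expR v * cos Th)) (sinB (Th + t * expR v * sin Th)); ring.
Qed.

Let symbol_re_ln (be x p : R) : 0 < p ->
  symbol_re be x (ln p) 0 = p `^ (- be) * expR (- (x * p `^ nu)).
Proof.
move=> p0; rewrite /symbol_re /symbol_abs /symbol_arg !mulr0 sin0 mulr0 addr0 cos0 !mulr1.
by rewrite !powR_expR_ln// expRD.
Qed.

Let Thb' : 0 < Th < b. Proof. by rewrite Tpos. Qed.
Let bpi' : 0 < b < pi. Proof. by rewrite b0. Qed.

Let laplace_symbol (be x : R) (d K : R) : 0 < d <= 1 ->
  holomorphic_pair b d K (symbol_re be x) (symbol_im be x) (symbol_re' be x) (symbol_im' be x) ->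
  forall p, 0 < p -> laplace_integrable (stab (1 - be) ^~ x) p /\
    laplace (stab (1 - be) ^~ x) p = p `^ (- be) * expR (- (x * p `^ nu)).
Proof.
move=> d01 hol p p0.
have E (t : R) : ray_transform Th (symbol_re be x) (symbol_im be x) t = stab (1 - be) t x.
  by congr (_ * _); apply: eq_leb_Rintegral => v _; exact: ray_integrand_symbol.
have [i El] := laplace_ray_transform bpi' d01 Thb' cosTh hol p0.
have E' : stab (1 - be) ^~ x = ray_transform Th (symbol_re be x) (symbol_im be x) by apply/funext.
by rewrite E'; split => //; rewrite El symbol_re_ln.
Qed.

Lemma laplace_stab (g x p : R) : 0 < g -> 0 < x -> 0 < p ->
  laplace_integrable (stab g ^~ x) p /\
  laplace (stab g ^~ x) p = p `^ (g - 1) * expR (- (x * p `^ nu)).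
Proof.
move=> g0 x0 p0; have g1 : 1 - g < 1 by rewrite ltrBlDr ltrDl.
have [d [K [d01 hol]]] := holomorphic_symbol g1 x0.
by have := laplace_symbol d01 hol p0; rewrite opprB addrC subrK.
Qed.

Lemma laplace_stab0 (g p : R) : 0 < g < 1 -> 0 < p ->
  laplace_integrable (stab g ^~ 0) p /\ laplace (stab g ^~ 0) p = p `^ (g - 1).
Proof.
move=> /andP[g0 g1] p0; have hg : 0 < 1 - g < 1 by rewrite subr_gt0 g1 ltrBlDr ltrDl.
have [d [K [d01 hol]]] := holomorphic_symbol_pow hg.
by have := laplace_symbol d01 hol p0; rewrite mul0r oppr0 expR0 mulr1 opprB addrC subrK.
Qed.

Lemma laplace_stab_diff (x p : R) : 0 < x -> 0 < p ->
  laplace_integrable (stab_diff 0 ^~ x) p /\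
  laplace (stab_diff 0 ^~ x) p = p^-1 * (expR (- (x * p `^ nu)) - 1).
Proof.
move=> x0 p0; have [d [K [d01 hol]]] := holomorphic_symbol_sub x0.
pose C v th := symbol_re 1 x v th - symbol_re 1 0 v th.
pose S v th := symbol_im 1 x v th - symbol_im 1 0 v th.
have [i El] := laplace_ray_transform bpi' d01 Thb' cosTh hol p0.
have E' : stab_diff 0 ^~ x = ray_transform Th C S.
  apply/funext => t; congr (_ * _); apply: eq_leb_Rintegral => v _.
  rewrite -[X in stab_integrand X t x](subrr 1) -[X in stab_integrand X t 0](subrr 1).
  by rewrite -!ray_integrand_symbol /ray_integrand /C /S; ring.
rewrite E'; split => //; rewrite El !symbol_re_ln// mul0r oppr0 expR0 mulr1 powR_inv1 ?(ltW p0)//.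
by ring.
Qed.

Lemma continuous_stab (g x t : R) : 0 < g -> 0 <= x -> 0 < t -> {for t, continuous (stab g ^~ x)}.
Proof. by move=> g0 x0 t0; exact: is_derive_continuous (der_stab_t g0 t0 x0). Qed.

(** Hankel's integral for 1 / Gamma (1 - g), by Lerch from the transform of a
    power. *)
Lemma stab0 (g t : R) : 0 < g < 1 -> 0 < t -> stab g t 0 = t `^ (- g) / Gamma (1 - g).
Proof.
move=> /andP[g0 g1] t0; have g10 : 0 < 1 - g by rewrite subr_gt0.
have G0 := Gamma_gt0 g10.
apply: (@lerch R (stab g ^~ 0) (fun t => t `^ (- g) / Gamma (1 - g))) => //.
- by move=> s s0; exact: continuous_stab.
- move=> s s0; apply: cvgM; last exact: cvg_cst.
  exact: is_derive_continuous (der_pow (- g) s0).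
- by move=> p p0; case: (@laplace_stab0 g p) => //; rewrite g0.
- move=> p p0; have [i _] := laplace_pow g10 p0.
  apply: eq_laplace_integrable (laplace_integrableZl (Gamma (1 - g))^-1 i) => s s0.
  by rewrite addrAC subrr add0r mulrC.
- move=> p p0; have [i E] := laplace_pow g10 p0.
  rewrite (@laplace_stab0 g p _ p0).2 ?g0//.
  rewrite (@eq_laplace _ _ (fun s => (Gamma (1 - g))^-1 * s `^ (1 - g - 1))).
    by rewrite laplaceZl// E mulrA mulVf ?gt_eqF// mul1r opprB.
  by move=> s s0; rewrite addrAC subrr add0r mulrC.
Qed.

Let stab0_FTC (g t d M : R) : 0 <= g -> 0 < t -> 0 < d ->
  leb.-integrable setT (EFin \o (fun v => g * stab_integrand g t 0 v)) ->
  (forall v, `|stab_integrand g t 0 v| <= M * sech d v) ->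
  \int[leb]_v (g * stab_integrand g t 0 v) + t * \int[leb]_v stab_integrand (g + 1) t 0 v = 0.
Proof.
move=> g0 t0 d0 ig bM; have g1 : 0 < g + 1 by rewrite ltr_wpDl.
have i1 := integrable_stab g1 t0 (lexx 0).
have i2 := leb_integrableZl t measurableT i1.
rewrite -(leb_RintegralZl t measurableT i1) -(leb_RintegralD measurableT ig i2).
have [s0 s1] := sech_cvg0 d0.
have dF (v : R) : is_derive v 1 (stab_integrand g t 0)
    (g * stab_integrand g t 0 v + t * stab_integrand (g + 1) t 0 v).
  by have [_ _] := der_stab_integrand g t 0 v; rewrite !mul0r subr0.
rewrite (Rintegral_FTC_real dF _ (leb_integrableD measurableT ig i2)
  (sech_dominated_cvg0 bM s0) (sech_dominated_cvg0 bM s1)) ?subrr// => v.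
apply: cvgD; (apply: cvgM; first exact: cvg_cst); exact: continuous_stab_integrand.
Qed.

(** The integral over v of d/dv (s^g e^{st}) = g s^g e^{st} + t s^{g+1} e^{st}
    vanishes. *)
Lemma stab0_rec (g t : R) : 0 < g -> 0 < t -> stab (g + 1) t 0 = - (g / t) * stab g t 0.
Proof.
move=> g0 t0; have [K K0 HK] := stab_major_decay g0 t0.
have ig := integrable_stab g0 t0 (lexx 0).
have := stab0_FTC (ltW g0) t0 g0 (leb_integrableZl g measurableT ig)
  (fun v => le_trans (stab_integrand_le g t v (lexx 0)) (HK v)).
rewrite (leb_RintegralZl g measurableT ig) /stab => H.
have -> : \int[leb]_v stab_integrand (g + 1) t 0 v = - (g / t) * \int[leb]_v stab_integrand g t 0 v.
  apply: (mulfI (lt0r_neq0 t0)); rewrite mulrA mulrN mulrCA mulfV ?lt0r_neq0// mulr1.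
  by rewrite mulNr; apply/eqP; rewrite -addr_eq0 addrC; apply/eqP.
by rewrite mulrCA.
Qed.

(** The same identity for g = 0, where the boundary term at - oo vanishes
    because sin is small there. *)
Lemma stab1_0 (t : R) : 0 < t -> stab 1 t 0 = 0.
Proof.
move=> t0; have [K K0 HK] := stab_major_decay ltr01 t0.
have i0 : leb.-integrable setT (EFin \o (fun v => 0 * stab_integrand 0 t 0 v)).
  have i1 := integrable_stab ltr01 t0 (lexx 0).
  by apply: eq_leb_integrable (leb_integrableZl 0 measurableT i1) => // v _; rewrite !mul0r.
have bd v : `|stab_integrand 0 t 0 v| <= t * K * sech 1 v.
  apply: (@le_trans _ _ (t * stab_major 1 t v)); last by rewrite -mulrA ler_pM2l.
  have := stab_majorD 0 1 t v; rewrite add0r mul1r => ->; rewrite mulrA.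
  rewrite /stab_integrand /stab_major !mul0r !subr0 !add0r normrM (gtr0_norm (expR_gt0 _)).
  rewrite mulrC ler_pM2r ?expR_gt0//.
  have h := sin_lipschitz 0 (t * expR v * sin Th).
  rewrite sin0 !subr0 in h; apply: (le_trans h).
  by rewrite normrM ger0_norm ?mulr_ge0 ?expR_ge0 ?(ltW t0)// ler_piMr// mulr_ge0 ?expR_ge0 ?(ltW t0).
have := stab0_FTC (lexx 0) t0 ltr01 i0 bd; rewrite add0r => H.
have E0 : \int[leb]_v (0 * stab_integrand 0 t 0 v) = 0.
  rewrite (eq_leb_Rintegral (g := fun v => 0 * stab_integrand 1 t 0 v)); last by move=> v _; rewrite !mul0r.
  by rewrite (leb_RintegralZl 0 measurableT (integrable_stab ltr01 t0 (lexx 0))) mul0r.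
rewrite E0 add0r in H; move/eqP : H; rewrite mulf_eq0 (gt_eqF t0)/= => /eqP H.
by rewrite /stab H mulr0.
Qed.

(** The recurrences of both sides in g agree, including at integers g, where
    both sides are 0. *)
Lemma stab0_Gamma (g t : R) : 0 < g -> 0 < t -> stab g t 0 = t `^ (- g) / Gamma (1 - g).
Proof.
move=> g0 t0; suff H n : forall g, 0 < g <= n%:R -> stab g t 0 = t `^ (- g) / Gamma (1 - g).
  apply: (H (Num.bound `|g|)); rewrite g0/=.
  by apply: (le_trans (ler_norm _)); apply/ltW/archi_boundP.
elim: n => [|n IH] {g0}g; first by case: ltgtP.
move=> /andP[g0 gn]; have [g1|g1|->] := ltgtP g 1.
- by apply: stab0; rewrite ?g0.
- have g10 : 0 < g - 1 by rewrite subr_gt0.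
  have h : 0 < g - 1 <= n%:R by rewrite g10 lerBlDr natr1.
  have := stab0_rec g10 t0; rewrite subrK => ->.
  rewrite (IH _ h) [(Gamma (1 - g))^-1]Gamma_recV; last by rewrite subr_le0 ltW.
  have -> : t `^ (- (g - 1)) = t `^ (- g) * t.
    by rewrite !powR_expR_ln// -[X in _ = _ * X](@lnK _ t)// -expRD; congr expR; ring.
  have -> : 1 - g + 1 = 1 - (g - 1) by ring.
  move: (Gamma (1 - (g - 1)))^-1 (t `^ (- g)) => G P.
  by field; rewrite gt_eqF.
- by rewrite stab1_0// subrr Gamma_recV// mul0r mulr0.
Qed.

Definition stab_taylor (g t x v : R) (n : nat) : R :=
  \sum_(j < n) (- x) ^+ j / j`!%:R * stab_integrand (g + nu * j%:R) t 0 v.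

Lemma der_stab_taylor (g t x v : R) (n : nat) :
  is_derive x 1 (fun y => stab_taylor g t y v n.+1) (- stab_taylor (g + nu) t x v n).
Proof.
elim: n => [|n IH].
  rewrite /stab_taylor big_ord0 oppr0.
  have -> : (fun y => \sum_(j < 1) (- y) ^+ j / j`!%:R * stab_integrand (g + nu * j%:R) t 0 v) =
    (fun=> stab_integrand g t 0 v).
    by apply/funext => y; rewrite big_ord_recr big_ord0/= expr0 fact0 add0r divr1 mul1r mulr0 addr0.
  exact: der_cst.
have -> : (fun y => stab_taylor g t y v n.+2) = (fun y => stab_taylor g t y v n.+1 +
  (- y) ^+ n.+1 / n.+1`!%:R * stab_integrand (g + nu * n.+1%:R) t 0 v).
  by apply/funext => y; rewrite /stab_taylor big_ord_recr.
have -> : stab_taylor (g + nu) t x v n.+1 = stab_taylor (g + nu) t x v n +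
  (- x) ^+ n / n`!%:R * stab_integrand (g + nu * n.+1%:R) t 0 v.
  have Eg : g + nu + nu * n%:R = g + nu * n.+1%:R by rewrite -natr1; ring.
  by rewrite /stab_taylor big_ord_recr/= Eg.
have f0 : n`!%:R != 0 :> R by rewrite pnatr_eq0 -lt0n fact_gt0.
have n1 : 1 + n%:R != 0 :> R by rewrite addrC natr1 pnatr_eq0.
by der; rewrite factS natrM -natr1; field; rewrite f0 addrC n1.
Qed.

(** Induction on n: differentiating the remainder in x gives the remainder of
    order n - 1 of the integrand for g + nu. *)
Lemma stab_taylor_le (g t x v : R) (n : nat) : 0 <= x ->
  `|stab_integrand g t x v - stab_taylor g t x v n| <=
  stab_major g t v * ((x * expR (nu * v)) ^+ n / n`!%:R).
Proof.
elim: n g x => [|n IH] g x x0.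
  by rewrite /stab_taylor big_ord0 subr0 expr0 fact0 divr1 mulr1 stab_integrand_le.
rewrite exprMn (mulrC (x ^+ _)) -mulrA mulrA.
have h0 : stab_integrand g t 0 v - stab_taylor g t 0 v n.+1 = 0.
  rewrite /stab_taylor big_ord_recl/= expr0 fact0 divr1 mul1r mulr0 addr0.
  rewrite big1 ?addr0 ?subrr// => j _.
  by rewrite oppr0 expr0n/= !mul0r.
have hd (y : R) : is_derive y 1 (fun y => stab_integrand g t y v - stab_taylor g t y v n.+1)
    (- (stab_integrand (g + nu) t y v - stab_taylor (g + nu) t y v n)).
  have [h1 _ _] := der_stab_integrand g t y v.
  by have h2 := der_stab_taylor g t y v n; der; rewrite opprD.
apply: (taylor_step x0 h0 hd) => y /andP[y0 _].
rewrite normrN; apply: (le_trans (IH _ _ y0)).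
rewrite stab_majorD exprMn exprS le_eqVlt; apply/orP; left; apply/eqP; ring.
Qed.

(** For v >= 0, nu <= 1 / 2 gives e^v >= (e^{nu v})^2, and x y - c y^2 is bounded
    by x^2 / (4 c). *)
Lemma stab_major_exp (g t x v : R) : 0 < t -> 0 <= x ->
  stab_major g t v * expR (x * expR (nu * v)) <=
  expR (x + x ^+ 2 / (- (2 * t * cos Th))) * stab_major g (t / 2) v.
Proof.
move=> t0 x0; rewrite /stab_major -!expRD ler_expR.
pose c := - (t / 2 * cos Th).
have cc : 0 < c by rewrite oppr_gt0 pmulr_rlt0// divr_gt0.
have -> : - (2 * t * cos Th) = 4 * c by rewrite /c; field.
suff h : x * expR (nu * v) - c * expR v <= x + x ^+ 2 / (4 * c).
  have -> : g * v + t * expR v * cos Th + x * expR (nu * v) =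
    g * v + t / 2 * expR v * cos Th + (x * expR (nu * v) - c * expR v) by rewrite /c; field.
  by rewrite [leRHS]addrC lerD2l.
have q0 : 0 <= x ^+ 2 / (4 * c) by rewrite divr_ge0 ?sqr_ge0 ?mulr_ge0// ltW.
have [v0|v0] := leP v 0.
  have h1 : expR (nu * v) <= 1 by rewrite -expR0 ler_expR mulr_ge0_le0// ltW.
  have h2 : x * expR (nu * v) <= x * 1 by rewrite ler_wpM2l.
  have : 0 <= c * expR v by rewrite mulr_ge0 ?expR_ge0// ltW.
  lra.
have h1 : expR (nu * v) ^+ 2 <= expR v.
  rewrite expr2 -expRD ler_expR -mulrDl ler_piMl ?(ltW v0)//.
  have := nu2; rewrite -[2^-1]mul1r ler_pdivlMr//; lra.
have h2 : c * expR (nu * v) ^+ 2 <= c * expR v by rewrite ler_pM2l.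
have h3 : 0 <= c * (expR (nu * v) - x / (2 * c)) ^+ 2 by rewrite mulr_ge0 ?sqr_ge0// ltW.
have h4 : c * (expR (nu * v) - x / (2 * c)) ^+ 2 =
  c * expR (nu * v) ^+ 2 - x * expR (nu * v) + x ^+ 2 / (4 * c) by field; rewrite gt_eqF.
lra.
Qed.

Let stab_rem (g t x : R) (n : nat) (v : R) := stab_integrand g t x v - stab_taylor g t x v n.+1.

Let stab_rem_integral (g t x : R) (n : nat) : 0 <= g -> 0 < t -> 0 <= x ->
  leb.-integrable setT (EFin \o stab_rem g t x n) /\
  pi^-1 * \int[leb]_v stab_rem g t x n v = stab_diff g t x -
    \sum_(j < n) (- x) ^+ j.+1 / j.+1`!%:R * stab (g + nu * j.+1%:R) t 0.
Proof.
move=> g0 t0 x0; elim: n => [|n [i E]].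
  have E0 v : stab_rem g t x 0 v = stab_integrand g t x v - stab_integrand g t 0 v.
    by rewrite /stab_rem /stab_taylor big_ord_recr big_ord0/= expr0 fact0 add0r divr1 mul1r mulr0 addr0.
  split.
    apply: eq_leb_integrable (integrable_stab_diff g0 t0 x0) => // v _; by rewrite E0.
  rewrite big_ord0 subr0; congr (_ * _); exact: eq_leb_Rintegral.
have gn : 0 < g + nu * n.+1%:R by rewrite ltr_wpDl// mulr_gt0.
have i1 := integrable_stab gn t0 (lexx 0).
pose k := (- x) ^+ n.+1 / n.+1`!%:R.
have i2 := leb_integrableZl k measurableT i1.
have E0 v : stab_rem g t x n.+1 v = stab_rem g t x n v - k * stab_integrand (g + nu * n.+1%:R) t 0 v.
  by rewrite /stab_rem /stab_taylor [in LHS]big_ord_recr/= opprD addrA.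
have E1 : stab_rem g t x n.+1 = (fun v => stab_rem g t x n v - k * stab_integrand (g + nu * n.+1%:R) t 0 v).
  exact/funext.
split; first by rewrite E1; exact: leb_integrableB.
rewrite E1 (leb_RintegralB measurableT i i2) (leb_RintegralZl k measurableT i1) mulrBr E.
by rewrite big_ord_recr/= /stab -/k; ring.
Qed.

Let stab_rem_cvg (g t x : R) : 0 <= g -> 0 < t -> 0 <= x ->
  \int[leb]_v stab_rem g t x n v @[n --> \oo] --> 0.
Proof.
move=> g0 t0 x0; have gn : 0 < g + nu by rewrite ltr_wpDl.
have t20 : 0 < t / 2 by rewrite divr_gt0.
pose M := x * expR (x + x ^+ 2 / (- (2 * t * cos Th))).
have iM := leb_integrableZl M measurableT (integrable_stab_major gn t20).
have bd n v : `|stab_rem g t x n v| <= M * stab_major (g + nu) (t / 2) v.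
  apply: (le_trans (stab_taylor_le _ _ _ _ x0)).
  set z := x * expR (nu * v); have z0 : 0 <= z by rewrite mulr_ge0 ?expR_ge0.
  have h1 : z ^+ n.+1 / n.+1`!%:R <= z * expR z.
    apply: (@le_trans _ _ (z * (z ^+ n / n`!%:R))).
      rewrite exprS factS natrM invfM mulrACA !mulrA ler_wpM2r ?invr_ge0//.
      by rewrite mulrAC ler_piMr ?mulr_ge0 ?exprn_ge0// invf_le1 ?ler1n.
    by rewrite ler_wpM2l// exp_coeff_le.
  have A0 : 0 <= stab_major g t v := expR_ge0 _.
  apply: (le_trans (ler_wpM2l A0 h1)).
  have := stab_major_exp (g + nu) v t0 x0; rewrite -/z => h2.
  have := ler_wpM2l x0 h2; rewrite stab_majorD /M /z => h3.
  by rewrite -[leRHS]mulrA; apply: le_trans h3; rewrite le_eqVlt; apply/orP; left; apply/eqP; ring.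
have mf n : measurable_fun setT (stab_rem g t x n).
  exact: leb_integrable_measurable (stab_rem_integral n g0 t0 x0).1.
have cf v : setT v -> stab_rem g t x n v @[n --> \oo] --> 0.
  move=> _; apply: norm_cvg0.
  have h := cvg_exp_coeff (x * expR (nu * v)).
  have h1 : stab_major g t v * exp_coeff (x * expR (nu * v)) n.+1 @[n --> \oo] --> stab_major g t v * 0.
    by apply: cvgM; [exact: cvg_cst|rewrite (cvg_shiftS (exp_coeff (x * expR (nu * v))))].
  rewrite mulr0 in h1; apply: (squeeze_cvgr _ _ h1); last exact: cvg_cst.
  by apply: nearW => n; rewrite normr_ge0/=; exact: stab_taylor_le.
have [_ h] := Rintegral_dominated_cvg measurableT mf iM (fun n v _ => bd n v) cf.
by move: h; rewrite [X in _ --> X](_ : _ = 0)// /Rintegral integral0.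
Qed.

(** Integrated term by term, the Taylor series of the integrand in x is the
    Wright series, by Hankel's integral; the term j = 0 is the one that stab_diff
    removes. *)
Theorem Wright_stab (g t x : R) : 0 <= g -> 0 < t -> 0 <= x ->
  Wright (- (x * t `^ (- nu))) (- nu) (1 - g) = (Gamma (1 - g))^-1 + t `^ g * stab_diff g t x.
Proof.
move=> g0 t0 x0; rewrite /Wright; set u := (fun j : nat => _).
apply: cvg_lim => //; rewrite -cvg_shiftS/=.
have Eu n : series u n.+1 = (Gamma (1 - g))^-1 + t `^ g *
    (stab_diff g t x - pi^-1 * \int[leb]_v stab_rem g t x n v).
  rewrite (stab_rem_integral n g0 t0 x0).2 subKr seriesEord /= big_ord_recl/=.
  rewrite {1}/u expr0 fact0 !mul1r mulr0 add0r; congr (_ + _).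
  rewrite mulr_sumr; apply: eq_bigr => j _.
  have gj : 0 < g + nu * j.+1%:R by rewrite ltr_wpDl// mulr_gt0.
  rewrite stab0_Gamma// /u/= /bump/= add1n.
  rewrite (_ : - nu * j.+1%:R + (1 - g) = 1 - (g + nu * j.+1%:R)); last by ring.
  have -> : (- (x * t `^ (- nu))) ^+ j.+1 = (- x) ^+ j.+1 * (t `^ g * t `^ (- (g + nu * j.+1%:R))).
    rewrite -mulNr exprMn; congr (_ * _); rewrite !powR_expR_ln// -expRD -expRM_natl.
    by congr expR; ring.
  by rewrite invfM; ring.
rewrite (_ : (fun n => series u n.+1) = (fun n => (Gamma (1 - g))^-1 + t `^ g *
    (stab_diff g t x - pi^-1 * \int[leb]_v stab_rem g t x n v))); last exact/funext.
have h : pi^-1 * \int[leb]_v stab_rem g t x n v @[n --> \oo] --> pi^-1 * 0.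
  by apply: cvgM; [exact: cvg_cst|exact: stab_rem_cvg].
rewrite mulr0 in h.
rewrite -[stab_diff g t x in X in _ --> X]subr0.
apply: cvgD; first exact: cvg_cst.
apply: cvgM; first exact: cvg_cst.
by apply: cvgB => //; exact: cvg_cst.
Qed.

Lemma integral_stab_major (g t : R) : 0 < g -> 0 < t ->
  \int[leb]_v stab_major g t v = t `^ (- g) * \int[leb]_v stab_major g 1 v.
Proof.
move=> g0 t0; have i := integrable_stab_major g0 ltr01.
have [j E] := Rintegral_affine (ln t) (oner_neq0 R) i.
have s v : stab_major g t v = t `^ (- g) * stab_major g 1 (1 * v + ln t).
  have et : expR (v + ln t) = expR v * t by rewrite (expRD v) (@lnK R t).
  rewrite /stab_major (powR_expR_ln _ t0) !mul1r et -expRD.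
  by congr expR; ring.
rewrite (eq_leb_Rintegral (fun v _ => s v)) (leb_RintegralZl _ measurableT j).
by rewrite E normr1 invr1 mul1r.
Qed.

(** e^{-q} <= 1 / q for the modulus e^{-q} of e^{-x s^nu}, followed by the
    scaling s -> s / t. *)
Lemma stab1_le : exists2 C, 0 <= C & forall x t, 0 < x -> 0 < t ->
  `|stab 1 t x| <= C / x * t `^ (nu - 1).
Proof.
have nu1 : 0 < 1 - nu by rewrite subr_gt0 (le_lt_trans nu2)// invf_lt1// ltr1n.
pose I := \int[leb]_v stab_major (1 - nu) 1 v.
have I0 : 0 <= I by apply: Rintegral_ge0 => v _; exact: expR_ge0.
have p1 : 0 <= (pi : R)^-1 by rewrite invr_ge0 (ltW pi0).
exists (pi^-1 * ((cos (nu * Th))^-1 * I)).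
  by rewrite mulr_ge0// mulr_ge0// invr_ge0 ltW.
move=> x t x0 t0; rewrite /stab normrM (ger0_norm p1) -!mulrA ler_wpM2l//.
pose k := (cos (nu * Th))^-1 / x.
have im := integrable_stab_major nu1 t0.
have bd v : setT v -> `|stab_integrand 1 t x v| <= k * stab_major (1 - nu) t v.
  move=> _; rewrite /stab_integrand normrM (gtr0_norm (expR_gt0 _)).
  apply: (@le_trans _ _ (expR (1 * v + t * expR v * cos Th - x * expR (nu * v) * cos (nu * Th)))).
    by rewrite ler_piMr ?expR_ge0.
  rewrite expRD; have -> : expR (1 * v + t * expR v * cos Th) = expR (nu * v) * stab_major (1 - nu) t v.
    by rewrite -stab_majorD subrK.
  set q := x * expR (nu * v) * cos (nu * Th).
  have q0 : 0 < q by rewrite !mulr_gt0 ?expR_gt0.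
  have h : expR (- q) <= q^-1.
    by rewrite expRN lef_pV2 ?posrE ?expR_gt0//; have := expR_ge1Dx q; lra.
  rewrite mulrAC ler_pM2r ?expR_gt0//.
  apply: (le_trans (ler_wpM2l (expR_ge0 _) h)).
  rewrite le_eqVlt; apply/orP; left; apply/eqP; rewrite /q /k; field.
  by rewrite !gt_eqF ?expR_gt0.
apply: (le_trans (leb_norm_Rintegral_le measurableT (integrable_stab ltr01 t0 (ltW x0))
  (leb_integrableZl k measurableT im) bd)).
rewrite (leb_RintegralZl k measurableT im) integral_stab_major// opprB -/I.
by rewrite le_eqVlt; apply/orP; left; apply/eqP; rewrite /k; ring.
Qed.

Lemma stab_diff_le : exists2 C, 0 <= C & forall x t, 0 <= x -> 0 < t ->
  `|stab_diff 0 t x| <= C * x * t `^ (- nu).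
Proof.
pose I := \int[leb]_v stab_major nu 1 v.
have I0 : 0 <= I by apply: Rintegral_ge0 => v _; exact: expR_ge0.
have p1 : 0 <= (pi : R)^-1 by rewrite invr_ge0 (ltW pi0).
exists (pi^-1 * (2 * I)); first by rewrite mulr_ge0// mulr_ge0.
move=> x t x0 t0; rewrite /stab_diff normrM (ger0_norm p1) -!mulrA ler_wpM2l//.
have im := integrable_stab_major nu0 t0.
have bd v : setT v -> `|stab_integrand 0 t x v - stab_integrand 0 t 0 v| <= 2 * x * stab_major nu t v.
  by move=> _; have := stab_integrand_sub_le 0 t v x0; rewrite add0r.
apply: (le_trans (leb_norm_Rintegral_le measurableT (integrable_stab_diff (lexx 0) t0 x0)
  (leb_integrableZl (2 * x) measurableT im) bd)).
rewrite (leb_RintegralZl (2 * x) measurableT im) integral_stab_major// -/I.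
by rewrite le_eqVlt; apply/orP; left; apply/eqP; ring.
Qed.

(** Inverse transform of s^{-1} e^{-x s^nu}: the 1 is the value at x = 0, of
    transform s^{-1}. *)
Definition stab_sol (x t : R) : R := 1 + stab_diff 0 t x.

Lemma der_sol_t (x t : R) : 0 < x -> 0 < t -> is_derive t 1 (stab_sol x) (stab 1 t x).
Proof.
move=> x0 t0; have h := der_stab_diff_t (lexx 0) t0 (ltW x0).
by rewrite /stab_sol; der; rewrite !add0r stab1_0// subr0.
Qed.

Lemma der_sol_x (x t : R) : 0 < x -> 0 < t -> is_derive x 1 (stab_sol ^~ t) (- stab nu t x).
Proof.
move=> x0 t0; have h := der_stab_diff_x (lexx 0) t0 x0.
by rewrite /stab_sol; der; rewrite !add0r.
Qed.

Lemma laplace_sol (x p : R) : 0 < x -> 0 < p -> laplace_integrable (stab_sol x) p /\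
  laplace (stab_sol x) p = p^-1 * expR (- (x * p `^ nu)).
Proof.
move=> x0 p0; have [i1 E1] := laplace_cst 1 p0; have [i2 E2] := laplace_stab_diff x0 p0.
split; first exact: laplace_integrableD i1 i2.
by rewrite (laplaceD i1 i2) E1 E2; field; rewrite gt_eqF.
Qed.

(** The derivative in t is at most a constant times t^{nu - 1} / x, so there is a
    limit c at t = 0 and |stab_sol - c| is at most a constant times t^nu / x.
    The transform of the derivative is e^{-x s^nu}, without boundary term: thus
    c = 0. *)
Lemma sol_le : exists2 C, 0 <= C & forall x t, 0 < x -> 0 < t -> `|stab_sol x t| <= C / x * t `^ nu.
Proof.
have [C C0 HC] := stab1_le; exists (C / nu); first by rewrite divr_ge0// ltW.
move=> x t x0 t0.
have dk (s : R) : 0 < s -> `|stab 1 s x| <= C / nu / x * (nu * s `^ (nu - 1)).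
  move=> s0; apply: (le_trans (HC x s x0 s0)); rewrite le_eqVlt; apply/orP; left; apply/eqP.
  by field; rewrite !gt_eqF.
have [c cl cb] := limit_of_integrable_derivative nu0 (fun s => der_sol_t x0) dk.
suff c00 : c = 0 by have := cb t t0; rewrite c00 subr0.
have dc (s : R) : 0 < s -> is_derive s 1 (fun s => stab_sol x s - c) (stab 1 s x).
  by move=> s0; have h := der_sol_t x0 s0; der; rewrite addr0.
have lc : stab_sol x s - c @[s --> 0^'+] --> 0.
  have H : stab_sol x s - c @[s --> 0^'+] --> c - c by apply: cvgB => //; exact: cvg_cst.
  by rewrite subrr in H.
have [i1 E1] := laplace_stab ltr01 x0 ltr01.
have [_ E2] := laplace_derivative ltr01 (ltW nu0) dc
  (fun s s0 => continuous_stab ltr01 (ltW x0) s0) lc cb i1.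
have [i3 E3] := laplace_sol x0 ltr01; have [i4 E4] := laplace_cst (- c) (ltr01 : (0 : R) < 1).
have E5 := laplaceD i3 i4.
move: E2; rewrite E1 E5 E3 E4 subrr powRr0 invr1 !mul1r mulr1 subr0; lra.
Qed.

Lemma sol_cvg0 (x : R) : 0 < x -> stab_sol x t @[t --> 0^'+] --> 0.
Proof.
move=> x0; have [C C0 HC] := sol_le; apply: norm_cvg0.
have h : C / x * t `^ nu @[t --> 0^'+] --> C / x * 0.
  by apply: cvgM; [exact: cvg_cst|exact: powR_cvg0].
rewrite mulr0 in h; apply: (squeeze_cvgr _ _ h); last exact: cvg_cst.
near=> t; rewrite normr_ge0/= HC//; near: t; exact: nbhs_right_gt.
Unshelve. all: by end_near. Qed.

Lemma sol_cvg1 (t : R) : 0 < t -> stab_sol x t @[x --> (0 : R)^'+] --> (1 : R).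
Proof.
move=> t0; have [C C0 HC] := stab_diff_le; rewrite -[X in _ --> X]addr0.
apply: cvgD; first exact: cvg_cst.
apply: norm_cvg0.
have h : C * x * t `^ (- nu) @[x --> 0^'+] --> C * 0 * t `^ (- nu).
  apply: cvgM; last exact: cvg_cst; apply: cvgM; first exact: cvg_cst.
  exact: (@cvg_at_right_filter _ _ (fun x : R => x)).
rewrite mulr0 mul0r in h; apply: (squeeze_cvgr _ _ h); last exact: cvg_cst.
near=> x; rewrite normr_ge0/= HC//; apply: ltW; near: x; exact: nbhs_right_gt.
Unshelve. all: by end_near. Qed.

(** The two bounds, in z = x t^{-nu}, serve for z <= 1 and for z >= 1. *)
Lemma sol_bounded : exists M, forall x t, 0 < x -> 0 < t -> `|stab_sol x t| <= M.
Proof.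
have [C C0 HC] := sol_le; have [D D0 HD] := stab_diff_le; exists (1 + C + D) => x t x0 t0.
have tn : 0 < t `^ nu by exact: powR_gt0.
have [h|/ltW h] := leP x (t `^ nu).
  apply: (le_trans (ler_normD _ _)); rewrite normr1 -addrA lerD2l.
  apply: (le_trans (HD x t (ltW x0) t0)); apply: (@le_trans _ _ D); last by rewrite lerDr.
  by rewrite powRN -mulrA ler_piMr// ler_pdivrMr// mul1r.
apply: (le_trans (HC x t x0 t0)); apply: (@le_trans _ _ C); last by rewrite addrAC lerDr addr_ge0.
by rewrite -mulrA ler_piMr// mulrC ler_pdivrMr// mul1r.
Qed.

(** Both sides are continuous in t and have the transform
    Gamma (1 - 2 nu) s^{2 nu - 1} e^{-x s^nu}. *)
Lemma abel_stab (x t : R) : nu < 2^-1 -> 0 < x -> 0 < t ->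
  leb.-integrable `]0, t[ (EFin \o (fun tau => (t - tau) `^ (- (2 * nu)) * stab 1 tau x)) /\
  \int[leb]_(tau in `]0, t[) ((t - tau) `^ (- (2 * nu)) * stab 1 tau x) =
  Gamma (1 - 2 * nu) * stab (2 * nu) t x.
Proof.
move=> nu12 x0 t0; have [C C0 HC] := stab1_le.
have n2 : 0 < 2 * nu by rewrite mulr_gt0.
have m01 : 0 < 2 * nu < 1 by rewrite n2/= mulrC -ltr_pdivlMr// mul1r.
have a01 : 0 < nu < 1 by rewrite nu0/=; case/andP: m01; lra.
have cg s (s0 : 0 < s) := continuous_stab ltr01 (ltW x0) s0.
have gK s (s0 : 0 < s) := HC x s x0 s0.
have ia s (s0 : 0 < s) := integrable_abel m01 a01 cg gK s0.
split; first exact: ia.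
have lc p (p0 : 0 < p) := laplace_convolution m01 p0 (laplace_stab ltr01 x0 p0).1 ia.
have ls p (p0 : 0 < p) := laplace_stab n2 x0 p0.
apply: (@lerch R (fun t => \int[leb]_(tau in `]0, t[) ((t - tau) `^ (- (2 * nu)) * stab 1 tau x))
  (fun t => Gamma (1 - 2 * nu) * stab (2 * nu) t x)) => //.
- by move=> s s0; exact: (continuous_abel m01 a01 cg gK s0).
- move=> s s0; apply: cvgM; first exact: cvg_cst.
  exact: continuous_stab (ltW x0) s0.
- by move=> p p0; case: (lc p p0).
- by move=> p p0; apply: laplace_integrableZl; case: (ls p p0).
- move=> p p0; rewrite (lc p p0).2 laplaceZl; last by case: (ls p p0).
  by rewrite (ls p p0).2 (laplace_stab ltr01 x0 p0).2 subrr powRr0 mul1r mulrA.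
Qed.

End stable.

(** * The fundamental solution *)

(** The properties of the inverse transform f of s^{-1} e^{-x s^nu}, of its
    derivative ft in t and of its derivatives fx, fxx in x that the study of the
    Stefan problem uses.  The fields fund_abel and fund_heat say that f solves the
    diffusion equation for 2 nu < 1 and for 2 nu = 1. *)
Record fundamental_solution {R : realType} (nu : R) (f ft fx fxx : R -> R -> R) : Prop :=
    FundamentalSolution {
  fund_dt : forall x t : R, 0 < x -> 0 < t -> is_derive t 1 (f x) (ft x t) ;
  fund_dx : forall x t : R, 0 < x -> 0 < t -> is_derive x 1 (f ^~ t) (fx x t) ;
  fund_dxx : forall x t : R, 0 < x -> 0 < t -> is_derive x 1 (fx ^~ t) (fxx x t) ;
  fund_ft_continuous : forall x t : R, 0 < x -> 0 < t -> {for t, continuous (ft x)} ;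
  fund_laplace : forall x s : R, 0 < x -> 0 < s -> laplace_integrable (f x) s /\
    laplace (f x) s = s^-1 * expR (- (x * s `^ nu)) ;
  fund_laplace_t : forall x s : R, 0 < x -> 0 < s -> laplace_integrable (ft x) s ;
  fund_laplace_xx : forall x s : R, 0 < x -> 0 < s -> laplace_integrable (fxx x) s /\
    laplace (fxx x) s = s `^ (2 * nu - 1) * expR (- (x * s `^ nu)) ;
  fund_initial : forall x : R, 0 < x -> f x t @[t --> 0^'+] --> 0 ;
  fund_boundary : forall t : R, 0 < t -> f x t @[x --> (0 : R)^'+] --> (1 : R) ;
  fund_bounded : exists M, forall x t : R, 0 < x -> 0 < t -> `|f x t| <= M ;
  fund_abel : forall x t : R, nu < 2^-1 -> 0 < x -> 0 < t ->
    (@lebesgue_measure R).-integrable `]0, t[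
      (EFin \o (fun tau => (t - tau) `^ (- (2 * nu)) * ft x tau)) /\
    \int[@lebesgue_measure R]_(tau in `]0, t[) ((t - tau) `^ (- (2 * nu)) * ft x tau) =
    Gamma (1 - 2 * nu) * fxx x t ;
  fund_heat : nu = 2^-1 -> forall x t : R, ft x t = fxx x t ;
  fund_Wright : forall x t : R, 0 < x -> 0 < t ->
    f x t = Wright (- (x * t `^ (- nu))) (- nu) 1 ;
  fund_Wright_x : forall x t : R, 0 < x -> 0 < t ->
    fx x t = - (t `^ (- nu) * Wright (- (x * t `^ (- nu))) (- nu) (1 - nu)) }.

Theorem exists_fundamental_solution {R : realType} (nu : R) : 0 < nu -> nu <= 2^-1 ->
  exists f ft fx fxx, fundamental_solution nu f ft fx fxx.
Proof.
move=> nu0 nu2; have pi0 := pi_gt0 R.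
(* Any angles with pi / 2 < Th < b < pi would do. *)
pose Th : R := pi * (2 / 3); pose b : R := pi * (5 / 6).
have Th0 : pi / 2 < Th by rewrite /Th; lra.
have Thb : Th < b by rewrite /Th /b; lra.
have bpi : b < pi by rewrite /b; lra.
have n2 : 0 < 2 * nu by rewrite mulr_gt0.
exists (stab_sol nu Th), (fun x t => stab nu Th 1 t x),
  (fun x t => - stab nu Th nu t x), (fun x t => stab nu Th (2 * nu) t x).
split.
- move=> x t; exact: (der_sol_t nu0 nu2 Th0 Thb bpi).
- move=> x t; exact: (der_sol_x nu0 nu2 Th0 Thb bpi).
- move=> x t x0 t0; have h := der_stab_x nu0 nu2 Th0 Thb bpi nu0 t0 x0.
  by der; rewrite opprK mulr2n mulrDl mul1r.
- move=> x t x0 t0; exact: (continuous_stab nu0 nu2 Th0 Thb bpi ltr01 (ltW x0) t0).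
- move=> x s; exact: (laplace_sol nu0 nu2 Th0 Thb bpi).
- move=> x s x0 s0; exact: (laplace_stab nu0 nu2 Th0 Thb bpi ltr01 x0 s0).1.
- move=> x s; exact: (laplace_stab nu0 nu2 Th0 Thb bpi n2).
- move=> x; exact: (sol_cvg0 nu0 nu2 Th0 Thb bpi).
- move=> t; exact: (sol_cvg1 nu0 nu2 Th0 Thb bpi).
- exact: (sol_bounded nu0 nu2 Th0 Thb bpi).
- move=> x t; exact: (abel_stab nu0 nu2 Th0 Thb bpi).
- by move=> -> x t; rewrite mulfV.
- move=> x t x0 t0.
  have := Wright_stab nu0 nu2 Th0 Thb bpi (lexx 0) t0 (ltW x0).
  by rewrite subr0 Gamma1 invr1 powRr0 mul1r => ->.
- move=> x t x0 t0.
  rewrite (Wright_stab nu0 nu2 Th0 Thb bpi (ltW nu0) t0 (ltW x0)).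
  rewrite (stab_diffE nu0 nu2 Th0 Thb bpi nu0 t0 (ltW x0)).
  rewrite (stab0_Gamma nu0 nu2 Th0 Thb bpi nu0 t0) powRN.
  have tn : t `^ nu != 0 by rewrite lt0r_neq0// powR_gt0.
  move: (t `^ nu) (Gamma (1 - nu))^-1 (stab _ _ _ _ _) tn => T G S T0.
  by congr (- _); field.
Qed.

(** * Calculus on the half-line *)

Section half_line_calculus.
Context {R : realType}.
Local Notation leb := (@lebesgue_measure R).
Local Notation pos := (`]0, +oo[%classic : set R).

Lemma is_derive_derive1 (f : R -> R) (x l : R) : is_derive x 1 f l -> derive1 f x = l.
Proof. by move=> [_ E]; rewrite derive1E. Qed.

Lemma derivable_is_derive (f : R -> R) (x : R) : derivable f x 1 -> is_derive x 1 f (derive1 f x).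
Proof. by move=> /derivableP h; rewrite derive1E. Qed.

Lemma near_eq_pos (f g : R -> R) (x : R) : (forall y : R, 0 < y -> f y = g y) -> 0 < x ->
  \forall y \near x, f y = g y.
Proof.
move=> fg x0; near=> y; apply: fg; near: y; exact: lt_nbhsr.
Unshelve. all: by end_near. Qed.

Lemma is_derive_pos (f g : R -> R) (x l : R) : (forall y : R, 0 < y -> f y = g y) -> 0 < x ->
  is_derive x 1 f l -> is_derive x 1 g l.
Proof. by move=> fg x0; apply: near_eq_is_derive; exact: near_eq_pos. Qed.

Lemma continuous_pos (f g : R -> R) (x : R) : (forall y : R, 0 < y -> f y = g y) -> 0 < x ->
  {for x, continuous f} -> {for x, continuous g}.
Proof.
move=> fg x0; rewrite /prop_for /= /continuous_at fg// => h; apply: cvg_trans h.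
by apply: near_eq_cvg; exact: near_eq_pos.
Qed.

Lemma cvg_at_right_pos (f g : R -> R) (l : R) : (forall y : R, 0 < y -> f y = g y) ->
  f y @[y --> 0^'+] --> l -> g y @[y --> 0^'+] --> l.
Proof.
move=> fg; apply: cvg_trans; apply: near_eq_cvg; near=> y; apply: fg; near: y.
exact: nbhs_right_gt.
Unshelve. all: by end_near. Qed.

Lemma twice_derivable_pos (f df ddf g : R -> R) (x : R) : (forall y : R, 0 < y -> f y = g y) ->
  (forall y : R, 0 < y -> is_derive y 1 f (df y)) ->
  (forall y : R, 0 < y -> is_derive y 1 df (ddf y)) -> 0 < x ->
  [/\ twice_derivable g x, derive1 g x = df x & derive1 (derive1 g) x = ddf x].
Proof.
move=> fg d1 d2 x0.
have dg (y : R) (y0 : 0 < y) := is_derive_pos fg y0 (d1 y y0).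
have Eg (y : R) : 0 < y -> df y = derive1 g y by move=> y0; rewrite (is_derive_derive1 (dg y y0)).
have ddg := is_derive_pos Eg x0 (d2 x x0).
split; last exact: is_derive_derive1.
- split; last by case: ddg.
  by near=> y; have [] : is_derive y 1 g (df y) by apply: dg; near: y; exact: lt_nbhsr.
- by rewrite Eg.
Unshelve. all: by end_near. Qed.

Lemma derive0_cst_pos (f : R -> R) : (forall x : R, 0 < x -> is_derive x 1 f 0) ->
  forall x, 0 < x -> f x = f 1.
Proof.
move=> df; have H (x y : R) : 0 < x -> x <= y -> f x = f y.
  move=> x0 xy; have d z : x <= z <= y -> is_derive z 1 f 0.
    by case/andP=> xz _; apply: df; exact: lt_le_trans xz.
  have := lipschitz_segment (M := 0) (df := fun=> 0) xy d.
  rewrite mul0r => /(_ (fun z _ => _)) h; apply/esym/eqP; rewrite -subr_eq0 -normr_le0.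
  by apply: h; rewrite normr0.
move=> x x0; have [h|/ltW h] := leP x 1; first exact: H.
by rewrite -(H 1 x).
Qed.

(** The factorization (d/dx - k) (d/dx + k) W = 0 is integrated twice;
    boundedness excludes the component e^{k x}. *)
Lemma bounded_ode (W dW : R -> R) (k M : R) : 0 < k ->
  (forall x : R, 0 < x -> is_derive x 1 W (dW x)) ->
  (forall x : R, 0 < x -> is_derive x 1 dW (k ^+ 2 * W x)) ->
  (forall x : R, 0 < x -> `|W x| <= M) ->
  exists B, forall x : R, 0 < x -> W x = B * expR (- (k * x)).
Proof.
move=> k0 d1 d2 WM.
pose p x := expR (- (k * x)) * (dW x + k * W x).
have dp (x : R) : 0 < x -> is_derive x 1 p 0.
  by move=> x0; have h1 := d1 x x0; have h2 := d2 x x0; rewrite /p; der; ring.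
have pA := derive0_cst_pos dp; set A := p 1 in pA.
have ee (x : R) : expR (- (k * x)) * expR (k * x) = 1 by rewrite -expRD addrC subrr expR0.
pose q x := expR (k * x) * W x - A / (2 * k) * expR (2 * (k * x)).
have dq (x : R) : 0 < x -> is_derive x 1 q 0.
  move=> x0; have h1 := d1 x x0; rewrite /q; der.
  have e2 : expR (2 * (k * x)) = expR (k * x) * expR (k * x) by rewrite -expRD; congr expR; ring.
  rewrite -(pA x x0) /p e2.
  transitivity (expR (k * x) * (dW x + k * W x) * (1 - expR (- (k * x)) * expR (k * x))).
    by field; rewrite gt_eqF.
  by rewrite ee subrr mulr0.
have qB := derive0_cst_pos dq; set B := q 1 in qB.
have WE (x : R) : 0 < x -> W x = A / (2 * k) * expR (k * x) + B * expR (- (k * x)).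
  move=> x0; have e2 : expR (2 * (k * x)) = expR (k * x) * expR (k * x) by rewrite -expRD; congr expR; ring.
  rewrite -(qB x x0) /q e2; transitivity (W x * (expR (- (k * x)) * expR (k * x)) +
    A / (2 * k) * expR (k * x) * (1 - expR (- (k * x)) * expR (k * x))); last by ring.
  by rewrite ee subrr mulr0 addr0 mulr1.
suff A0 : A = 0 by exists B => x x0; rewrite WE// A0 !mul0r add0r.
apply/eqP; apply: contraT => A0; pose c := `|A / (2 * k)|.
have c0 : 0 < c by rewrite normr_gt0 mulf_neq0// invr_neq0// lt0r_neq0// mulr_gt0.
have M0 : 0 <= M by apply: le_trans (WM 1 ltr01).
have bd (x : R) : 0 < x -> c * (k * x) <= M + `|B|.
  move=> x0; have e1 : expR (- (k * x)) <= 1 by rewrite -expR0 ler_expR oppr_le0 mulr_ge0// ltW.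
  apply: (@le_trans _ _ (c * expR (k * x))).
    by rewrite ler_pM2l//; have := expR_ge1Dx (k * x); lra.
  rewrite -[expR (k * x)]gtr0_norm ?expR_gt0// -normrM.
  have -> : A / (2 * k) * expR (k * x) = W x - B * expR (- (k * x)) by rewrite WE// addrK.
  apply: (le_trans (ler_normB _ _)); apply: lerD; first exact: WM.
  by rewrite normrM (gtr0_norm (expR_gt0 _)) ler_piMr.
have y0 : 0 < (M + `|B| + 1) / (c * k) by rewrite divr_gt0 ?mulr_gt0// ltr_wpDl// addr_ge0.
have E : c * (k * ((M + `|B| + 1) / (c * k))) = M + `|B| + 1.
  by clearbody c; field; rewrite !lt0r_neq0.
by have := bd _ y0; rewrite E; lra.
Qed.

End half_line_calculus.

(** * Every half-line solution is an affine function of the fundamental solution *)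

Section uniqueness.
Context {R : realType}.
Local Notation leb := (@lebesgue_measure R).
Local Notation pos := (`]0, +oo[%classic : set R).
Variables (nu : R) (f ft fx fxx : R -> R -> R).
Hypotheses (nu0 : 0 < nu) (nu2 : nu <= 2^-1).
Hypothesis F : fundamental_solution nu f ft fx fxx.

Lemma continuous_fund (x t : R) : 0 < x -> 0 < t -> {for t, continuous (f x)}.
Proof. by move=> x0 t0; exact: is_derive_continuous (fund_dt F x0 t0). Qed.

Let n2 : 2 * nu != 1 -> 0 < 2 * nu < 1.
Proof.
move=> h; rewrite mulr_gt0//= lt_neqAle h/= mulrC -ler_pdivlMr// mul1r//.
Qed.

(** The choice operator in the definition of the inverse transform picks some
    continuous inverse transform, and Lerch's theorem identifies it. *)
Lemma Rfun_pos (x t : R) : 0 < x -> 0 < t ->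
  inverse_laplace (fun s => s `^ (- 1) * expR (- (x * s `^ nu))) t = f x t.
Proof.
move=> x0 t0; set FF := fun s : R => _.
have h : is_inverse_laplace FF (f x).
  split; first by move=> s s0; exact: continuous_fund.
  move=> s s0; have [i E] := fund_laplace F x0 s0; split => //.
  by rewrite E /FF powR_inv1// ltW.
have [c l] := @xgetPex _ (cst 0) [set g | is_inverse_laplace FF g] (ex_intro _ _ h).
have [c' l'] := h.
apply: (lerch c c' (fun s s0 => (l s s0).1) (fun s s0 => (l' s s0).1)) => // s s0.
by rewrite (l s s0).2 (l' s s0).2.
Qed.

Lemma Rfun_gt0 (x t : R) : 0 < x -> 0 < t -> Rfun 1 nu x t = f x t.
Proof. by move=> x0 t0; rewrite /Rfun x0 Rfun_pos. Qed.

Lemma Rfun_0 (t : R) : 0 < t -> Rfun 1 nu 0 t = 1.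
Proof.
move=> t0; rewrite /Rfun ltxx; apply: cvg_lim => //.
apply: cvg_at_right_pos (fund_boundary F t0) => x x0.
by rewrite Rfun_pos.
Qed.

Lemma half_line_derivable u0 u (x t : R) : half_line_solution nu u0 u -> 0 < x -> 0 < t ->
  is_derive t 1 (u x) (derive1 (u x) t).
Proof.
case=> [H _ _ _ _] x0 t0; apply: derivable_is_derive.
have t1 : 0 < t + 1 by rewrite addr_gt0.
have [[h _ _] _] := H x (t + 1) x0 t1; have [[h' _ _] _] := H x t x0 t0.
move: h h'; rewrite /caputo_derivable; case: eqP => // _ [h _] _.
by apply: h; rewrite t0 ltrDl ltr01.
Qed.

Lemma laplace_caputo u0 u (x s : R) : half_line_solution nu u0 u -> 0 < x -> 0 < s ->
  laplace (dxx u x) s = s `^ (2 * nu - 1) * laplace (derive1 (u x)) s.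
Proof.
case=> [H _ _ _ L] x0 s0; have [i1 _ _ _] := L x s x0 s0.
have [e|ne] := eqVneq (2 * nu) 1.
  rewrite e subrr powRr0 mul1r; apply: eq_laplace => t t0.
  by have [[_ _ <-] _] := H x t x0 t0; rewrite /caputo e eqxx.
have G0 : 0 < Gamma (1 - 2 * nu) by rewrite Gamma_gt0// subr_gt0; case/andP: (n2 ne).
have ii (t : R) : 0 < t -> leb.-integrable `]0, t[
    (EFin \o (fun tau => (t - tau) `^ (- (2 * nu)) * derive1 (u x) tau)).
  move=> t0; have [[h _ _] _] := H x t x0 t0; move: h.
  by rewrite /caputo_derivable (negPf ne) => -[].
have [ic Ec] := laplace_convolution (n2 ne) s0 i1 ii.
rewrite (@eq_laplace _ _ (fun t => (Gamma (1 - 2 * nu))^-1 *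
    \int[leb]_(tau in `]0, t[) ((t - tau) `^ (- (2 * nu)) * derive1 (u x) tau))).
  by rewrite (laplaceZl _ ic) Ec !mulrA mulVf ?mul1r// lt0r_neq0.
by move=> t t0; have [[_ _ <-] _] := H x t x0 t0; rewrite /caputo (negPf ne).
Qed.

Lemma half_line_laplace u0 u (x s : R) : half_line_solution nu u0 u -> 0 < x -> 0 < s ->
  laplace_integrable (u x) s /\ laplace (derive1 (u x)) s = s * laplace (u x) s - u0.
Proof.
move=> hu x0 s0; have [H [I1 I2] _ [M HM] L] := hu; have [i1 _ _ _] := L x s x0 s0.
apply: (@laplace_derivative R (u x) (derive1 (u x)) u0 M 0 s s0 (lexx 0)) => //.
- by move=> t t0; exact: half_line_derivable hu x0 t0.
- by move=> t t0; case: (H x t x0 t0).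
- have := I2 x x0; rewrite I1 ?(ltW x0)// indicE mem_set ?mulr1//.
  by apply/posP.
- by move=> t t0; rewrite powRr0 mulr1 HM.
Qed.

(** V = laplace (u x) s - u0 / s satisfies V'' = s^{2 nu} V and is bounded, so it
    is a multiple of e^{-x s^nu}; the constant is its limit at x = 0, where u = 1.
    Hence u and u0 + (1 - u0) f have the same transforms in t. *)
Lemma uniqueness u0 u : half_line_solution nu u0 u ->
  forall x t, 0 < x -> 0 < t -> u x t = u0 + (1 - u0) * f x t.
Proof.
move=> hu; have [H _ B [M HM] L] := hu.
have cu (x t : R) : 0 < x -> 0 < t -> {for t, continuous (u x)}.
  by move=> x0 t0; exact: is_derive_continuous (half_line_derivable hu x0 t0).
have M0 : 0 <= M by apply: le_trans (HM 1 1 ltr01 ltr01).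
have key (s : R) : 0 < s -> forall x, 0 < x ->
    laplace (u x) s = u0 / s + (1 - u0) / s * expR (- (x * s `^ nu)).
  move=> s0; pose V x := laplace (u x) s; pose k := s `^ nu.
  have k0 : 0 < k by exact: powR_gt0.
  have kk : s `^ (2 * nu) = k ^+ 2 by rewrite /k -powR_mulrn ?powR_ge0// -powRrM mulrC.
  have dV (x : R) : 0 < x -> is_derive x 1 V (derive1 V x).
    move=> x0; apply: derivable_is_derive; have [_ _ [h _] _] := L x s x0 s0.
    exact: nbhs_singleton h.
  have d2V (x : R) : 0 < x -> is_derive x 1 (derive1 V) (k ^+ 2 * (V x - u0 / s)).
    move=> x0; have [_ _ [_ h] E] := L x s x0 s0.
    have := derivable_is_derive h; rewrite E (laplace_caputo hu x0 s0).
    rewrite (half_line_laplace hu x0 s0).2 -kk.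
    rewrite (_ : s `^ (2 * nu - 1) = s `^ (2 * nu) / s); last first.
      by rewrite powRD ?(gt_eqF s0) ?implybT// powR_inv1 ?(ltW s0).
    rewrite (_ : s `^ (2 * nu) / s * (s * laplace (u x) s - u0) =
      s `^ (2 * nu) * (V x - u0 / s))//.
    by rewrite /V; field; rewrite gt_eqF.
  have dW (x : R) : 0 < x -> is_derive x 1 (fun x => V x - u0 / s) (derive1 V x).
    by move=> x0; have h := dV x x0; der; rewrite addr0.
  have bV (x : R) : 0 < x -> `|V x| <= M / s.
    move=> x0; have [i E] := laplace_cst M s0; rewrite -E /V.
    apply: (leb_norm_Rintegral_le measurable_pos (half_line_laplace hu x0 s0).1 i) => t /posP t0.
    by rewrite normrM (ger0_norm (expR_ge0 _)) ler_wpM2l ?expR_ge0// HM.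
  have bW (x : R) : 0 < x -> `|V x - u0 / s| <= M / s + `|u0 / s|.
    by move=> x0; apply: (le_trans (ler_normB _ _)); rewrite lerD2r bV.
  have [C HC] := bounded_ode k0 dW d2V bW.
  suff -> : (1 - u0) / s = C.
    by move=> x x0; have := HC x x0; rewrite /V -/k [x * k]mulrC => <-; ring.
  (* Dominated convergence along the sequence x = 1 / (n + 1). *)
  have h0 : @harmonic R n @[n --> \oo] --> 0 by exact: cvg_harmonic.
  have hp n : 0 < @harmonic R n by exact: harmonic_gt0.
  have i1 := (laplace_cst M s0).1.
  have mu_ n := leb_integrable_measurable (half_line_laplace hu (hp n) s0).1.
  have bd n t : pos t -> `|expR (- (s * t)) * u (harmonic n) t| <= expR (- (s * t)) * M.
    by move=> /posP t0; rewrite normrM (ger0_norm (expR_ge0 _)) ler_wpM2l ?expR_ge0// HM.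
  have cv t : pos t -> expR (- (s * t)) * u (harmonic n) t @[n --> \oo] --> expR (- (s * t)) * 1.
    move=> /posP t0; apply: cvgM; first exact: cvg_cst.
    have [E h] := B t t0; rewrite E in h.
    exact: ((cvg_at_rightP _ _ _).1 h harmonic (conj hp h0)).
  have [_ lim1] := Rintegral_dominated_cvg measurable_pos mu_ i1 bd cv.
  have lim2 : V (harmonic n) @[n --> \oo] --> u0 / s + C * expR (- (k * 0)).
    have E n : V (harmonic n) = u0 / s + C * expR (- (k * harmonic n)).
      by have := HC _ (hp n); lra.
    under eq_fun do rewrite E.
    apply: cvgD; first exact: cvg_cst.
    apply: cvgM; first exact: cvg_cst.
    exact: (cvg_comp _ _ h0 (@continuous_expRN R k 0)).
  have EL : \int[leb]_(t in pos) (expR (- (s * t)) * 1) = u0 / s + C * expR (- (k * 0)).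
    exact: (cvg_unique (@norm_hausdorff _ _) lim1 lim2).
  have [_ E1] := laplace_cst (1 : R) s0.
  rewrite /laplace EL mulr0 oppr0 expR0 mulr1 in E1.
  by rewrite mulrBl -E1; ring.
move=> x t x0 t0.
apply: (@lerch R (u x) (fun t => u0 + (1 - u0) * f x t)) => //.
- by move=> y; exact: cu.
- move=> y y0; apply: cvgD; first exact: cvg_cst.
  by apply: cvgM; [exact: cvg_cst|exact: continuous_fund].
- by move=> s s0; exact: (half_line_laplace hu x0 s0).1.
- move=> s s0; apply: laplace_integrableD; first exact: (laplace_cst u0 s0).1.
  exact: laplace_integrableZl (fund_laplace F x0 s0).1.
- move=> s s0; have [i1 E1] := laplace_cst u0 s0; have [i2 E2] := fund_laplace F x0 s0.
  rewrite (key s s0 x x0) (laplaceD i1 (laplace_integrableZl (1 - u0) i2)) E1.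
  by rewrite (laplaceZl _ i2) E2 mulrA.
Qed.

End uniqueness.

(** * The fractional Stefan problem *)

Section assembly.
Context {R : realType}.
Local Notation leb := (@lebesgue_measure R).
Local Notation pos := (`]0, +oo[%classic : set R).
Variables (nu : R).
Hypotheses (nu0 : 0 < nu) (nu2 : nu <= 2^-1).

Let nlt1 : nu < 1. Proof. by apply: le_lt_trans nu2 _; rewrite invf_lt1// ltr1n. Qed.

Lemma caputo_order : 2 * nu != 1 -> 0 < 2 * nu < 1 /\ nu < 2^-1.
Proof.
move=> h; have h2 : 2 * nu <= 1 by have := nu2; lra.
have h1 : 2 * nu < 1 by rewrite lt_neqAle h.
by split; [rewrite h1 mulr_gt0|lra].
Qed.

(** The beta integral B (1 - 2 nu, nu) scaled to ]0, t[, again by comparing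
    transforms. *)
Lemma abel_power (t : R) : 2 * nu != 1 -> 0 < t ->
  leb.-integrable `]0, t[ (EFin \o (fun tau => (t - tau) `^ (- (2 * nu)) * tau `^ (nu - 1))) /\
  \int[leb]_(tau in `]0, t[) ((t - tau) `^ (- (2 * nu)) * tau `^ (nu - 1)) =
  Gamma (1 - 2 * nu) * Gamma nu / Gamma (1 - nu) * t `^ (- nu).
Proof.
move=> ne t0; have [m01 _] := caputo_order ne.
have a01 : 0 < nu < 1 by rewrite nu0.
have nu10 : 0 < 1 - nu by rewrite subr_gt0.
have G0 := lt0r_neq0 (Gamma_gt0 nu10).
pose g (s : R) := s `^ (nu - 1).
have cg s : 0 < s -> {for s, continuous g}.
  by move=> s0; exact: is_derive_continuous (der_pow (nu - 1) s0).
have gK (s : R) : 0 < s -> `|g s| <= 1 * s `^ (nu - 1).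
  by move=> s0; rewrite mul1r ger0_norm ?powR_ge0.
have ia s (s0 : 0 < s) := integrable_abel m01 a01 cg gK s0.
split; first exact: ia.
have lc p (p0 : 0 < p) := laplace_convolution m01 p0 (laplace_pow nu0 p0).1 ia.
have lp p (p0 : 0 < p) := laplace_pow nu10 p0.
pose k := Gamma (1 - 2 * nu) * Gamma nu / Gamma (1 - nu).
have E s : s `^ (- nu) = s `^ (1 - nu - 1) by rewrite addrAC subrr add0r.
apply: (@lerch R (fun t => \int[leb]_(tau in `]0, t[) ((t - tau) `^ (- (2 * nu)) * g tau))
  (fun t => k * t `^ (- nu))) => //.
- by move=> s s0; exact: (continuous_abel m01 a01 cg gK s0).
- move=> s s0; apply: cvgM; first exact: cvg_cst.
  exact: is_derive_continuous (der_pow (- nu) s0).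
- by move=> p p0; case: (lc p p0).
- move=> p p0; apply: eq_laplace_integrable (laplace_integrableZl k (lp p p0).1) => s _.
  by rewrite E.
- move=> p p0; rewrite (lc p p0).2 (laplace_pow nu0 p0).2.
  rewrite (@eq_laplace _ _ (fun s => k * s `^ (1 - nu - 1))); last by move=> s _; rewrite E.
  rewrite (laplaceZl _ (lp p p0).1) (lp p p0).2.
  have -> : p `^ (- (1 - nu)) = p `^ (2 * nu - 1) * p `^ (- nu).
    by rewrite !powR_expR_ln// -expRD; congr expR; ring.
  by rewrite /k; move: G0; move: (Gamma (1 - nu)) => G G0; field.
Qed.

Lemma caputo_power (c t : R) : 0 < t ->
  caputo_derivable (2 * nu) (fun t => c * t `^ nu) t /\
  caputo (2 * nu) (fun t => c * t `^ nu) t =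
  c * Gamma (1 + nu) / Gamma (1 - nu) * t `^ (- nu).
Proof.
move=> t0.
have d (s : R) : 0 < s -> is_derive s 1 (fun t => c * t `^ nu) (c * nu * s `^ (nu - 1)).
  by move=> s0; der; ring.
have E (s : R) (s0 : 0 < s) := is_derive_derive1 (d s s0).
have Gr : Gamma (1 + nu) = nu * Gamma nu by rewrite addrC Gamma_rec_pos.
rewrite /caputo_derivable /caputo; case: eqP => [e|/eqP ne].
  split; first by case: (d t t0).
  have e1 : nu - 1 = - nu by lra.
  have e2 : 1 - nu = nu by lra.
  rewrite E// Gr e1 e2; have := lt0r_neq0 (Gamma_gt0 nu0).
  by move: (Gamma nu) => G G0; field.
have [i I] := abel_power ne t0; have [m01 _] := caputo_order ne.
have G0 : 0 < Gamma (1 - 2 * nu) by rewrite Gamma_gt0// subr_gt0; case/andP: m01.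
have mI := measurable_itv (`]0, t[ : interval R).
have EI (tau : R) : `]0, t[%classic tau -> c * nu * ((t - tau) `^ (- (2 * nu)) * tau `^ (nu - 1)) =
    (t - tau) `^ (- (2 * nu)) * derive1 (fun t => c * t `^ nu) tau.
  by rewrite /= in_itv/= => /andP[tau0 _]; rewrite E//; ring.
split.
  split; first by move=> tau /andP[tau0 _]; case: (d tau tau0).
  exact: eq_leb_integrable EI (leb_integrableZl (c * nu) mI i).
rewrite -(eq_leb_Rintegral EI) (leb_RintegralZl (c * nu) mI i) I Gr.
have := lt0r_neq0 G0; move: (Gamma (1 - 2 * nu)) (Gamma (1 - nu))^-1 => G H GG.
by field.
Qed.

Variables (f ft fx fxx : R -> R -> R).
Hypothesis F : fundamental_solution nu f ft fx fxx.
Variables (u0 : R) (u : R -> R -> R).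
Hypothesis uE : forall x t, 0 < x -> 0 < t -> u x t = u0 + (1 - u0) * f x t.

Let k := 1 - u0.

Let uEt (x : R) : 0 < x -> forall t, 0 < t -> u0 + k * f x t = u x t.
Proof. by move=> x0 t t0; rewrite uE. Qed.

Let uEx (t : R) : 0 < t -> forall x, 0 < x -> u0 + k * f x t = u x t.
Proof. by move=> t0 x x0; rewrite uE. Qed.

Lemma solution_dt (x t : R) : 0 < x -> 0 < t -> is_derive t 1 (u x) (k * ft x t).
Proof.
move=> x0 t0; apply: (is_derive_pos (uEt x0) t0).
by have h := fund_dt F x0 t0; der; rewrite mul0r !add0r.
Qed.

Lemma solution_dx (x t : R) : 0 < x -> 0 < t ->
  [/\ twice_derivable (u ^~ t) x, dx u x t = k * fx x t & dxx u x t = k * fxx x t].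
Proof.
move=> x0 t0.
have d1 (y : R) : 0 < y -> is_derive y 1 (fun y => u0 + k * f y t) (k * fx y t).
  by move=> y0; have h := fund_dx F y0 t0; der; rewrite mul0r !add0r.
have d2 (y : R) : 0 < y -> is_derive y 1 (fun y => k * fx y t) (k * fxx y t).
  by move=> y0; have h := fund_dxx F y0 t0; der; rewrite mul0r !add0r.
exact: (twice_derivable_pos (uEx t0) d1 d2 x0).
Qed.

Lemma solution_diffusion (x t : R) : 0 < x -> 0 < t -> diffusion_eq nu u x t.
Proof.
move=> x0 t0; have [tw _ Exx] := solution_dx x0 t0.
have E (s : R) (s0 : 0 < s) := is_derive_derive1 (solution_dt x0 s0).
rewrite /diffusion_eq Exx /caputo_derivable /caputo; case: eqP => [e|/eqP ne].
  split => //; first by case: (solution_dt x0 t0).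
  by rewrite E// (fund_heat F)//; lra.
have [m01 nlt] := caputo_order ne; have [i I] := fund_abel F nlt x0 t0.
have G0 : 0 < Gamma (1 - 2 * nu) by rewrite Gamma_gt0// subr_gt0; case/andP: m01.
have mI := measurable_itv (`]0, t[ : interval R).
have EI (tau : R) : `]0, t[%classic tau -> k * ((t - tau) `^ (- (2 * nu)) * ft x tau) =
    (t - tau) `^ (- (2 * nu)) * derive1 (u x) tau.
  by rewrite /= in_itv/= => /andP[tau0 _]; rewrite E//; ring.
split => //.
  split; first by move=> tau /andP[tau0 _]; case: (solution_dt x0 tau0).
  exact: eq_leb_integrable EI (leb_integrableZl k mI i).
rewrite -(eq_leb_Rintegral EI) (leb_RintegralZl k mI i) I.
by rewrite [k * (_ * _)]mulrCA mulKf// lt0r_neq0.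
Qed.

(** The converse of uniqueness. *)
Lemma solution_half_line : (forall t, 0 < t -> u 0 t = 1) ->
  (forall x, 0 <= x -> u x 0 = u0 * \1_(`]0, +oo[%classic : set R) x) ->
  half_line_solution nu u0 u.
Proof.
move=> ub ui.
have E (x s : R) (x0 : 0 < x) (s0 : 0 < s) := is_derive_derive1 (solution_dt x0 s0).
split.
- move=> x t x0 t0; split; first exact: solution_diffusion.
  apply: (@continuous_pos _ (fun s => k * ft x s)) => //; first by move=> s s0; rewrite E.
  by apply: cvgM; [exact: cvg_cst|exact: fund_ft_continuous F x t x0 t0].
- split => // x x0; rewrite ui ?(ltW x0)// indicE mem_set ?mulr1; last exact/posP.
  apply: (cvg_at_right_pos (uEt x0)).
  have h : u0 + k * f x t @[t --> 0^'+] --> u0 + k * 0.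
    apply: cvgD; first exact: cvg_cst.
    by apply: cvgM; [exact: cvg_cst|exact: fund_initial F x x0].
  by rewrite mulr0 addr0 in h.
- move=> t t0; rewrite ub//; split => //; apply: (cvg_at_right_pos (uEx t0)).
  have h : u0 + k * f x t @[x --> (0 : R)^'+] --> u0 + k * 1.
    apply: cvgD; first exact: cvg_cst.
    by apply: cvgM; [exact: cvg_cst|exact: fund_boundary F t t0].
  by rewrite (_ : u0 + k * 1 = 1) in h; last by rewrite /k; ring.
- have [M HM] := fund_bounded F; exists (`|u0| + `|k| * M) => x t x0 t0.
  rewrite uE//; apply: (le_trans (ler_normD _ _)); rewrite lerD2l normrM.
  by rewrite ler_wpM2l// HM.
- move=> x s x0 s0.
  have [i1 E1] := laplace_cst u0 s0.
  have Lu (y : R) : 0 < y -> u0 / s + k * (s^-1 * expR (- (y * s `^ nu))) = laplace (u y) s.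
    move=> y0; have [i2 E2] := fund_laplace F y0 s0.
    rewrite -(eq_laplace _ (uEt y0)) (laplaceD i1 (laplace_integrableZl k i2)).
    by rewrite (laplaceZl _ i2) E1 E2.
  have [ixx Exx] := fund_laplace_xx F x0 s0.
  have Edxx (t : R) : 0 < t -> k * fxx x t = dxx u x t.
    by move=> t0; have [_ _ ->] := solution_dx x0 t0.
  have ss : s `^ nu * s `^ nu = s `^ (2 * nu - 1) * s.
    by rewrite !powR_expR_ln// -[X in _ = _ * X](@lnK R s)// -!expRD; congr expR; ring.
  have d1 (y : R) : 0 < y -> is_derive y 1 (fun y => u0 / s + k * (s^-1 * expR (- (y * s `^ nu))))
      (- (k * (s^-1 * (expR (- (y * s `^ nu)) * s `^ nu)))) by move=> _; der; ring.
  have d2 (y : R) : 0 < y -> is_derive y 1 (fun y => - (k * (s^-1 * (expR (- (y * s `^ nu)) * s `^ nu))))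
      (k * (s^-1 * (expR (- (y * s `^ nu)) * (s `^ nu * s `^ nu)))) by move=> _; der; ring.
  have [tw _ E2] := twice_derivable_pos Lu d1 d2 x0.
  split => //.
  + apply: eq_laplace_integrable (laplace_integrableZl k (fund_laplace_t F x0 s0)) => t t0.
    by rewrite E.
  + exact: eq_laplace_integrable Edxx (laplace_integrableZl k ixx).
  + rewrite E2 -(eq_laplace _ Edxx) (laplaceZl _ ixx) Exx ss; field.
    by rewrite lt0r_neq0.
Qed.

End assembly.

Theorem mainTheorem2 (R : realType) (nu r u0 alpha : R)
    (nu_gt0 : 0 < nu) (nu_le : nu <= 2^-1) (r_gt0 : 0 < r)
    (alpha_gt0 : 0 < alpha) :
  let eta := fun t : R => 2 * alpha * t `^ nu in
  let W1 := Wright (- (2 * alpha)) (- nu) 1 in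
  let W2 := Wright (- (2 * alpha)) (- nu) (1 - nu) in
  let boundary_eq := W1 = - (u0 / (1 - u0)) in
  let stefan_eq :=
    2 * alpha * r * Gamma (1 + nu) / ((1 - u0) * Gamma (1 - nu)) = W2 in
  let transcendental_eq :=
    2 * alpha * r * Gamma (1 + nu) / Gamma (1 - nu) * (1 - W1) = W2 in
  let solution := fun x t : R => (Rfun 1 nu x t - W1) / (1 - W1) in
  [/\ (* what the two conditions on the moving boundary become *)
      u0 != 1 -> forall u : R -> R -> R, half_line_solution nu u0 u ->
        (moving_boundary_condition u eta <-> boundary_eq) /\
        (stefan_condition nu r u eta <-> stefan_eq),
      (* the resulting expressions for u0 and the equation for alpha *)
      u0 != 1 -> boundary_eq ->
        [/\ u0 = - (W1 / (1 - W1)), 1 - u0 = 1 / (1 - W1) &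
            (stefan_eq <-> transcendental_eq)],
      (* a solution is necessarily given by the formula *)
      forall u : R -> R -> R, half_line_solution nu u0 u ->
        stefan_problem nu r u0 u eta ->
        [/\ u0 = - (W1 / (1 - W1)), 1 - u0 = 1 / (1 - W1),
            transcendental_eq &
            forall x t, 0 <= x -> 0 < t -> u x t = solution x t] &
      (* the formula does give a solution *)
      u0 != 1 -> boundary_eq -> transcendental_eq ->
        forall u : R -> R -> R,
          (forall x t, 0 <= x -> 0 < t -> u x t = solution x t) ->
          (forall x, 0 <= x ->
             u x 0 = u0 * \1_(`]0, +oo[%classic : set R) x) ->
          half_line_solution nu u0 u /\ stefan_problem nu r u0 u eta].

Proof.
move=> eta W1 W2 boundary_eq stefan_eq transcendental_eq solution.
have [f [ft [fx [fxx F]]]] := exists_fundamental_solution nu_gt0 nu_le.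
have nu1 : 0 < 1 - nu.
  by rewrite subr_gt0 (le_lt_trans nu_le)// invf_lt1// ltr1n.
have G0 : 0 < Gamma (1 - nu) by exact: Gamma_gt0.
have tn (t : R) (t0 : 0 < t) : 0 < t `^ nu := powR_gt0 nu t0.
have eta_gt0 (t : R) : 0 < t -> 0 < eta t by move=> t0; rewrite /eta !mulr_gt0// tn.
have zE (t : R) : 0 < t -> eta t * t `^ (- nu) = 2 * alpha.
  by move=> t0; rewrite /eta powRN mulfK// lt0r_neq0// tn.
(* At x = eta t the variable x t^{-nu} is the constant 2 alpha, so both conditions
   on the moving boundary are independent of t. *)
have part1 (v : R -> R -> R) :
    (forall x t, 0 < x -> 0 < t -> v x t = u0 + (1 - u0) * f x t) ->
    (moving_boundary_condition v eta <-> u0 + (1 - u0) * W1 = 0) /\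
    (stefan_condition nu r v eta <->
      2 * alpha * r * Gamma (1 + nu) / Gamma (1 - nu) = (1 - u0) * W2).
  move=> vE.
  have vW (t : R) : 0 < t -> v (eta t) t = u0 + (1 - u0) * W1.
    by move=> t0; rewrite (vE _ _ (eta_gt0 t t0) t0) (fund_Wright F (eta_gt0 t t0) t0) zE.
  have dxW (t : R) : 0 < t -> dx v (eta t) t = - ((1 - u0) * (t `^ (- nu) * W2)).
    move=> t0; have [_ -> _] := solution_dx F vE (eta_gt0 t t0) t0.
    by rewrite (fund_Wright_x F (eta_gt0 t t0) t0) zE// mulrN.
  split.
    split=> [h|h t t0]; last by rewrite vW.
    by rewrite -(vW 1 ltr01) h.
  have tm (t : R) : 0 < t -> t `^ (- nu) != 0 by move=> t0; rewrite lt0r_neq0// powR_gt0.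
  have eqv (t : R) : 0 < t -> (caputo (2 * nu) eta t = - (r^-1 * dx v (eta t) t) <->
      2 * alpha * r * Gamma (1 + nu) / Gamma (1 - nu) = (1 - u0) * W2).
    move=> t0; rewrite (caputo_power nu_gt0 nu_le (2 * alpha) t0).2 dxW//.
    have T0 := tm t t0; have r0 := lt0r_neq0 r_gt0.
    move: (t `^ (- nu)) T0 (Gamma (1 - nu))^-1 => T T0 G.
    have -> : - (r^-1 * - ((1 - u0) * (T * W2))) = r^-1 * T * ((1 - u0) * W2) by ring.
    have -> : 2 * alpha * Gamma (1 + nu) * G * T =
      r^-1 * T * (2 * alpha * r * Gamma (1 + nu) * G) by field.
    split=> [|->//]; apply: mulfI.
    by rewrite mulf_neq0 ?invr_eq0.
  split=> [h|h t t0]; first by apply/(eqv 1 ltr01); case: (h 1 ltr01).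
  split; last exact/eqv.
    exact: (caputo_power nu_gt0 nu_le (2 * alpha) t0).1.
  have [[h1 _] _ _] := solution_dx F vE (eta_gt0 t t0) t0.
  exact: nbhs_singleton h1.
have eq1 : u0 != 1 -> (u0 + (1 - u0) * W1 = 0 <-> boundary_eq).
  rewrite eq_sym -subr_eq0 => k0; rewrite /boundary_eq; split=> h.
    by apply: (mulfI k0); rewrite mulrN mulrCA divff// mulr1; lra.
  by rewrite h mulrN mulrCA divff// mulr1 subrr.
have eq2 : u0 != 1 -> (2 * alpha * r * Gamma (1 + nu) / Gamma (1 - nu) = (1 - u0) * W2 <-> stefan_eq).
  rewrite eq_sym -subr_eq0 => k0; rewrite /stefan_eq invfM.
  move: (Gamma (1 - nu))^-1 => G; split=> h.
    by apply: (mulfI k0); rewrite -h; field.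
  by rewrite -h; field.
have part2 : u0 != 1 -> boundary_eq -> [/\ u0 = - (W1 / (1 - W1)), 1 - u0 = 1 / (1 - W1) &
    (stefan_eq <-> transcendental_eq)].
  move=> u1; have k0 : 1 - u0 != 0 by rewrite subr_eq0 eq_sym.
  rewrite /boundary_eq => E.
  have E1 : 1 - W1 = (1 - u0)^-1 by rewrite E; field.
  rewrite /stefan_eq /transcendental_eq E1 !invrK mul1r; split => //.
    by rewrite E; field.
  suff -> : 2 * alpha * r * Gamma (1 + nu) / ((1 - u0) * Gamma (1 - nu)) =
    2 * alpha * r * Gamma (1 + nu) / Gamma (1 - nu) / (1 - u0) by [].
  by rewrite invfM; ring.
have part1' (v : R -> R -> R) : u0 != 1 ->
    (forall x t, 0 < x -> 0 < t -> v x t = u0 + (1 - u0) * f x t) ->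
    (moving_boundary_condition v eta <-> boundary_eq) /\
    (stefan_condition nu r v eta <-> stefan_eq).
  move=> u1 /part1 [h1 h2]; split.
    by split=> [/h1/(eq1 u1)|/(eq1 u1)/h1].
  by split=> [/h2/(eq2 u1)|/(eq2 u1)/h2].
have sol0 (t : R) : u0 != 1 -> boundary_eq -> 0 < t -> solution 0 t = 1.
  move=> u1 E t0; rewrite /solution (Rfun_0 F t0) divff//.
  have [_ h _] := part2 u1 E; apply: contra_neq u1 => h0.
  by move: h; rewrite h0 invr0 mulr0; lra.
have solE (x t : R) : u0 != 1 -> boundary_eq -> 0 < x -> 0 < t -> solution x t = u0 + (1 - u0) * f x t.
  move=> u1 E x0 t0; rewrite /solution (Rfun_gt0 F x0 t0).
  have [a1 a2 _] := part2 u1 E; rewrite a2 div1r mulrBl mulrC.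
  by rewrite [in RHS]a1 addrC.
split => //.
- by move=> u1 v hv; exact: part1' u1 (uniqueness nu_gt0 nu_le F hv).
- move=> v hv [_ _ _ mb sc]; have vE := uniqueness nu_gt0 nu_le F hv.
  (* For u0 = 1 the solution is constant, equal to 1, and cannot vanish at eta t. *)
  have u1 : u0 != 1.
    apply: contraTneq isT => e1; have := mb 1 ltr01.
    by rewrite vE ?eta_gt0// e1 subrr mul0r addr0 => /eqP; rewrite oner_eq0.
  have [h1 h2] := part1' v u1 vE; have be := h1.1 mb; have [a1 a2 a3] := part2 u1 be.
  split => //; first exact/a3/h2.
  move=> x t; rewrite le_eqVlt => /predU1P[<-|x0] t0; last by rewrite solE// vE.
  rewrite sol0//; have [_ _ B _ _] := hv; by case: (B t t0).
- move=> u1 be te v vs vi.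
  have vE (x t : R) : 0 < x -> 0 < t -> v x t = u0 + (1 - u0) * f x t.
    by move=> x0 t0; rewrite vs ?(ltW x0)// solE.
  have v0 (t : R) : 0 < t -> v 0 t = 1 by move=> t0; rewrite vs// sol0.
  have hv := solution_half_line nu_gt0 nu_le F vE v0 vi.
  have [h1 h2] := part1' v u1 vE; have [_ _ a3] := part2 u1 be.
  split; first exact: hv.
  have [_ ic fb _ _] := hv; split; [|exact: ic|exact: fb| | ].
  + move=> x t t0 /andP[x0 _].
    have h : diffusion_eq nu v x t := solution_diffusion nu_gt0 nu_le F vE x0 t0.
    exact: h.
  + exact: h1.2.
  + exact/h2/a3.
Qed.
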